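(* Let $M$ be a smooth manifold of finite dimension $n$, let $\mathrm{Lor}\to M$ be the bundle of fibre-wise lorentzian metrics, let $L = R\,\mathrm{vol}_g\in\Omega^{0,n}(J^\infty\mathrm{Lor})$ be the Hilbert-Einstein lagrangian form, and let $$\gamma = g^{ad}g^{bc}(\nabla_c\,\delta g_{ab}-\nabla_a\,\delta g_{bc})\wedge \iota_{\hat\partial_d}\mathrm{vol}_g\in\Omega^{1,n-1}(J^\infty\mathrm{Lor})$$ be its boundary form. Then the Lepage form $L+\gamma$ is invariant under the action $\rho:\mathcal{X}(M)\to\mathcal{X}(J^\infty\mathrm{Lor})$, $\rho(v)=\xi_v+\hat v$, of spacetime vector fields, i.e. $$\mathcal{L}_{\rho(v)}(L+\gamma)=0\qquad\text{for all } v\in\mathcal{X}(M).$$ In other words, $\rho$ is a manifest diffeomorphism symmetry of the local lagrangian field theory $(M,\mathrm{Lor},L)$ with boundary form $\gamma$.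
   Context: Manifolds are smooth, finite-dimensional and second countable. $\mathrm{Lor}\to M$ is the bundle whose fibre over $x$ is the set of metrics of signature $(-1,1,\dots,1)$ on $T_xM$. $J^\infty\mathrm{Lor}$ is its infinite jet bundle (a pro-manifold). Its de Rham complex is bigraded (the variational bicomplex): $\Omega^{p,q}(J^\infty\mathrm{Lor})$ has vertical degree $p$ and horizontal degree $q$; $\delta$ is the vertical and $d$ the horizontal differential, and $\mathbf{d}=\delta+d$ is the total differential. $\mathcal{X}(\cdot)$ denotes the Lie algebra of vector fields. For a vector field $X$, $\mathcal{L}_X=[\iota_X,\mathbf{d}]$ (graded commutator). Repeated indices are summed. Local coordinates. Coordinates $x^a$ on an open subset of $M$ induce jet coordinates $g_{ab,C}(j^\infty_x\eta)=\partial^{|C|}\eta_{ab}/\partial x^C|_x$ ($C$ a multi-index, $g_{ab}=g_{ba}$, $\eta_{ab}$ the components of the metric $\eta$). One has $\delta x^a=0$, $d g_{ab,C}=g_{ab,Ce}\,dx^e$, $d\,\delta g_{ab,C}=-\delta g_{ab,Ce}\wedge dx^e$. The horizontal lift by the Cartan connection of $\partial_a=\partial/\partial x^a$ is the vector field $\hat\partial_a$ determined by $\iota_{\hat\partial_a}dx^b=\delta^b_a$, $\iota_{\hat\partial_a}\delta g_{bc,D}=0$ (it is the total derivative); the horizontal lift of $v=v^a\partial_a\in\mathcal{X}(M)$ is $\hat v=v^a\hat\partial_a$. A vector field $\xi$ on the infinite jet bundle is strictly vertical if $[\iota_\xi,d]=0$ and strictly horizontal if $[\iota_\xi,\delta]=0$.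 For $v\in\mathcal{X}(M)$, $\xi_v$ is the strictly vertical vector field on $J^\infty\mathrm{Lor}$ induced by the action $\eta\mapsto-\mathcal{L}_v\eta$ on metrics: $\mathcal{L}_{\xi_v}x^a=0$ and $\mathcal{L}_{\xi_v}g_{ab,C}=\hat\partial_C\,\xi_{ab}$ with $$\xi_{ab}=-\Bigl(v^cg_{ab,c}+\frac{\partial v^{c}}{\partial x^a}g_{cb}+\frac{\partial v^{c}}{\partial x^b}g_{ac}\Bigr),$$ where $\hat\partial_C=(\hat\partial_1)^{C_1}\cdots(\hat\partial_n)^{C_n}$. The map $\rho(v)=\xi_v+\hat v$ is a homomorphism of Lie algebras. $(g^{ab})$ is the inverse matrix of $(g_{ab})$; $\Gamma^a_{bc}=\tfrac12g^{ad}(g_{db,c}+g_{dc,b}-g_{bc,d})$; $\nabla_c\,\delta g_{ab}=\mathcal{L}_{\hat\partial_c}\delta g_{ab}-\Gamma^e_{ca}\delta g_{eb}-\Gamma^e_{cb}\delta g_{ae}$; the metric volume form is the $(0,n)$-form $\mathrm{vol}_g=\sqrt{-\det g}\;dx^1\wedge\dots\wedge dx^n$; $$\mathrm{Riem}_{abc}{}^d=\hat\partial_b\Gamma^d_{ac}-\hat\partial_a\Gamma^d_{bc}+\Gamma^e_{ac}\Gamma^d_{eb}-\Gamma^e_{bc}\Gamma^d_{ea},$$ $\mathrm{Ric}_{ab}=\mathrm{Riem}_{aeb}{}^e$, $R=g^{ab}\mathrm{Ric}_{ab}$. These are functions and forms on $J^\infty\mathrm{Lor}$. The Euler-Lagrange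 form is $EL=-(\mathrm{Ric}^{ab}-\tfrac12Rg^{ab})\,\delta g_{ab}\wedge\mathrm{vol}_g$, and $EL-\delta L=d\gamma$. Manifest diffeomorphism symmetry: for a local lagrangian field theory $(M,F,L)$ ($F\to M$ a fibre bundle, $L\in\Omega^{0,n}(J^\infty F)$) with boundary form $\gamma\in\Omega^{1,n-1}(J^\infty F)$ (i.e. $EL-\delta L=d\gamma$ with $EL$ the Euler-Lagrange form), it is a homomorphism of Lie algebras $\rho:\mathcal{X}(M)\to\mathcal{X}(J^\infty F)$ of the form $\rho(v)=\xi_v+\hat v$, with $\xi_v$ strictly vertical and $\hat v$ the horizontal lift of $v$ by the Cartan connection, such that $\mathcal{L}_{\rho(v)}(L+\gamma)=0$ for all $v$. *)

(* Defs.v *)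
From HB Require Import structures.
From mathcomp Require Import all_boot all_order all_algebra.
From mathcomp Require Import all_classical all_reals.
From mathcomp Require Import topology normedtype derive.

Set Implicit Arguments.
Unset Strict Implicit.
Unset Printing Implicit Defensive.

Import Order.TTheory GRing.Theory Num.Theory.
Import numFieldNormedType.Exports.

Local Open Scope classical_set_scope.
Local Open Scope ring_scope.

(** * Calculus on R^n *)

Definition multi_index (n : nat) := {ffun 'I_n -> nat}.

Definition mi0 (n : nat) : multi_index n := [ffun=> 0%N].

Definition mi_add1 (n : nat) (C : multi_index n) (a : 'I_n) : multi_index n :=
  [ffun b => (C b + (b == a))%N].

Definition mi_size (n : nat) (C : multi_index n) : nat := (\sum_a C a)%N.

Section Euclidean.
Context {R : realType}.

Definition partial (m : nat) (a : 'I_m) (f : 'rV[R]_m -> R) : 'rV[R]_m -> R :=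
  fun x => 'D_(delta_mx 0 a) f x.

Definition partial_mi (m : nat) (C : multi_index m) (f : 'rV[R]_m -> R) :
    'rV[R]_m -> R :=
  foldr (fun a h => iter (C a) (partial a) h) f (enum 'I_m).

(* f is C^oo at every point of A: all iterated partial derivatives of f are
   differentiable there.  Only used for open sets A. *)
Definition smooth_on (m : nat) (A : set 'rV[R]_m) (f : 'rV[R]_m -> R) : Prop :=
  forall (s : seq 'I_m) (x : 'rV[R]_m), A x -> differentiable (foldr (@partial m) f s) x.

(* Lie bracket of vector fields on an open subset of R^n. *)
Definition bracket (n : nat) (v w : 'rV[R]_n -> 'rV[R]_n) : 'rV[R]_n -> 'rV[R]_n :=
  fun x => 'D_(v x) w x - 'D_(w x) v x.

End Euclidean.

(** * Smooth manifolds *)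

Record manifold (R : realType) (n : nat) := Manifold {
  carrier : topologicalType;
  chart : Type;
  dom : chart -> set carrier;
  phi : chart -> carrier -> 'rV[R]_n;
  psi : chart -> 'rV[R]_n -> carrier;
  _ : hausdorff_space carrier;
  _ : @second_countable carrier;
  _ : forall x : carrier, exists i, dom i x;
  _ : forall i, open (dom i);
  _ : forall i, open (phi i @` dom i);
  _ : forall i x, dom i x -> psi i (phi i x) = x;
  _ : forall i, {within dom i, continuous (phi i)};
  _ : forall i, {within phi i @` dom i, continuous (psi i)};
  _ : forall i j (a : 'I_n), smooth_on (phi i @` (dom i `&` dom j))
        (fun x => phi j (psi i x) 0 a)
}.

Section Manifold.
Context {R : realType} {n : nat} (M : manifold R n).

Definition cod (i : chart M) : set 'rV[R]_n := phi i @` dom i.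

Definition overlap (i j : chart M) : set 'rV[R]_n := phi i @` (dom i `&` dom j).

Definition transition (i j : chart M) (x : 'rV[R]_n) : 'rV[R]_n := phi j (psi i x).

(* Vector fields on M through their components in the charts.  The library's
   Jacobian acts on row vectors from the right: 'D_u f x = u *m 'J f x. *)
Record vfield := VField {
  vcomp :> chart M -> 'rV[R]_n -> 'rV[R]_n;
  _ : forall i a, smooth_on (cod i) (fun x => vcomp i x 0 a);
  _ : forall i j x, overlap i j x ->
        vcomp j (transition i j x) = vcomp i x *m 'J (transition i j) x
}.

End Manifold.

(** * Jet coordinates *)

(* Unordered pairs {a, b}, encoded as ordered ones, so that g_{ab,C} and
   g_{ba,C} are the same coordinate. *)
Definition upair (n : nat) := {ab : 'I_n * 'I_n | (ab.1 <= ab.2)%N}.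

Lemma mk_upair_subproof (n : nat) (a b : 'I_n) :
  let ab := if (a <= b)%N then (a, b) else (b, a) in (ab.1 <= ab.2)%N.
Proof. by case: leqP => //= /ltnW. Qed.

Definition mk_upair (n : nat) (a b : 'I_n) : upair n :=
  exist (fun ab : 'I_n * 'I_n => ab.1 <= ab.2)%N _ (mk_upair_subproof a b).

(* The coordinates of the jet bundle over a chart: inl a is x^a and
   inr (ab, C) is g_{ab,C}. *)
Definition coord (n : nat) : Type := ('I_n + upair n * multi_index n)%type.

(* Coordinate space of the infinite jet bundle; its tangent vectors have the
   same coordinates. *)
Notation jspace R n := (coord n -> R).

(* Differential forms on (an open subset of) the coordinate space: the value of
   a form of degree k at a point p on k tangent vectors.  Arguments of all
   lengths are allowed, so this also accommodates inhomogeneous forms. *)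
Notation jet_form R n := (jspace R n -> seq (jspace R n) -> R).

Section Jets.
Context {R : realType} {n : nat}.
Implicit Types (p V W : jspace R n) (f h : jspace R n -> R)
  (X Y : jspace R n -> jspace R n) (w : jet_form R n) (a b c d e : 'I_n).

Definition basept p : 'rV[R]_n := \row_a p (inl a).

Definition gjet a b (C : multi_index n) p : R := p (inr (mk_upair a b, C)).

Definition gmx p : 'M[R]_n := \matrix_(a, b) gjet a b (mi0 n) p.

(* Signature (-1, 1, ..., 1). *)
Definition lorentzian (G : 'M[R]_n) : Prop :=
  (0 < n)%N /\ exists2 P : 'M[R]_n, P \in unitmx &
    P *m G *m P^T = diag_mx (\row_(a < n) if a == 0%N :> nat then -1 else 1).

(* Directional derivative of f at p along V. *)
Definition dirder f V p : R := derive1 (fun t : R => f (p + t *: V)) 0.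

(* Smooth functions on an open subset D of the pro-manifold: pullbacks of smooth
   functions of finitely many jet coordinates. *)
Definition jsmooth_on (D : set (jspace R n)) f : Prop :=
  exists (m : nat) (K : 'I_m -> coord n) (F : 'rV[R]_m -> R),
    [/\ injective K,
        smooth_on [set (\row_j p (K j)) | p in D] F
      & forall p, D p -> f p = F (\row_j p (K j))].

(* Differential forms of finite order on D. *)
Definition jform_on (D : set (jspace R n)) w : Prop :=
  [/\ forall p (s1 s2 : seq (jspace R n)) (k : R) V W, D p ->
        w p (s1 ++ (k *: V + W) :: s2) = k * w p (s1 ++ V :: s2) + w p (s1 ++ W :: s2),
      forall p s1 s2 V, D p -> w p (s1 ++ V :: V :: s2) = 0,
      exists K : seq (coord n), forall p s s', D p ->
        [seq [seq V i | i <- K] | V <- s] = [seq [seq V i | i <- K] | V <- s'] ->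
        w p s = w p s'
    & forall s, jsmooth_on D (fun p => w p s)].

(** ** Exterior calculus *)

Definition form0 f : jet_form R n := fun p s => if s is [::] then f p else 0.

Definition fscale f w : jet_form R n := fun p s => f p * w p s.

(* Wedge product of multilinear alternating functions, by the recursion
   i_V (al /\ be) = i_V al /\ be + (-1)^|al| al /\ i_V be. *)
Fixpoint wedge_at (al be : seq (jspace R n) -> R) (s : seq (jspace R n)) : R :=
  if s is V :: s' then
    wedge_at (fun t => al (V :: t)) be s' +
    wedge_at (fun t => (-1) ^+ size t * al t) (fun t => be (V :: t)) s'
  else al [::] * be [::].

Definition wedge (w1 w2 : jet_form R n) : jet_form R n :=
  fun p s => wedge_at (w1 p) (w2 p) s.

Definition iprod X w : jet_form R n := fun p s => w p (X p :: s).

(* The total differential, evaluated on constant vector fields. *)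
Definition ext w : jet_form R n := fun p s =>
  \sum_(i < size s)
    (-1) ^+ i * dirder (fun q => w q (take i s ++ drop i.+1 s)) (nth 0 s i) p.

Definition lie X w : jet_form R n := iprod X (ext w) + ext (iprod X w).

Definition jbracket X Y : jspace R n -> jspace R n := fun p i =>
  dirder (fun q => Y q i) (X p) p - dirder (fun q => X q i) (Y p) p.

(** ** Cartan connection and variational bicomplex *)

(* Horizontal lift of the a-th coordinate vector field. *)
Definition hpartial a : jspace R n -> jspace R n := fun p i =>
  match i with
  | inl b => (b == a)%:R
  | inr (bc, C) => p (inr (bc, mi_add1 C a))
  end.

Definition hlift (v : 'rV[R]_n -> 'rV[R]_n) : jspace R n -> jspace R n :=
  fun p => \sum_a v (basept p) 0 a *: hpartial a p.

Definition hor p V : jspace R n := \sum_a V (inl a) *: hpartial a p.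

Definition ver p V : jspace R n := V - hor p V.

(* Component of vertical degree k of a form: the sum, over all ways of choosing
   k of the arguments, of its values on the vertical parts of the chosen
   arguments and the horizontal parts of the others. *)
Fixpoint vproj_at p (k : nat) (al : seq (jspace R n) -> R)
    (s : seq (jspace R n)) : R :=
  if s is V :: s' then
    vproj_at p k (fun t => al (hor p V :: t)) s' +
    (if k is k'.+1 then vproj_at p k' (fun t => al (ver p V :: t)) s' else 0)
  else (k == 0%N)%:R * al [::].

Definition vproj (k : nat) w : jet_form R n := fun p s => vproj_at p k (w p) s.

Definition bidegree_on (D : set (jspace R n)) (k l : nat) w : Prop :=
  forall p s, D p ->
    ((size s != k + l)%N -> w p s = 0) /\ vproj k w p s = w p s.

(* The parts of bidegree (1, 0) and (0, 1) of the total differential. *)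
Definition vdiff w : jet_form R n := fun p s =>
  \sum_(k < size s) vproj k.+1 (ext (vproj k w)) p s.

Definition hdiff w : jet_form R n := fun p s =>
  \sum_(k < size s) vproj k (ext (vproj k w)) p s.

Definition strictly_vertical_on (D : set (jspace R n)) X : Prop :=
  forall w, jform_on D w ->
  forall p s, D p -> (iprod X (hdiff w) + hdiff (iprod X w)) p s = 0.

(** ** General relativity in jet coordinates *)

Definition tot a f : jspace R n -> R := fun p => dirder f (hpartial a p) p.

Definition tot_mi (C : multi_index n) f : jspace R n -> R :=
  foldr (fun a h => iter (C a) (tot a) h) f (enum 'I_n).

Definition g_ a b : jspace R n -> R := gjet a b (mi0 n).

Definition g1_ a b c : jspace R n -> R := gjet a b (mi_add1 (mi0 n) c).

Definition ginv a b : jspace R n -> R := fun p => invmx (gmx p) a b.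

(* Upper index first: Gamma^a_{bc}. *)
Definition Gamma a b c : jspace R n -> R := fun p =>
  2^-1 * \sum_d ginv a d p * (g1_ d b c p + g1_ d c b p - g1_ b c d p).

(* Riem_{abc}^d *)
Definition Riem a b c d : jspace R n -> R := fun p =>
  tot b (Gamma d a c) p - tot a (Gamma d b c) p +
  \sum_e (Gamma e a c p * Gamma d e b p - Gamma e b c p * Gamma d e a p).

Definition Ric a b : jspace R n -> R := fun p => \sum_e Riem a e b e p.

Definition Ric_up a b : jspace R n -> R := fun p =>
  \sum_c \sum_d ginv a c p * ginv b d p * Ric c d p.

Definition scalar_curvature : jspace R n -> R := fun p =>
  \sum_a \sum_b ginv a b p * Ric a b p.

Definition dx a : jet_form R n := ext (form0 (fun p => p (inl a))).

Definition deltag a b : jet_form R n := vdiff (form0 (g_ a b)).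

(* nabla_c delta g_{ab} *)
Definition nabla_deltag c a b : jet_form R n :=
  lie (hpartial c) (deltag a b)
  - \sum_e fscale (Gamma e c a) (deltag e b)
  - \sum_e fscale (Gamma e c b) (deltag a e).

Definition vol : jet_form R n :=
  fscale (fun p => Num.sqrt (- \det (gmx p)))
    (\big[wedge/form0 (fun=> 1)]_(a < n) dx a).

Definition hilbert_lagrangian : jet_form R n := fscale scalar_curvature vol.

Definition hilbert_boundary : jet_form R n :=
  \sum_a \sum_b \sum_c \sum_d
    wedge (fscale (fun p => ginv a d p * ginv b c p)
             (nabla_deltag c a b - nabla_deltag a b c))
          (iprod (hpartial d) vol).

Definition hilbert_EL : jet_form R n :=
  - \sum_a \sum_b
    wedge (fscale (fun p => Ric_up a b p - 2^-1 * scalar_curvature p * ginv a b p)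
             (deltag a b))
          vol.

(* The components xi_{ab} of the infinitesimal action -L_v eta. *)
Definition xi_comp (v : 'rV[R]_n -> 'rV[R]_n) a b : jspace R n -> R := fun p =>
  let dv e c := partial e (fun x => v x 0 c) (basept p) in
  - \sum_c (v (basept p) 0 c * g1_ a b c p + dv a c * g_ c b p + dv b c * g_ a c p).

Definition xi (v : 'rV[R]_n -> 'rV[R]_n) : jspace R n -> jspace R n := fun p i =>
  match i with
  | inl _ => 0
  | inr (ab, C) => tot_mi C (xi_comp v (val ab).1 (val ab).2) p
  end.

End Jets.

(** * The infinite jet bundle of Lor over a manifold *)

Section JetBundle.
Context {R : realType} {n : nat} (M : manifold R n).

(* The part of the infinite jet bundle over the i-th chart. *)
Definition jdom (i : chart M) : set (jspace R n) :=
  [set p | cod i (basept p) /\ lorentzian (gmx p)].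

Definition joverlap (i j : chart M) : set (jspace R n) :=
  [set p | overlap i j (basept p) /\ lorentzian (gmx p)].

(* A polynomial metric with the jet coordinates p up to order k. *)
Definition taylor (k : nat) (p : jspace R n) (y : 'rV[R]_n) : 'M[R]_n :=
  \matrix_(a, b) \sum_(C : {ffun 'I_n -> 'I_k.+1})
    gjet a b [ffun c => C c : nat] p *
    \prod_c ((y - basept p) 0 c ^+ C c / (C c)`!%:R).

(* Components of a metric eta after the change of coordinates whose inverse is
   sigma. *)
Definition change_metric (sigma : 'rV[R]_n -> 'rV[R]_n) (eta : 'rV[R]_n -> 'M[R]_n)
    (z : 'rV[R]_n) : 'M[R]_n :=
  'J sigma z *m eta (sigma z) *m ('J sigma z)^T.

(* Change of jet coordinates.  The derivatives of order |C| of the components of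
   a metric in the chart j depend only on its |C|-jet, so any metric with the
   |C|-jet p can be used. *)
Definition jtransition (i j : chart M) (p : jspace R n) : jspace R n := fun c =>
  match c with
  | inl a => transition i j (basept p) 0 a
  | inr (ab, C) =>
      partial_mi C
        (fun z => change_metric (transition j i) (taylor (mi_size C) p) z
                    (val ab).1 (val ab).2)
        (transition i j (basept p))
  end.

Definition djtransition (i j : chart M) (p V : jspace R n) : jspace R n :=
  fun c => dirder (fun q => jtransition i j q c) V p.

(* Vector fields on the infinite jet bundle. *)
Record jvfield := JVField {
  jvcomp :> chart M -> jspace R n -> jspace R n;
  _ : forall i c, jsmooth_on (jdom i) (fun p => jvcomp i p c);
  _ : forall i j p, joverlap i j p ->
        jvcomp j (jtransition i j p) = djtransition i j p (jvcomp i p)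
}.

(* Forms of bidegree (k, l) on the infinite jet bundle.  On an oriented atlas
   the sign of the Jacobian determinant is 1.  In general it is required by the
   formula sqrt (- det g) dx^1 /\ ... /\ dx^n for the volume form: if M is not
   oriented, lagrangian forms are twisted by the orientation bundle. *)
Record jform (k l : nat) := JForm {
  jfcomp :> chart M -> jet_form R n;
  _ : forall i, jform_on (jdom i) (jfcomp i);
  _ : forall i, bidegree_on (jdom i) k l (jfcomp i);
  _ : forall i j p s, joverlap i j p ->
        jfcomp i p s =
        Num.sg (\det ('J (transition i j) (basept p))) *
        jfcomp j (jtransition i j p) (map (djtransition i j p) s)
}.

(* Equality, on the whole jet bundle, of forms and of vector fields given by
   their chart expressions. *)
Definition eq_jform (w1 w2 : chart M -> jet_form R n) : Prop :=
  forall i p s, jdom i p -> w1 i p s = w2 i p s.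

Definition eq_jvfield (X Y : chart M -> jspace R n -> jspace R n) : Prop :=
  forall i p, jdom i p -> X i p = Y i p.

Definition eq_vfield (v w : chart M -> 'rV[R]_n -> 'rV[R]_n) : Prop :=
  forall i x, cod i x -> v i x = w i x.

Definition lie_algebra_morphism (rho : vfield M -> jvfield) : Prop :=
  (forall (k : R) (u v w : vfield M),
     eq_vfield u (fun i x => k *: v i x + w i x) ->
     eq_jvfield (rho u) (fun i p => k *: rho v i p + rho w i p)) /\
  (forall u v w : vfield M,
     eq_vfield u (fun i => bracket (v i) (w i)) ->
     eq_jvfield (rho u) (fun i => jbracket (rho v i) (rho w i))).

Definition lepage_invariant (L : jform 0 n) (gamma : jform 1 n.-1)
    (rho : vfield M -> jvfield) : Prop :=
  forall v, eq_jform (fun i => lie (rho v i) (L i + gamma i)) (fun=> 0).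

Definition boundary_form (EL : jform 1 n) (L : jform 0 n) (gamma : jform 1 n.-1) :
    Prop :=
  eq_jform (fun i => EL i - vdiff (L i)) (fun i => hdiff (gamma i)).

(* rho (v) = xi_v + hlift v, where xi_v := rho (v) - hlift v. *)
Definition manifest_diffeo_symmetry (EL : jform 1 n) (L : jform 0 n)
    (gamma : jform 1 n.-1) (rho : vfield M -> jvfield) : Prop :=
  [/\ boundary_form EL L gamma,
      lie_algebra_morphism rho,
      forall v i, strictly_vertical_on (jdom i) (fun p => rho v i p - hlift (v i) p)
    & lepage_invariant L gamma rho].

End JetBundle.

(* Main.v *)
From HB Require Import structures.
From mathcomp Require Import all_boot all_order all_algebra.
From mathcomp Require Import all_classical all_reals.
From mathcomp Require Import topology normedtype landau derive realfun.
From mathcomp Require Import ring lra.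
Require Import Defs.

(** The Lagrangian and its boundary form are built from the metric by natural
    operations, so a diffeomorphism which acts on the points of M and on metrics
    at the same time preserves their sum, and rho (v) = xi_v + hlift v generates
    such an action.  In a chart this becomes a statement about tensor densities.
    The Lagrangian is r dx^1 /\ ... /\ dx^n with the density
    r = sqrt (- det g) R, and the boundary form is the sum over d of the products
    of alpha^d with the contraction of dx^1 /\ ... /\ dx^n by the d-th coordinate
    field, where alpha is a vector density with values in vertical 1-forms.  The
    Lie derivative along a field X differentiates the coefficients of a form
    along X and lets the derivative of X act on each argument (lieE).  On the
    horizontal arguments the derivative of rho (v) is the matrix B of first
    derivatives of v, which acts on dx^1 /\ ... /\ dx^n by its trace (dx_top_slot).
    Invariance therefore says that r changes by - tr B r
    (hilbert_density_invariant) and that alpha changes by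
    - tr B alpha + alpha B (alpha_invariant); the terms cancel in lepage_lie.

    Both laws come from the law for the metric, g changes by - (B g + g B^T), which
    is the formula for xi_{ab}.  Taking a total derivative of it shows that the
    Christoffel symbols transform as a tensor up to minus the second derivatives
    of v (Gam_rfield).  In the curvature the second and third derivatives of v
    cancel by their symmetry (DFm_rfield), so R is invariant.  The form alpha is
    sqrt (- det g) times g^{bc} X^d_{bc} - g^{dc} X^b_{bc}, where X is the vertical
    derivative of the Christoffel symbols (bformE).  A vertical derivative of
    Gam_rfield kills the second derivatives of v, so X is a tensor.

    The boundary identity is the Palatini identity.  The horizontal differential
    is the sum of dx^a /\ (Lie derivative along the a-th total derivative)
    (hdiffE), so the horizontal differential of the boundary form is minus the
    divergence of alpha.  By the lemma palatini this divergence is the part of the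
    variation of r which comes from the Ricci tensor; the rest of the variation
    is the Einstein tensor (variation_hilbert_density).  The formula hdiffE holds
    because forms of vertical degree k are the eigenforms, for the eigenvalue k,
    of the derivation N which replaces one argument by its vertical part
    (vproj_eigen), and because the commutator of N with the total differential
    is what remains of it after subtracting that sum (ext_Nv).

    The components of xi_v are linear in the jets of the metric with smooth
    coefficients on the base.  On such functions total derivatives commute, by the
    symmetry of second derivatives, so xi_v commutes with total derivatives.  Two
    consequences follow.  The field xi_v is strictly vertical (vertical_hdiff),
    and it is determined by its components on g_{ab} (evolutionary_uniq).
    Linearity and the bracket formula for rho thus need to be checked at order 0
    only, where they concern the Lie derivatives of a metric.

    All derivatives are taken at one jet along straight lines.  This is possible
    because jets over an open set of M whose metric is lorentzian form a set which
    is open along lines (lorentzian_near). *)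

Set Implicit Arguments.
Unset Strict Implicit.
Unset Printing Implicit Defensive.

Import Order.TTheory GRing.Theory Num.Theory.
Import numFieldNormedType.Exports.

Local Open Scope classical_set_scope.
Local Open Scope ring_scope.

(** * Multilinear functions of a list of vectors *)

Section Slots.
Context {R : realType} {T : lmodType R}.
Implicit Types (al : seq T -> R) (be : T -> seq T -> R) (A C : T -> T) (s t : seq T).

Definition contr (V : T) al : seq T -> R := fun t => al (V :: t).

(** The sum over i of (-1)^i be (V_i) (V_0, ..., V_{i-1}, V_{i+1}, ...), by recursion
    on the list of arguments so that algebraic identities follow by induction; the
    total differential is of this form (extE). *)
Fixpoint alt be s : R :=
  if s is V :: s' then be V s' - alt (fun W => contr V (be W)) s' else 0.

(** The derivation induced by A: the sum over i of al (V_0, ..., A V_i, ...). *)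
Fixpoint slot A al s : R :=
  if s is V :: s' then al (A V :: s') + slot A (contr V al) s' else 0.

(** Exterior multiplication by the 1-form a. *)
Definition e1 (a : T -> R) al : seq T -> R := alt (fun V t => a V * al t).

Definition mlin al := forall s1 s2 (k : R) V W,
  al (s1 ++ (k *: V + W) :: s2) = k * al (s1 ++ V :: s2) + al (s1 ++ W :: s2).

Definition altn al := forall s1 s2 V, al (s1 ++ V :: V :: s2) = 0.

Lemma mlin_contr al V : mlin al -> mlin (contr V al).
Proof. by move=> h s1 s2 k W W'; exact: (h (V :: s1)). Qed.

Lemma altn_contr al V : altn al -> altn (contr V al).
Proof. by move=> h s1 s2 W; exact: (h (V :: s1)). Qed.

Lemma mlinD al s1 s2 V W : mlin al ->
  al (s1 ++ (V + W) :: s2) = al (s1 ++ V :: s2) + al (s1 ++ W :: s2).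
Proof. by move=> h; have := h s1 s2 1 V W; rewrite scale1r mul1r. Qed.

Lemma mlin0 al s1 s2 : mlin al -> al (s1 ++ 0 :: s2) = 0.
Proof.
move=> h; have := h s1 s2 1 0 0; rewrite scale1r addr0 mul1r => e.
by apply: (addrI (al (s1 ++ 0 :: s2))); rewrite addr0 -e.
Qed.

Lemma mlinZ al s1 s2 k V : mlin al -> al (s1 ++ (k *: V) :: s2) = k * al (s1 ++ V :: s2).
Proof. by move=> h; have := h s1 s2 k V 0; rewrite addr0 mlin0 // addr0. Qed.

Lemma mlinB al s1 s2 V W : mlin al ->
  al (s1 ++ (V - W) :: s2) = al (s1 ++ V :: s2) - al (s1 ++ W :: s2).
Proof. by move=> h; rewrite mlinD // -scaleN1r mlinZ // mulN1r. Qed.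

Lemma mlin_sum al s1 s2 (I : Type) (r : seq I) (F : I -> T) : mlin al ->
  al (s1 ++ (\sum_(i <- r) F i) :: s2) = \sum_(i <- r) al (s1 ++ F i :: s2).
Proof.
move=> h; elim: r => [|i r IH]; first by rewrite !big_nil mlin0.
by rewrite !big_cons mlinD // IH.
Qed.

Lemma altn_swap al s1 s2 V W : mlin al -> altn al ->
  al (s1 ++ V :: W :: s2) = - al (s1 ++ W :: V :: s2).
Proof.
move=> hm ha; apply/eqP; rewrite -addr_eq0; apply/eqP.
have := ha s1 s2 (V + W).
have E X Y : al (s1 ++ X :: Y :: s2) = al ((s1 ++ [:: X]) ++ Y :: s2) by rewrite -catA.
rewrite mlinD // !E !(mlinD _ _ _ _ hm) -!E !ha add0r addr0 => h.
exact: h.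
Qed.

Lemma alt_ext be be' s :
  (forall V t, (size t).+1 = size s -> be V t = be' V t) -> alt be s = alt be' s.
Proof.
elim: s be be' => //= V s IH be be' h; rewrite h //; congr (_ - _).
by apply: IH => W t e; rewrite /contr h //= e.
Qed.

Lemma slot_ext A al al' s :
  (forall t, size t = size s -> al t = al' t) -> slot A al s = slot A al' s.
Proof.
elim: s al al' => //= V s IH al al' h; rewrite h //; congr (_ + _).
by apply: IH => t e; rewrite /contr h //= e.
Qed.

Lemma slot_ext_op A A' al s :
  (forall V, A V = A' V) -> slot A al s = slot A' al s.
Proof. by move=> h; elim: s al => //= V s IH al; rewrite h IH. Qed.

Lemma altD be be' s :
  alt (fun V t => be V t + be' V t) s = alt be s + alt be' s.
Proof.
elim: s be be' => [|V s IH] be be' /=; first by rewrite addr0.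
rewrite (_ : alt _ s = alt (fun W => contr V (be W)) s + alt (fun W => contr V (be' W)) s).
  by rewrite opprD addrACA.
by rewrite -IH; apply: alt_ext.
Qed.

Lemma altZ k be s : alt (fun V t => k * be V t) s = k * alt be s.
Proof.
elim: s be => [|V s IH] be /=; first by rewrite mulr0.
by rewrite mulrBr -IH.
Qed.

Lemma altN be s : alt (fun V t => - be V t) s = - alt be s.
Proof. by rewrite -mulN1r -altZ; apply: alt_ext => V t _; rewrite mulN1r. Qed.

Lemma altB be be' s :
  alt (fun V t => be V t - be' V t) s = alt be s - alt be' s.
Proof. by rewrite altD altN. Qed.

Lemma alt0 s : alt (fun _ _ => 0) s = 0.
Proof.
rewrite -[RHS](mul0r (alt (fun _ _ => 0) s)) -altZ.
by apply: alt_ext => V t _; rewrite mul0r.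
Qed.

Lemma alt_sum (I : Type) (r : seq I) (be : I -> T -> seq T -> R) s :
  alt (fun V t => \sum_(i <- r) be i V t) s = \sum_(i <- r) alt (be i) s.
Proof.
elim: r => [|i r IH].
  by rewrite big_nil -[RHS](alt0 s); apply: alt_ext => V t _; rewrite big_nil.
by rewrite big_cons -IH -altD; apply: alt_ext => V t _; rewrite big_cons.
Qed.

Lemma slotD A al al' s : slot A (fun t => al t + al' t) s = slot A al s + slot A al' s.
Proof.
elim: s al al' => [|V s IH] al al' /=; first by rewrite addr0.
by rewrite addrACA -IH.
Qed.

Lemma slotZ A k al s : slot A (fun t => k * al t) s = k * slot A al s.
Proof.
elim: s al => [|V s IH] al /=; first by rewrite mulr0.
by rewrite mulrDr -IH.
Qed.

Lemma slotN A al s : slot A (fun t => - al t) s = - slot A al s.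
Proof. by rewrite -mulN1r -slotZ; apply: slot_ext => t _; rewrite mulN1r. Qed.

Lemma slot0 A s : slot A (fun _ => 0) s = 0.
Proof.
rewrite -[RHS](mul0r (slot A (fun _ => 0) s)) -slotZ.
by apply: slot_ext => t _; rewrite mul0r.
Qed.

Lemma slot_sum A (I : Type) (r : seq I) (al : I -> seq T -> R) s :
  slot A (fun t => \sum_(i <- r) al i t) s = \sum_(i <- r) slot A (al i) s.
Proof.
elim: r => [|i r IH].
  by rewrite big_nil -[RHS](slot0 A s); apply: slot_ext => t _; rewrite big_nil.
by rewrite big_cons -IH -slotD; apply: slot_ext => t _; rewrite big_cons.
Qed.

Lemma slot_opD A C al s : mlin al ->
  slot (fun V => A V + C V) al s = slot A al s + slot C al s.
Proof.
elim: s al => [|V s IH] al h /=; first by rewrite addr0.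
by rewrite (mlinD [::]) // IH; [rewrite addrACA|exact: mlin_contr].
Qed.

Lemma slot_opZ k A al s : mlin al -> slot (fun V => k *: A V) al s = k * slot A al s.
Proof.
elim: s al => [|V s IH] al h /=; first by rewrite mulr0.
by rewrite (mlinZ [::]) // IH ?mulrDr //; exact: mlin_contr.
Qed.

Lemma slot_opN A al s : mlin al -> slot (fun V => - A V) al s = - slot A al s.
Proof.
by move=> h; rewrite -mulN1r -slot_opZ //; apply: slot_ext_op => V; rewrite scaleN1r.
Qed.

Lemma slot_op0 al s : mlin al -> slot (fun V => 0) al s = 0.
Proof.
by move=> h; rewrite -(mul0r (slot id al s)) -slot_opZ //; apply: slot_ext_op => V; rewrite scale0r.
Qed.

Lemma slot_op_sum (I : Type) (r : seq I) (A : I -> T -> T) al s : mlin al ->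
  slot (fun V => \sum_(i <- r) A i V) al s = \sum_(i <- r) slot (A i) al s.
Proof.
move=> h; elim: r => [|i r IH].
  by rewrite big_nil -[RHS](slot_op0 s h); apply: slot_ext_op => V; rewrite big_nil.
by rewrite big_cons -IH -slot_opD //; apply: slot_ext_op => V; rewrite big_cons.
Qed.

Lemma contr_slot A al V t :
  contr V (slot A al) t = al (A V :: t) + slot A (contr V al) t.
Proof. by []. Qed.

Lemma slot_alt A be s :
  slot A (alt be) s = alt (fun V => be (A V)) s + alt (fun V => slot A (be V)) s.
Proof.
elim: s be => [|V s IH] be /=; first by rewrite addr0.
have -> : slot A (contr V (alt be)) s =
    slot A (be V) s - slot A (alt (fun W => contr V (be W))) s.
  by rewrite -slotN -slotD; apply: slot_ext.
rewrite IH.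
have -> : alt (fun W => contr V (slot A (be W))) s =
   alt (fun W => contr (A V) (be W)) s + alt (fun W => slot A (contr V (be W))) s.
  by rewrite -altD; apply: alt_ext.
ring.
Qed.

Lemma mlin_slot A al : (forall k V W, A (k *: V + W) = k *: A V + A W) ->
  mlin al -> mlin (slot A al).
Proof.
move=> hA hal s1; elim: s1 al hal => [|X s1 IH] al hal s2 k V W /=.
  have -> : slot A (contr (k *: V + W) al) s2 =
      k * slot A (contr V al) s2 + slot A (contr W al) s2.
    by rewrite -slotZ -slotD; apply: slot_ext => t _; rewrite /contr (hal [::]).
  by rewrite hA (hal [::]) /=; ring.
rewrite IH ?mulrDr; last exact: mlin_contr.
by rewrite (hal (A X :: s1)) addrACA.
Qed.

(** The operators act by precomposition, so the commutator changes its order. *)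
Lemma slot_comm A C al s : mlin al ->
  slot A (slot C al) s - slot C (slot A al) s =
  slot (fun V => C (A V) - A (C V)) al s.
Proof.
elim: s al => [|V s IH] al h /=; first by rewrite subrr.
have E A' C' : slot A' (contr V (slot C' al)) s =
    slot A' (contr (C' V) al) s + slot A' (slot C' (contr V al)) s.
  by rewrite -slotD; apply: slot_ext.
rewrite !E -(IH _ (mlin_contr V h)) (mlinB [::]) //=; rewrite /contr /=.
ring.
Qed.

(** Moving the altered argument of an alternating function to the front costs the sign
    with which alt weights it. *)
Lemma slot_front A al s : mlin al -> altn al ->
  slot A al s = alt (fun W => contr (A W) al) s.
Proof.
elim: s al => [//|V s IH] al hm ha /=; rewrite IH; [|exact: mlin_contr|exact: altn_contr].
congr (_ + _); rewrite -altN; apply: alt_ext => W t _.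
by rewrite /contr (altn_swap [::]).
Qed.

(** An alternating sum over two arguments changes sign when they are exchanged.  For
    the vertical projection, which depends on the point, this turns the derivative
    of the projection into the horizontal differential. *)
Lemma altn_slot_sym (C : T -> T -> T) al s : mlin al -> altn al ->
  alt (fun V => slot (C V) al) s = - alt (fun V => slot (fun W => C W V) al) s.
Proof.
elim: s al => [|V s IH] al hm ha /=; first by rewrite oppr0.
have E (C' : T -> T -> T) : alt (fun W => contr V (slot (C' W) al)) s =
   alt (fun W => contr (C' W V) al) s + alt (fun W => slot (C' W) (contr V al)) s.
  by rewrite -altD; apply: alt_ext.
rewrite (E C) (E (fun X Y => C Y X)) (IH (contr V al)); [|exact: mlin_contr|exact: altn_contr].
rewrite !slot_front //.
ring.
Qed.

Lemma altE be s : alt be s =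
  \sum_(i < size s) (-1) ^+ i * be (nth 0 s i) (take i s ++ drop i.+1 s).
Proof.
elim: s be => [|V s IH] be /=; first by rewrite big_ord0.
rewrite big_ord_recl /= expr0 mul1r drop0; congr (_ + _).
rewrite IH -sumrN; apply: eq_bigr => i _ /=.
by rewrite /contr /bump /= add1n exprS mulN1r mulNr.
Qed.

(** ** Exterior multiplication by a 1-form *)

Lemma e1_cons a al V s : e1 a al (V :: s) = a V * al s - e1 a (contr V al) s.
Proof. by []. Qed.

Lemma e1_contr a al V s : e1 a (contr V al) s = a V * al s - contr V (e1 a al) s.
Proof. rewrite /contr e1_cons; ring. Qed.

Lemma e1_ext a a' al al' s :
  (forall V, a V = a' V) -> (forall t, (size t).+1 = size s -> al t = al' t) ->
  e1 a al s = e1 a' al' s.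
Proof. by move=> h h'; apply: alt_ext => V t e; rewrite h h'. Qed.

Lemma e1D a al al' s : e1 a (fun t => al t + al' t) s = e1 a al s + e1 a al' s.
Proof. by rewrite -altD; apply: alt_ext => V t _; rewrite mulrDr. Qed.

Lemma e1Z a k al s : e1 a (fun t => k * al t) s = k * e1 a al s.
Proof. by rewrite -altZ; apply: alt_ext => V t _; rewrite mulrCA. Qed.

Lemma e1N a al s : e1 a (fun t => - al t) s = - e1 a al s.
Proof. by rewrite -mulN1r -e1Z; apply: e1_ext => // t _; rewrite mulN1r. Qed.

Lemma e1_sum (I : Type) (r : seq I) a (al : I -> seq T -> R) s :
  e1 a (fun t => \sum_(i <- r) al i t) s = \sum_(i <- r) e1 a (al i) s.
Proof. by rewrite -alt_sum; apply: alt_ext => V t _; rewrite mulr_sumr. Qed.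

Lemma e1_Dl a a' al s : e1 (fun V => a V + a' V) al s = e1 a al s + e1 a' al s.
Proof. by rewrite -altD; apply: alt_ext => V t _; rewrite mulrDl. Qed.

Lemma e1_Zl a k al s : e1 (fun V => k * a V) al s = k * e1 a al s.
Proof. by rewrite -altZ; apply: alt_ext => V t _; rewrite mulrA. Qed.

Lemma e1_suml (I : Type) (r : seq I) (a : I -> T -> R) al s :
  e1 (fun V => \sum_(i <- r) a i V) al s = \sum_(i <- r) e1 (a i) al s.
Proof. by rewrite -alt_sum; apply: alt_ext => V t _; rewrite mulr_suml. Qed.

Lemma e1_anticomm a b al s : e1 a (e1 b al) s = - e1 b (e1 a al) s.
Proof.
elim: s al => [|V s IH] al; first by rewrite /e1 /= oppr0.
have E a' b' : e1 a' (contr V (e1 b' al)) s =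
    b' V * e1 a' al s - e1 a' (e1 b' (contr V al)) s.
  by rewrite -e1Z -e1N -e1D; apply: e1_ext.
rewrite !e1_cons !E IH; ring.
Qed.

Lemma e1_e1 a al s : e1 a (e1 a al) s = 0.
Proof.
have h := e1_anticomm a a al s.
by apply/eqP; rewrite -[_ == _](mulrn_eq0 _ 2) mulr2n {1}h addNr.
Qed.

Lemma slot_e1 A a al s :
  slot A (e1 a al) s = e1 (a \o A) al s + e1 a (slot A al) s.
Proof.
rewrite /e1 slot_alt; congr (_ + _).
by apply: alt_ext => V t _; rewrite slotZ.
Qed.

End Slots.

(** * Vertical and horizontal vectors *)

Section Bidegree.
Context {R : realType} {n : nat}.
Notation J := (jspace R n).
Implicit Types (p V W : J) (al : seq J -> R) (s t : seq J).

Lemma jaddE V W i : (V + W) i = V i + W i. Proof. by []. Qed.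
Lemma jscaleE (k : R) V i : (k *: V) i = k * V i. Proof. by []. Qed.
Lemma joppE V i : (- V) i = - V i. Proof. by []. Qed.
Lemma jsumE (I : Type) (r : seq I) (F : I -> J) i :
  (\sum_(k <- r) F k) i = \sum_(k <- r) F k i.
Proof. by rewrite fct_sumE. Qed.
Definition jE := (jaddE, jscaleE, joppE, jsumE).

Lemma horE p V i : hor p V i = \sum_a V (inl a) * hpartial a p i.
Proof. by rewrite /hor jE; apply: eq_bigr => a _. Qed.

Lemma hor_inl p V a : hor p V (inl a) = V (inl a).
Proof.
rewrite horE (bigD1 a) //= eqxx mulr1 big1 ?addr0 // => b ba.
by rewrite eq_sym (negbTE ba) mulr0.
Qed.

Lemma hor_inr p V ab C :
  hor p V (inr (ab, C)) = \sum_a V (inl a) * p (inr (ab, mi_add1 C a)).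
Proof. by rewrite horE. Qed.

Lemma ver_inl p V a : ver p V (inl a) = 0.
Proof. by rewrite /ver !jE hor_inl subrr. Qed.

Lemma ver_inr p V ab C : ver p V (inr (ab, C)) =
  V (inr (ab, C)) - \sum_a V (inl a) * p (inr (ab, mi_add1 C a)).
Proof. by rewrite /ver !jE hor_inr. Qed.

Lemma hor_lin p (k : R) V W : hor p (k *: V + W) = k *: hor p V + hor p W.
Proof.
rewrite /hor scaler_sumr -big_split; apply: eq_bigr => a _ /=.
by rewrite !jE scalerDl scalerA.
Qed.

Lemma ver_lin p (k : R) V W : ver p (k *: V + W) = k *: ver p V + ver p W.
Proof. by rewrite /ver hor_lin scalerBr opprD addrACA. Qed.

Lemma hor_vertical p V : (forall a, V (inl a) = 0) -> hor p V = 0.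
Proof. by move=> h; rewrite /hor big1 // => a _; rewrite h scale0r. Qed.

Lemma ver_vertical p V : (forall a, V (inl a) = 0) -> ver p V = V.
Proof. by move=> h; rewrite /ver hor_vertical // subr0. Qed.

Lemma hor_ver p V : hor p (ver p V) = 0.
Proof. by apply: hor_vertical => a; rewrite ver_inl. Qed.

Lemma ver_ver p V : ver p (ver p V) = ver p V.
Proof. by rewrite {1}/ver hor_ver subr0. Qed.

Lemma hor_hor p V : hor p (hor p V) = hor p V.
Proof. by rewrite {1}/hor; apply: eq_bigr => a _; rewrite hor_inl. Qed.

Lemma ver_hor p V : ver p (hor p V) = 0.
Proof. by rewrite /ver hor_hor subrr. Qed.

(** ** The components of given vertical degree *)

Lemma vproj_cons p k al V s : vproj_at p k al (V :: s) =
  vproj_at p k (contr (hor p V) al) s +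
  (if k is k'.+1 then vproj_at p k' (contr (ver p V) al) s else 0).
Proof. by []. Qed.

Lemma vproj_ext p k al al' s :
  (forall t, size t = size s -> al t = al' t) -> vproj_at p k al s = vproj_at p k al' s.
Proof.
elim: s k al al' => [|V s IH] k al al' h /=; first by rewrite h.
congr (_ + _); last (case: k => // k); by apply: IH => t e; rewrite h //= e.
Qed.

Lemma vprojD p k al al' s :
  vproj_at p k (fun t => al t + al' t) s = vproj_at p k al s + vproj_at p k al' s.
Proof.
elim: s k al al' => [|V s IH] k al al' /=; first by rewrite mulrDr.
rewrite (IH k (contr (hor p V) al)).
by case: k => [|k]; rewrite ?addr0 // (IH k (contr (ver p V) al)) addrACA.
Qed.

Lemma vprojZ p k (c : R) al s :
  vproj_at p k (fun t => c * al t) s = c * vproj_at p k al s.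
Proof.
elim: s k al => [|V s IH] k al /=; first by rewrite mulrCA.
rewrite (IH k (contr (hor p V) al)).
by case: k => [|k]; rewrite ?addr0 // (IH k (contr (ver p V) al)) mulrDr.
Qed.

Lemma vproj0 p k s : vproj_at p k (fun _ => 0) s = 0.
Proof.
rewrite -[RHS](mul0r (vproj_at p k (fun _ => 0) s)) -vprojZ.
by apply: vproj_ext => t _; rewrite mul0r.
Qed.

Lemma vproj_mlin p k al : mlin al -> mlin (vproj_at p k al).
Proof.
move=> hal s1; elim: s1 k al hal => [|X s1 IH] k al hal s2 c V W.
  rewrite !cat0s !vproj_cons.
  have E Y Z k' : vproj_at p k' (contr (c *: Y + Z) al) s2 =
      c * vproj_at p k' (contr Y al) s2 + vproj_at p k' (contr Z al) s2.
    by rewrite -vprojZ -vprojD; apply: vproj_ext => t _; rewrite /contr (hal [::]).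
  by rewrite hor_lin E; case: k => [|k]; rewrite ?addr0 // ver_lin E; ring.
rewrite !cat_cons !vproj_cons IH; last exact: mlin_contr.
by case: k => [|k]; rewrite ?addr0 // IH; [ring|exact: mlin_contr].
Qed.

Lemma vproj_altn p k al : mlin al -> altn al -> altn (vproj_at p k al).
Proof.
move=> hm ha s1; elim: s1 k al hm ha => [|X s1 IH] k al hm ha s2 V; last first.
  have hmX Y : mlin (contr Y al) by exact: mlin_contr.
  have haX Y : altn (contr Y al) by exact: altn_contr.
  by rewrite cat_cons vproj_cons IH //; case: k => [|k]; rewrite ?addr0 // IH ?addr0.
rewrite cat0s vproj_cons.
have Z Y k' : vproj_at p k' (contr Y (contr Y al)) s2 = 0.
  by rewrite -(vproj0 p k' s2); apply: vproj_ext => t _; exact: (ha [::]).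
have S Y Y' k' : vproj_at p k' (contr Y (contr Y' al)) s2 =
    - vproj_at p k' (contr Y' (contr Y al)) s2.
  rewrite -mulN1r -vprojZ; apply: vproj_ext => t _.
  by rewrite /contr (altn_swap [::]) // mulN1r.
case: k => [|[|k]]; rewrite !vproj_cons ?Z ?addr0 ?add0r //.
- by rewrite (S (ver p V) (hor p V)) addNr.
- by rewrite (S (ver p V) (hor p V)) addNr.
Qed.

Lemma vproj_total p al s m : mlin al -> (size s < m)%N ->
  \sum_(k < m) vproj_at p k al s = al s.
Proof.
elim: s m al => [|V s IH] [|m] al hal // hs.
  by rewrite big_ord_recl /= mul1r big1 ?addr0 // => i _; rewrite mul0r.
under eq_bigr => k _ do rewrite vproj_cons.
rewrite big_split /= IH; [|exact: mlin_contr|exact: ltnW].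
rewrite big_ord_recl /= add0r.
rewrite (eq_bigr (fun k : 'I_m => vproj_at p k (contr (ver p V) al) s)) //.
rewrite IH //; last exact: mlin_contr.
by rewrite /contr -(mlinD [::]) //= addrC /ver subrK.
Qed.

Lemma slot_ver_vproj p k al s : mlin al ->
  slot (ver p) (vproj_at p k al) s = k%:R * vproj_at p k al s.
Proof.
elim: s k al => [|V s IH] k al hal.
  by rewrite /=; case: k => [|k] /=; rewrite ?mul0r ?mulr0.
rewrite [LHS]/= hor_ver ver_ver.
have -> : vproj_at p k (fun t => al (0 :: t)) s = 0.
  by rewrite -[RHS](vproj0 p k s); apply: vproj_ext => t _; rewrite (mlin0 [::]).
rewrite add0r vproj_cons.
case: k => [|k].
  have := IH 0%N (contr (hor p V) al) (mlin_contr _ hal).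
  rewrite mul0r => e; rewrite add0r mul0r -[RHS]e.
  by apply: slot_ext => t _; rewrite /contr vproj_cons addr0.
have -> : slot (ver p) (contr V (vproj_at p k.+1 al)) s =
   slot (ver p) (vproj_at p k.+1 (contr (hor p V) al)) s +
   slot (ver p) (vproj_at p k (contr (ver p V) al)) s by rewrite -slotD.
rewrite !IH; try exact: mlin_contr.
rewrite -[vproj_at p k (fun t => _) s]/(vproj_at p k (contr (ver p V) al) s).
rewrite -natr1; ring.
Qed.

Lemma vproj_slot_ver p k al s : mlin al ->
  vproj_at p k (slot (ver p) al) s = k%:R * vproj_at p k al s.
Proof.
elim: s k al => [|V s IH] k al hal.
  by rewrite /=; case: k => [|k] /=; rewrite ?mul0r ?mulr0.
rewrite !vproj_cons.
have E Y k' : vproj_at p k' (contr Y (slot (ver p) al)) s =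
    vproj_at p k' (contr (ver p Y) al) s + k'%:R * vproj_at p k' (contr Y al) s.
  by rewrite -IH -?vprojD //; exact: mlin_contr.
rewrite !E ver_hor.
have -> k' : vproj_at p k' (contr 0 al) s = 0.
  by rewrite -[RHS](vproj0 p k' s); apply: vproj_ext => t _; rewrite /contr (mlin0 [::]).
case: k => [|k]; first by rewrite !mul0r !addr0.
rewrite E ver_ver -natr1; ring.
Qed.

(** A multilinear function is the sum of its components of given vertical degree, and
    the derivation slot (ver p) multiplies the component of degree k by k.  So its
    eigenspaces are the spaces of forms of given vertical degree. *)
Lemma vproj_eigen p k j al s : mlin al ->
  (forall t, slot (ver p) al t = k%:R * al t) ->
  vproj_at p j al s = (j == k)%:R * al s.
Proof.
move=> hal he.
have Z i : i != k -> vproj_at p i al s = 0.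
  move=> ik; have := vproj_slot_ver p i s hal.
  have -> : vproj_at p i (slot (ver p) al) s = vproj_at p i (fun t => k%:R * al t) s.
    exact: vproj_ext.
  rewrite vprojZ => /eqP; rewrite -subr_eq0 -mulrBl mulf_eq0.
  by rewrite subr_eq0 eqr_nat eq_sym (negbTE ik) /= => /eqP.
have [->|/Z ->] := eqVneq j k; last by rewrite mul0r.
have hk : (k < (maxn k (size s)).+1)%N by rewrite ltnS leq_maxl.
rewrite mul1r -[RHS](@vproj_total p _ _ (maxn k (size s)).+1 hal); last by rewrite ltnS leq_maxr.
rewrite (bigD1 (Ordinal hk)) //= big1 ?addr0 // => i ik; apply: Z.
by apply: contra ik => /eqP ik; apply/eqP/val_inj.
Qed.

(** ** Wedge products with 1-forms *)

Lemma wedge_at00 al be s : (forall t, al t = 0) -> wedge_at al be s = 0.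
Proof.
elim: s al be => [|V s IH] al be h /=; first by rewrite h mul0r.
by rewrite !IH ?addr0 // => t; rewrite h mulr0.
Qed.

Lemma wedge_at0 al be s : (forall V t, al (V :: t) = 0) ->
  wedge_at al be s = al [::] * be s.
Proof.
elim: s al be => [|V s IH] al be h //=.
rewrite wedge_at00 // add0r IH ?expr0 ?mul1r // => W t.
by rewrite h mulr0.
Qed.

Lemma wedge_at1 al be s : al [::] = 0 -> (forall V W t, al (V :: W :: t) = 0) ->
  wedge_at al be s = e1 (fun V => al [:: V]) be s.
Proof.
elim: s al be => [|V s IH] al be h0 h2; first by rewrite /= h0 mul0r.
rewrite /= wedge_at0 // IH ?h0 ?mulr0 // => [|W W' t]; last by rewrite h2 mulr0.
rewrite e1_cons; congr (_ + _); rewrite -[RHS]mulN1r -e1_Zl.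
by apply: e1_ext => // W; rewrite expr1.
Qed.

Lemma wedge1 (w1 w2 : jet_form R n) p s : w1 p [::] = 0 ->
  (forall V W t, w1 p (V :: W :: t) = 0) ->
  wedge w1 w2 p s = e1 (fun V => w1 p [:: V]) (w2 p) s.
Proof. exact: wedge_at1. Qed.

End Bidegree.

(** * Derivatives along curves *)

Section Curves.
Context {R : realType}.
Implicit Types (f g : R -> R) (a b : R).

(** Derivatives of curves at parameter 0, to which directional derivatives reduce. *)
Definition der0 f a := is_derive (0 : R) (1 : R) f a.

Lemma der0_eq f a b : der0 f a -> a = b -> der0 f b.
Proof. by move=> h <-. Qed.

Lemma der0_uniq f a b : der0 f a -> der0 f b -> a = b.
Proof. by move=> h h'; rewrite -(@derive_val _ _ _ _ _ _ _ h) (@derive_val _ _ _ _ _ _ _ h'). Qed.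

Lemma der0_derive1 f a : der0 f a -> derive1 f 0 = a.
Proof. by move=> h; rewrite derive1E (@derive_val _ _ _ _ _ _ _ h). Qed.

Lemma der0_near f g a : (\forall t \near (0 : R), f t = g t) -> der0 f a -> der0 g a.
Proof. by move=> h; exact: near_eq_is_derive. Qed.

Lemma der0_ext f g a : f =1 g -> der0 f a -> der0 g a.
Proof. by move=> /funext ->. Qed.

Lemma is_derive_line (V : normedModType R) (f : V -> R) (x v : V) (s l : R) :
  is_derive (x + s *: v) v f l -> is_derive s (1 : R) (fun t => f (x + t *: v)) l.
Proof.
have e : (fun h : R => h^-1 *: ((f \o shift (x + s *: v)) (h *: v) - f (x + s *: v))) =
    (fun h : R => h^-1 *: (((fun t : R => f (x + t *: v)) \o shift s) (h *: 1) -
      (fun t : R => f (x + t *: v)) s)).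
  apply/funext => h /=; rewrite [h *: 1]mulr1 (addrC (h *: v)) -addrA -scalerDl.
  by rewrite (addrC s h).
have ed : derivable f (x + s *: v) v = derivable (fun t : R => f (x + t *: v)) s 1.
  by rewrite /derivable e.
have ev : 'D_v f (x + s *: v) = 'D_1 (fun t : R => f (x + t *: v)) s by rewrite /derive e.
by move=> -[d <-]; split; [move: d; rewrite ed|exact: esym ev].
Qed.

Lemma der0_line (V : normedModType R) (f : V -> R) x v l :
  is_derive x v f l -> der0 (fun t => f (x + t *: v)) l.
Proof. by move=> h; apply: is_derive_line; rewrite scale0r addr0. Qed.

(** ** Directional derivatives *)

Definition isD (E : lmodType R) (f : E -> R) (U p : E) (a : R) :=
  der0 (fun t => f (p + t *: U)) a.

Variable E : lmodType R.
Implicit Types (F G : E -> R) (U p : E).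

Lemma isD_eq F U p a b : isD F U p a -> a = b -> isD F U p b.
Proof. exact: der0_eq. Qed.

Lemma isD_uniq F U p a b : isD F U p a -> isD F U p b -> a = b.
Proof. exact: der0_uniq. Qed.

Lemma isD_ext F G U p a : F =1 G -> isD F U p a -> isD G U p a.
Proof. by move=> /funext ->. Qed.

Lemma isD_cst c U p : isD (fun=> c) U p 0.
Proof. exact: is_derive_cst. Qed.

Lemma isDD F G U p a b : isD F U p a -> isD G U p b -> isD (fun q => F q + G q) U p (a + b).
Proof. by move=> h h'; exact: is_deriveD. Qed.

Lemma isDN F U p a : isD F U p a -> isD (fun q => - F q) U p (- a).
Proof. by move=> h; exact: is_deriveN. Qed.

Lemma isDB F G U p a b : isD F U p a -> isD G U p b -> isD (fun q => F q - G q) U p (a - b).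
Proof. by move=> h h'; exact: is_deriveB. Qed.

Lemma isDM F G U p a b : isD F U p a -> isD G U p b ->
  isD (fun q => F q * G q) U p (a * G p + F p * b).
Proof.
move=> h h'; apply: der0_eq (is_deriveM h h') _.
by rewrite !scale0r !addr0 addrC [_ *: a]mulrC.
Qed.

Lemma isDZ k F U p a : isD F U p a -> isD (fun q => k * F q) U p (k * a).
Proof. by move=> h; exact: is_deriveZ. Qed.

Lemma isD_sum (I : eqType) (r : seq I) (P : pred I) (F : I -> E -> R) U p (a : I -> R) :
  (forall i, i \in r -> P i -> isD (F i) U p (a i)) ->
  isD (fun q => \sum_(i <- r | P i) F i q) U p (\sum_(i <- r | P i) a i).
Proof.
elim: r => [|i r IH] h.
  by rewrite big_nil; apply: isD_ext (isD_cst 0 U p) => q; rewrite big_nil.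
have {}IH := IH (fun j jr => h j (mem_behead (s := i :: r) jr)).
rewrite big_cons; case: ifP => Pi.
  apply: isD_ext (isDD (h i (mem_head _ _) Pi) IH) => q.
  by rewrite big_cons Pi.
by apply: isD_ext IH => q; rewrite big_cons Pi.
Qed.

Lemma isD_sumT (I : finType) (F : I -> E -> R) U p (a : I -> R) :
  (forall i, isD (F i) U p (a i)) ->
  isD (fun q => \sum_i F i q) U p (\sum_i a i).
Proof. by move=> h; exact: isD_sum. Qed.

(** Openness along straight lines, which is what directional derivatives see. *)
Definition line_open (D : set E) := forall p U, D p -> \forall t \near (0 : R), D (p + t *: U).

Lemma isD_on D F G U p a : line_open D -> D p -> (forall q, D q -> F q = G q) ->
  isD F U p a -> isD G U p a.
Proof.
move=> hD Dp h; apply: der0_near.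
by apply: filterS (hD p U Dp) => t; exact: h.
Qed.

End Curves.

Section DirectionalDerivatives.
Context {R : realType} {n : nat}.
Notation J := (jspace R n).
Implicit Types (p q U V W : J) (f : J -> R) (w : jet_form R n) (s t : seq J) (D : set J).

Lemma isD_dirder f U p a : isD f U p a -> dirder f U p = a.
Proof. exact: der0_derive1. Qed.

Lemma isD_derP f U p a : isD f U p a -> isD f U p (dirder f U p).
Proof. by move=> h; rewrite (isD_dirder h). Qed.

Lemma isD_coord (i : coord n) U p : isD (fun q => q i) U p (U i).
Proof.
have h := is_deriveD (is_derive_cst (p i) (0 : R) 1)
  (is_deriveM (is_derive_id (0 : R) 1) (is_derive_cst (U i) (0 : R) 1)).
by apply: der0_eq h _; rewrite scaler0 !add0r [_ *: _]mulr1.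
Qed.

Lemma dirder_on D f g U p : line_open D -> D p -> (forall q, D q -> f q = g q) ->
  dirder f U p = dirder g U p.
Proof.
move=> hD Dp h; rewrite /dirder !derive1E; apply: near_eq_derive.
by apply: filterS (hD p U Dp) => t; exact: h.
Qed.

Lemma dirder_ext f g U p : f =1 g -> dirder f U p = dirder g U p.
Proof. by move=> /funext ->. Qed.

Lemma dirder_cst c U p : dirder (fun=> c) U p = 0.
Proof. exact: isD_dirder (isD_cst _ _ _). Qed.

Lemma extE w p s : ext w p s = alt (fun V t => dirder (fun q => w q t) V p) s.
Proof. by rewrite altE. Qed.

Lemma ext_on D w w' p s : line_open D -> D p ->
  (forall q t, D q -> w q t = w' q t) -> ext w p s = ext w' p s.
Proof.
move=> hD Dp h; rewrite !extE; apply: alt_ext => V t _.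
by apply: (dirder_on _ hD) => // q; exact: h.
Qed.

Lemma lie_on D (X X' : J -> J) w w' p s : line_open D -> D p ->
  (forall q t, D q -> w q t = w' q t) -> (forall q, D q -> X q = X' q) ->
  lie X w p s = lie X' w' p s.
Proof.
move=> hD Dp h hX; rewrite /lie !addrfctE /iprod hX //; congr (_ + _).
  exact: (ext_on (D := D)).
by apply: (ext_on (D := D)) => // q t Dq; rewrite h ?hX.
Qed.

End DirectionalDerivatives.

(** * The horizontal and vertical differentials *)

Section Differentials.
Context {R : realType} {n : nat}.
Notation J := (jspace R n).
Implicit Types (p q U V W : J) (f g : J -> R) (w : jet_form R n) (s t : seq J).

(** Gateaux differentiability, with a linear derivative. *)
Definition gat f p := exists l : J -> R,
  (forall (k : R) U V, l (k *: U + V) = k * l U + l V) /\ forall U, isD f U p (l U).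

Lemma gatP f p U : gat f p -> isD f U p (dirder f U p).
Proof. by move=> [l [_ h]]; exact: isD_derP (h U). Qed.

Lemma gat_lin f p k U V : gat f p ->
  dirder f (k *: U + V) p = k * dirder f U p + dirder f V p.
Proof. by move=> [l [hl h]]; rewrite !(isD_dirder (h _)) hl. Qed.

Lemma gatDU f p U V : gat f p -> dirder f (U + V) p = dirder f U p + dirder f V p.
Proof. by move=> h; have := gat_lin 1 U V h; rewrite scale1r mul1r. Qed.

Lemma gatB f p U V : gat f p -> dirder f (U - V) p = dirder f U p - dirder f V p.
Proof. by move=> h; rewrite addrC -scaleN1r gat_lin // mulN1r addrC. Qed.

Lemma gat0 f p : gat f p -> dirder f 0 p = 0.
Proof. by move=> h; rewrite -(subrr 0) gatB // subrr. Qed.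

Lemma gat_sumU f p (I : Type) (r : seq I) (k : I -> R) (U : I -> J) : gat f p ->
  dirder f (\sum_(i <- r) k i *: U i) p = \sum_(i <- r) k i * dirder f (U i) p.
Proof.
move=> h; elim: r => [|i r IH]; first by rewrite !big_nil gat0.
by rewrite !big_cons gat_lin // IH.
Qed.

Lemma gat_cst c p : gat (fun=> c) p.
Proof.
exists (fun=> 0); split=> [k U V|U]; first by rewrite mulr0 addr0.
exact: isD_cst.
Qed.

Lemma gat_coord i p : gat (fun q => q i) p.
Proof. by exists (fun U => U i); split=> [|U] //; exact: isD_coord. Qed.

Lemma gatD f g p : gat f p -> gat g p -> gat (fun q => f q + g q) p.
Proof.
move=> [l [hl h]] [m [hm h']]; exists (fun U => l U + m U); split=> [k U V|U].
  by rewrite hl hm; ring.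
exact: isDD.
Qed.

Lemma gatM f g p : gat f p -> gat g p -> gat (fun q => f q * g q) p.
Proof.
move=> [l [hl h]] [m [hm h']].
exists (fun U => l U * g p + f p * m U); split=> [k U V|U].
  by rewrite hl hm; ring.
exact: isDM.
Qed.

Lemma gat_ext f g p : f =1 g -> gat f p -> gat g p.
Proof. by move=> /funext ->. Qed.

Lemma gat_sum (I : Type) (r : seq I) (f : I -> J -> R) p :
  (forall i, gat (f i) p) -> gat (fun q => \sum_(i <- r) f i q) p.
Proof.
move=> h; elim: r => [|i r IH].
  by apply: gat_ext (gat_cst 0 p) => q; rewrite big_nil.
by apply: gat_ext (gatD (h i) IH) => q; rewrite big_cons.
Qed.

Variables (D : set J).
Hypothesis (Dopen : line_open D).

Lemma gat_on f g p : D p -> (forall q, D q -> f q = g q) -> gat f p -> gat g p.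
Proof.
move=> Dp h [l [hl h']]; exists l; split=> // U.
exact: isD_on Dopen Dp h (h' U).
Qed.

(** Equality of two lists of vectors as far as the coordinates in K can see. *)
Fixpoint same_on (K : seq (coord n)) s s' : Prop :=
  match s, s' with
  | V :: t, V' :: t' => {in K, V =1 V'} /\ same_on K t t'
  | [::], [::] => True
  | _, _ => False
  end.

Lemma same_on_map K s s' : same_on K s s' ->
  [seq [seq V i | i <- K] | V <- s] = [seq [seq V i | i <- K] | V <- s'].
Proof.
elim: s s' => [|V s IH] [|V' s'] //= [h /IH ->].
by rewrite (iffLR (eq_in_map V V' K) h).
Qed.

Lemma same_on_refl K s : same_on K s s.
Proof. by elim: s => //= V s IH; split. Qed.

Lemma same_on_sub K K' s s' : {subset K <= K'} -> same_on K' s s' -> same_on K s s'.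
Proof.
move=> h; elim: s s' => [|V s IH] [|V' s'] //= [e /IH]; split => // i /h; exact: e.
Qed.

(** What the calculus uses of a form of finite order.  The class is stable under
    contraction with fields and under the projections to given vertical degree. *)
Record gat_form w : Prop := GatForm {
  gat_form_mlin : forall p, D p -> mlin (w p);
  gat_form_altn : forall p, D p -> altn (w p);
  gat_form_fin : exists K, forall p s s', D p -> same_on K s s' -> w p s = w p s';
  gat_form_gat : forall p s, D p -> gat (fun q => w q s) p }.

Lemma jsmooth_gat f p : D p -> jsmooth_on D f -> gat f p.
Proof.
move=> Dp [m [K [F [_ hF hf]]]].
have dF : differentiable F (\row_j p (K j)) by apply: (hF [::]); exists p.
apply: (gat_on Dp (f := fun q => F (\row_j q (K j)))) => [q Dq|]; first by rewrite hf.
exists (fun U => 'd F (\row_j p (K j)) (\row_j U (K j))); split=> [k U V|U].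
  rewrite -[k * _]/(k *: _) -linearZ -linearD; congr ('d _ _ _).
  by apply/rowP => j; rewrite !mxE.
have := derivableP (diff_derivable (v := \row_j U (K j)) dF).
rewrite deriveE // => /der0_line h'.
apply: der0_ext h' => t; congr F.
by apply/rowP => j; rewrite !mxE.
Qed.

Lemma jform_gat_form w : jform_on D w -> gat_form w.
Proof.
move=> [hm ha [K hK] hs]; split=> [p Dp s1 s2 k V W|p Dp s1 s2 V||p s Dp].
- exact: hm.
- exact: ha.
- by exists K => p s s' Dp /same_on_map; exact: hK.
- exact: jsmooth_gat.
Qed.

Definition evec (i : coord n) : J := fun j => (j == i)%:R.

Lemma same_on_expand (K : seq (coord n)) V :
  {in K, V =1 \sum_(i <- undup K) V i *: evec i}.
Proof.
move=> j jK; rewrite jsumE (bigD1_seq j) ?mem_undup ?undup_uniq //=.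
rewrite jscaleE /evec eqxx mulr1 big1 ?addr0 // => i ij.
by rewrite jscaleE eq_sym (negbTE ij) mulr0.
Qed.

Lemma gat_form_expand w : gat_form w -> exists K : seq (coord n), forall p V s, D p ->
  w p (V :: s) = \sum_(i <- K) V i * w p (evec i :: s).
Proof.
move=> hw; have [K hK] := gat_form_fin hw; exists (undup K) => p V s Dp.
rewrite (hK p _ ((\sum_(i <- undup K) V i *: evec i) :: s)) //; last first.
  by split; [exact: same_on_expand|exact: same_on_refl].
have hm := gat_form_mlin hw Dp.
rewrite (mlin_sum [::]) //; apply: eq_bigr => i _.
by rewrite (mlinZ [::]).
Qed.

(** Leibniz rule for the contraction with a field Q.  A form depends on finitely
    many coordinates of its argument, so the contraction is a finite sum of products
    of a coordinate of Q and a function, although the space of jets has infinite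
    dimension. *)
Lemma contr_rule w (Q : J -> J) (DQ U p : J) s : gat_form w -> D p ->
  (forall i, isD (fun q => Q q i) U p (DQ i)) ->
  isD (fun q => w q (Q q :: s)) U p
    (w p (DQ :: s) + dirder (fun q => w q (Q p :: s)) U p).
Proof.
move=> hw Dp hQ; have [K hK] := gat_form_expand hw.
apply: (isD_on Dopen Dp (F := fun q => \sum_(i <- K) Q q i * w q (evec i :: s))).
  by move=> q Dq; rewrite -hK.
have -> : dirder (fun q => w q (Q p :: s)) U p =
   \sum_(i <- K) Q p i * dirder (fun q => w q (evec i :: s)) U p.
  apply: isD_dirder.
  apply: (isD_on Dopen Dp (F := fun q => \sum_(i <- K) Q p i * w q (evec i :: s))).
    by move=> q Dq; rewrite -hK.
  apply: isD_sum => i _ _; apply: isDZ; apply: gatP; exact: gat_form_gat.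
rewrite hK // -big_split; apply: isD_sum => i _ _ /=.
apply: isDM => //; apply: gatP; exact: gat_form_gat.
Qed.

Lemma gat_form_contr w (Q : J -> J) : gat_form w ->
  (forall p i, D p -> gat (fun q => Q q i) p) -> gat_form (fun q t => w q (Q q :: t)).
Proof.
move=> hw hQ; split=> [p Dp|p Dp||p s Dp].
- exact: mlin_contr (gat_form_mlin hw Dp).
- exact: altn_contr (gat_form_altn hw Dp).
- have [K hK] := gat_form_fin hw; exists K => p s s' Dp h.
  by apply: hK => //; split.
- have [K hK] := gat_form_expand hw.
  apply: (gat_on Dp (f := fun q => \sum_(i <- K) Q q i * w q (evec i :: s))).
    by move=> q Dq; rewrite -hK.
  apply: gat_sum => i; apply: gatM; [exact: hQ|exact: gat_form_gat].
Qed.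

Lemma gat_form_contr_cst w V : gat_form w -> gat_form (fun q t => w q (V :: t)).
Proof. by move=> hw; apply: (gat_form_contr (Q := fun=> V)) => // p i _; exact: gat_cst. Qed.

Lemma hor_gat V p i : gat (fun q => hor q V i) p.
Proof.
case: i => [a|[ab C]].
  by apply: gat_ext (gat_cst (V (inl a)) p) => q; rewrite hor_inl.
apply: gat_ext (_ : gat (fun q => \sum_a V (inl a) * q (inr (ab, mi_add1 C a))) p).
  by move=> q; rewrite hor_inr.
apply: gat_sum => a; apply: gatM; [exact: gat_cst|exact: gat_coord].
Qed.

Lemma ver_gat V p i : gat (fun q => ver q V i) p.
Proof.
apply: (gat_ext (f := fun q => V i + (-1) * hor q V i)).
  by move=> q; rewrite /ver jaddE joppE mulN1r.
apply: gatD; first exact: gat_cst.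
apply: gatM; [exact: gat_cst|exact: hor_gat].
Qed.

Lemma vproj_gat k w p s : gat_form w -> D p -> gat (fun q => vproj_at q k (w q) s) p.
Proof.
elim: s k w => [|V s IH] k w hw Dp /=.
  apply: gatM; [exact: gat_cst|exact: gat_form_gat].
apply: gatD.
  by apply: IH => //; apply: gat_form_contr => // q i _; exact: hor_gat.
case: k => [|k]; first exact: gat_cst.
by apply: IH => //; apply: gat_form_contr => // q i _; exact: ver_gat.
Qed.

Lemma vproj_same K p k (al : seq J -> R) s s' :
  (forall t t', same_on K t t' -> al t = al t') ->
  same_on (K ++ [seq inl a | a : 'I_n]) s s' -> vproj_at p k al s = vproj_at p k al s'.
Proof.
elim: s s' k al => [|V s IH] [|V' s'] k al hal //= [hV hs].
have hinl a : V (inl a) = V' (inl a).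
  apply: hV; rewrite mem_cat; apply/orP; right.
  by apply: map_f; rewrite mem_enum.
have -> : hor p V = hor p V'.
  by rewrite /hor; apply: eq_bigr => a _; rewrite hinl.
congr (_ + _).
  by apply: IH => // t t' h; apply: hal; split.
case: k => // k.
rewrite (IH s') //; last by move=> t t' h; apply: hal; split.
apply: vproj_ext => t _; apply: hal; split; last exact: same_on_refl.
move=> i iK; have hi : V i = V' i by apply: hV; rewrite mem_cat iK.
case: i {iK} hi => [a|[ab C]] hi; first by rewrite !ver_inl.
by rewrite !ver_inr hi; congr (_ - _); apply: eq_bigr => a _; rewrite hinl.
Qed.

Lemma gat_form_vproj k w : gat_form w -> gat_form (vproj k w).
Proof.
move=> hw; split=> [p Dp|p Dp||p s Dp].
- exact: vproj_mlin (gat_form_mlin hw Dp).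
- exact: vproj_altn (gat_form_mlin hw Dp) (gat_form_altn hw Dp).
- have [K hK] := gat_form_fin hw; exists (K ++ [seq inl a | a : 'I_n]) => p s s' Dp.
  by apply: vproj_same => t t'; exact: hK.
- exact: vproj_gat.
Qed.

(** ** Lie derivatives *)

Definition Dfield (X : J -> J) p V : J := fun i => dirder (fun q => X q i) V p.

(** In the formula of Cartan the derivatives of the form along the arguments cancel. *)
Lemma lieE w (X : J -> J) p s : gat_form w -> D p -> (forall i, gat (fun q => X q i) p) ->
  lie X w p s = dirder (fun q => w q s) (X p) p + slot (Dfield X p) (w p) s.
Proof.
move=> hw Dp hX.
rewrite /lie addrfctE /= /iprod addrfctE !extE /=.
have -> : alt (fun V t => dirder (fun q => w q (X q :: t)) V p) s =
    slot (Dfield X p) (w p) s + alt (fun V t => dirder (fun q => w q (X p :: t)) V p) s.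
  rewrite slot_front; [|exact: gat_form_mlin|exact: gat_form_altn].
  rewrite -altD; apply: alt_ext => V t _; apply: isD_dirder.
  by apply: contr_rule => // i; exact: gatP.
rewrite /contr; ring.
Qed.

(** The derivative along V of the a-th total derivative: the latter is linear in the
    jet coordinates and raises the multi-index. *)
Definition jshift a V : J := fun i =>
  match i with
  | inl _ => 0
  | inr (ab, C) => V (inr (ab, mi_add1 C a))
  end.

Lemma isD_hpartial a p V i : isD (fun q => hpartial a q i) V p (jshift a V i).
Proof.
by case: i => [b|[ab C]]; [exact: isD_cst|exact: isD_coord].
Qed.

Lemma jshift_lin a (k : R) V W : jshift a (k *: V + W) = k *: jshift a V + jshift a W.
Proof. by apply/funext => -[b|[ab C]]; rewrite !jE //= mulr0 addr0. Qed.

Lemma jshiftD a V W : jshift a (V + W) = jshift a V + jshift a W.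
Proof. by have := jshift_lin a 1 V W; rewrite !scale1r. Qed.

Lemma gat_hpartial a p i : gat (fun q => hpartial a q i) p.
Proof.
by case: i => [b|[ab C]]; [exact: gat_cst|exact: gat_coord].
Qed.

(** The Lie derivative along the a-th total derivative. *)
Definition Lh a w : jet_form R n := fun p t =>
  dirder (fun q => w q t) (hpartial a p) p + slot (jshift a) (w p) t.

Lemma lie_hpartial a w p s : gat_form w -> D p -> lie (hpartial a) w p s = Lh a w p s.
Proof.
move=> hw Dp; rewrite lieE //; last by move=> i; exact: gat_hpartial.
congr (_ + _); apply: slot_ext_op => V; apply/funext => i.
exact: isD_dirder (isD_hpartial _ _ _ _).
Qed.

(** The sum of dx^a /\ (Lie derivative along the a-th total derivative). *)
Definition hd w : jet_form R n := fun p =>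
  alt (fun V t => \sum_a V (inl a) * Lh a w p t).

Definition Nv w : jet_form R n := fun p => slot (ver p) (w p).

(** The derivative along U of the vertical part of V, which depends on the point. *)
Definition Dver U V : J := - \sum_b V (inl b) *: jshift b U.

Lemma isD_ver U V p i : isD (fun q => ver q V i) U p (Dver U V i).
Proof.
rewrite /Dver joppE jsumE; case: i => [a|[ab C]].
  apply: isD_ext (_ : isD (fun=> 0) U p _) => [q|]; first by rewrite ver_inl.
  by apply: isD_eq (isD_cst _ _ _) _; rewrite big1 ?oppr0 // => b _; rewrite jscaleE mulr0.
apply: (isD_ext (F := fun q => V (inr (ab, C)) -
    \sum_a V (inl a) * q (inr (ab, mi_add1 C a)))) => [q|]; first by rewrite ver_inr.
apply: isD_eq (isDB (isD_cst _ _ _) (isD_sumT _)) _.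
  by move=> a; apply: isDZ; exact: isD_coord.
by rewrite sub0r.
Qed.

Lemma isD_slot_ver w U p s : gat_form w -> D p ->
  isD (fun q => slot (ver q) (w q) s) U p
    (slot (Dver U) (w p) s + slot (ver p) (fun t => dirder (fun q => w q t) U p) s).
Proof.
elim: s w => [|V s IH] w hw Dp /=.
  by apply: isD_eq (isD_cst _ _ _) _; rewrite addr0.
have hwV := gat_form_contr_cst V hw.
have h := contr_rule s hw Dp (fun i => isD_ver U V p i).
apply: isD_eq (isDD h (IH _ hwV Dp)) _.
by rewrite /contr addrACA.
Qed.

Lemma jshift_vertical a V b : jshift a V (inl b) = 0.
Proof. by []. Qed.

Lemma mi_add1C (C : multi_index n) a b : mi_add1 (mi_add1 C a) b = mi_add1 (mi_add1 C b) a.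
Proof. by apply/ffunP => c; rewrite !ffunE addnAC. Qed.

Lemma jshift_hpartialC a b p : jshift a (hpartial b p) = jshift b (hpartial a p).
Proof. by apply/funext => -[c|[ab C]] //=; rewrite mi_add1C. Qed.

Lemma jshift_sum a (I : Type) (r : seq I) (k : I -> R) (V : I -> J) :
  jshift a (\sum_(i <- r) k i *: V i) = \sum_(i <- r) k i *: jshift a (V i).
Proof.
elim: r => [|i r IH]; last by rewrite !big_cons jshift_lin IH.
by rewrite !big_nil; apply/funext => -[b|[ab C]].
Qed.

(** Total derivatives preserve the splitting into vertical and horizontal vectors,
    because they commute with one another. *)
Lemma Dver_hpartial a p V :
  Dver (hpartial a p) V + (ver p (jshift a V) - jshift a (ver p V)) = 0.
Proof.
rewrite (ver_vertical p (jshift_vertical a V)).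
have -> : jshift a (ver p V) = jshift a V - jshift a (hor p V).
  by rewrite /ver addrC -scaleN1r jshift_lin scaleN1r addrC.
rewrite /hor jshift_sum /Dver opprB [jshift a V + _]addrC subrK addrC.
apply/eqP; rewrite subr_eq0; apply/eqP; apply: eq_bigr => b _.
by rewrite jshift_hpartialC.
Qed.

Lemma Lh_Nv a w p s : gat_form w -> D p ->
  slot (ver p) (Lh a w p) s = Lh a (Nv w) p s.
Proof.
move=> hw Dp; rewrite /Lh slotD (isD_dirder (isD_slot_ver _ _ hw Dp)).
have hm := gat_form_mlin hw Dp.
have e : slot (Dver (hpartial a p)) (w p) s +
    (slot (jshift a) (slot (ver p) (w p)) s - slot (ver p) (slot (jshift a) (w p)) s) = 0.
  rewrite slot_comm // -slot_opD // -(slot_op0 s hm).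
  by apply: slot_ext_op => V; exact: Dver_hpartial.
rewrite -[slot (jshift a) (Nv w p) s]/(slot (jshift a) (slot (ver p) (w p)) s).
rewrite -[LHS]addr0 -e; ring.
Qed.

(** The operator hd preserves the vertical degree, since the forms dx^a are horizontal
    and the Lie derivatives along total derivatives commute with slot (ver p). *)
Lemma hd_Nv w p s : gat_form w -> D p -> slot (ver p) (hd w p) s = hd (Nv w) p s.
Proof.
move=> hw Dp; rewrite /hd slot_alt.
rewrite (_ : alt _ s = 0) ?add0r; last first.
  rewrite -[RHS](alt0 s); apply: alt_ext => V t _.
  by rewrite /= big1 // => a _; rewrite ver_inl mul0r.
apply: alt_ext => V t _; rewrite slot_sum; apply: eq_bigr => a _.
by rewrite slotZ Lh_Nv.
Qed.

Lemma dirder_ver w U p t : gat_form w -> D p -> dirder (fun q => w q t) (ver p U) p =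
  dirder (fun q => w q t) U p -
  \sum_a U (inl a) * dirder (fun q => w q t) (hpartial a p) p.
Proof.
move=> hw Dp; have hg := gat_form_gat hw t Dp.
by rewrite /ver gatB // /hor gat_sumU.
Qed.

(** The commutator of slot (ver p) with the total differential is the difference of
    the latter and hd: the derivatives along vertical arguments are those of the
    total differential minus those along total derivatives, and the derivative of
    the projection ver supplies the terms by which total derivatives act on the
    arguments. *)
Lemma ext_Nv w p s : gat_form w -> D p ->
  slot (ver p) (ext w p) s - ext (Nv w) p s = ext w p s - hd w p s.
Proof.
move=> hw Dp; have hm := gat_form_mlin hw Dp; have ha := gat_form_altn hw Dp.
have -> : slot (ver p) (ext w p) s =
    slot (ver p) (alt (fun V t => dirder (fun q => w q t) V p)) s.
  by apply: slot_ext => t _; rewrite extE.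
rewrite slot_alt !extE.
rewrite [alt (fun V t => dirder (fun q => Nv w q t) V p) s](_ : _ =
    alt (fun V => slot (Dver V) (w p)) s +
    alt (fun V => slot (ver p) (fun t => dirder (fun q => w q t) V p)) s); last first.
  rewrite -altD; apply: alt_ext => V t _.
  exact: isD_dirder (isD_slot_ver _ _ hw Dp).
have -> : alt (fun V => slot (Dver V) (w p)) s =
   alt (fun V t => \sum_a V (inl a) * slot (jshift a) (w p) t) s.
  transitivity (- alt (fun V => slot (fun W => \sum_b W (inl b) *: jshift b V) (w p)) s).
    by rewrite -altN; apply: alt_ext => V t _; rewrite -slot_opN.
  rewrite altn_slot_sym // opprK; apply: alt_ext => V t _.
  by rewrite slot_op_sum //; apply: eq_bigr => a _; rewrite slot_opZ.
have e : alt (fun V t => dirder (fun q => w q t) V p) s - hd w p s =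
    alt (fun V t => dirder (fun q => w q t) (ver p V) p) s -
    alt (fun V t => \sum_a V (inl a) * slot (jshift a) (w p) t) s.
  rewrite /hd -!altB; apply: alt_ext => V t _; rewrite dirder_ver //.
  have -> : \sum_a V (inl a) * Lh a w p t =
     \sum_a V (inl a) * dirder (fun q => w q t) (hpartial a p) p +
     \sum_a V (inl a) * slot (jshift a) (w p) t.
    by rewrite -big_split; apply: eq_bigr => a _; rewrite /= -mulrDr.
  ring.
rewrite e; ring.
Qed.

Lemma mlin_alt (be : J -> seq J -> R) : (forall V, mlin (be V)) ->
  (forall t (k : R) V W, be (k *: V + W) t = k * be V t + be W t) -> mlin (alt be).
Proof.
move=> hm hl s1; elim: s1 be hm hl => [|X s1 IH] be hm hl s2 k V W /=.
  rewrite hl.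
  have -> : alt (fun W0 => contr (k *: V + W) (be W0)) s2 =
     k * alt (fun W0 => contr V (be W0)) s2 + alt (fun W0 => contr W (be W0)) s2.
    by rewrite -altZ -altD; apply: alt_ext => Y t _; rewrite /contr (hm Y [::]).
  ring.
rewrite hm IH; first ring.
- by move=> Y; exact: mlin_contr.
- by move=> t c Y Z; rewrite /contr hl.
Qed.

Lemma mlin_dirder w U p : gat_form w -> D p -> mlin (fun t => dirder (fun q => w q t) U p).
Proof.
move=> hw Dp s1 s2 k V W; apply: isD_dirder.
apply: (isD_on Dopen Dp (F := fun q => k * w q (s1 ++ V :: s2) + w q (s1 ++ W :: s2))).
  by move=> q Dq; rewrite (gat_form_mlin hw Dq).
by apply: isDD; [apply: isDZ|]; apply: gatP; exact: gat_form_gat.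
Qed.

Lemma mlin_ext w p : gat_form w -> D p -> mlin (ext w p).
Proof.
move=> hw Dp s1 s2 k V W; rewrite !extE; apply: mlin_alt.
  by move=> U; exact: mlin_dirder.
by move=> t c U U'; rewrite gat_lin //; exact: gat_form_gat.
Qed.

Lemma mlin_hd w p : gat_form w -> D p -> mlin (hd w p).
Proof.
move=> hw Dp; apply: mlin_alt => [V s1 s2 k U W|t k V W].
  rewrite mulr_sumr -big_split; apply: eq_bigr => a _ /=.
  rewrite /Lh (mlin_dirder _ hw Dp) mlin_slot; first ring.
    exact: jshift_lin.
  exact: gat_form_mlin.
rewrite mulr_sumr -big_split; apply: eq_bigr => a _ /=.
rewrite !jE; ring.
Qed.

Lemma Lh_on a w w' p s : D p -> (forall q t, D q -> size t = size s -> w q t = w' q t) ->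
  Lh a w p s = Lh a w' p s.
Proof.
move=> Dp h; rewrite /Lh (dirder_on _ Dopen Dp (g := fun q => w' q s)); last first.
  by move=> q Dq; exact: h.
by congr (_ + _); apply: slot_ext => t e; rewrite h.
Qed.

Lemma hd_on w w' p s : D p ->
  (forall q t, D q -> (size t).+1 = size s -> w q t = w' q t) -> hd w p s = hd w' p s.
Proof.
move=> Dp h; apply: alt_ext => V t e; apply: eq_bigr => a _; congr (_ * _).
by apply: Lh_on => // q t' Dq e'; apply: h => //; rewrite e'.
Qed.

Lemma ext_on_size w w' p s : D p ->
  (forall q t, D q -> (size t).+1 = size s -> w q t = w' q t) -> ext w p s = ext w' p s.
Proof.
move=> Dp h; rewrite !extE; apply: alt_ext => V t e.
by apply: (dirder_on _ Dopen Dp) => q Dq; exact: h.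
Qed.

Lemma Lh_sum a (I : eqType) (r : seq I) (w : I -> jet_form R n) (c : I -> R) p s : D p ->
  (forall i, gat_form (w i)) ->
  Lh a (fun q t => \sum_(i <- r) c i * w i q t) p s = \sum_(i <- r) c i * Lh a (w i) p s.
Proof.
move=> Dp hw; rewrite /Lh slot_sum.
have -> : dirder (fun q => \sum_(i <- r) c i * w i q s) (hpartial a p) p =
   \sum_(i <- r) c i * dirder (fun q => w i q s) (hpartial a p) p.
  apply: isD_dirder; apply: isD_sum => i _ _; apply: isDZ; apply: gatP; exact: gat_form_gat.
by rewrite -big_split; apply: eq_bigr => i _ /=; rewrite slotZ mulrDr.
Qed.

Lemma hd_sum (I : eqType) (r : seq I) (w : I -> jet_form R n) (c : I -> R) p s : D p ->
  (forall i, gat_form (w i)) ->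
  hd (fun q t => \sum_(i <- r) c i * w i q t) p s = \sum_(i <- r) c i * hd (w i) p s.
Proof.
move=> Dp hw; transitivity (alt (fun V t =>
    \sum_(i <- r) c i * \sum_a V (inl a) * Lh a (w i) p t) s); last first.
  by rewrite alt_sum; apply: eq_bigr => i _; rewrite altZ.
apply: alt_ext => V t _; under [RHS]eq_bigr => i _ do rewrite mulr_sumr.
rewrite exchange_big; apply: eq_bigr => a _ /=.
by rewrite Lh_sum // mulr_sumr; apply: eq_bigr => i _; rewrite mulrCA.
Qed.

Lemma ext_sum (I : eqType) (r : seq I) (w : I -> jet_form R n) (c : I -> R) p s : D p ->
  (forall i, gat_form (w i)) ->
  ext (fun q t => \sum_(i <- r) c i * w i q t) p s = \sum_(i <- r) c i * ext (w i) p s.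
Proof.
move=> Dp hw; rewrite extE; transitivity (alt (fun V t =>
    \sum_(i <- r) c i * dirder (fun q => w i q t) V p) s); last first.
  by rewrite alt_sum; apply: eq_bigr => i _; rewrite altZ extE.
apply: alt_ext => V t _; apply: isD_dirder; apply: isD_sum => i _ _; apply: isDZ.
by apply: gatP; exact: gat_form_gat.
Qed.

Lemma hdZ c w p s : D p -> gat_form w -> hd (fun q t => c * w q t) p s = c * hd w p s.
Proof.
move=> Dp hw; have := @hd_sum unit [:: tt] (fun=> w) (fun=> c) p s Dp (fun=> hw).
rewrite big_seq1 => <-; apply: hd_on => // q t _ _; by rewrite big_seq1.
Qed.

Lemma extZ c w p s : D p -> gat_form w -> ext (fun q t => c * w q t) p s = c * ext w p s.
Proof.
move=> Dp hw; have := @ext_sum unit [:: tt] (fun=> w) (fun=> c) p s Dp (fun=> hw).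
rewrite big_seq1 => <-; apply: ext_on_size => // q t _ _; by rewrite big_seq1.
Qed.

Section Component.
Variables (w : jet_form R n) (k : nat) (p : J).
Hypotheses (hw : gat_form w) (Dp : D p).

Let wk := vproj k w.

Let hwk : gat_form wk. Proof. exact: gat_form_vproj. Qed.

Lemma Nv_vproj q t : D q -> Nv wk q t = k%:R * wk q t.
Proof. by move=> Dq; apply: slot_ver_vproj; exact: gat_form_mlin. Qed.

Lemma vproj_hd j s : vproj j (hd wk) p s = (j == k)%:R * hd wk p s.
Proof.
apply: vproj_eigen => [|t]; first exact: mlin_hd.
rewrite hd_Nv // -hdZ //; apply: hd_on => // q t' Dq _; exact: Nv_vproj.
Qed.

Lemma vproj_vd j s : vproj j (fun q t => ext wk q t - hd wk q t) p s =
  (j == k.+1)%:R * (ext wk p s - hd wk p s).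
Proof.
apply: (@vproj_eigen _ _ p k.+1 j (fun t => ext wk p t - hd wk p t)) => [s1 s2 c V W|t].
  rewrite mlin_ext // mlin_hd //; ring.
rewrite slotD slotN hd_Nv //.
have -> : hd (Nv wk) p t = k%:R * hd wk p t.
  by rewrite -hdZ //; apply: hd_on => // q t' Dq _; exact: Nv_vproj.
have := ext_Nv t hwk Dp.
have -> : ext (Nv wk) p t = k%:R * ext wk p t.
  by rewrite -extZ //; apply: ext_on_size => // q t' Dq _; exact: Nv_vproj.
move=> /eqP; rewrite subr_eq => /eqP ->; rewrite -natr1; ring.
Qed.

(** On forms of vertical degree k the total differential splits into hd, of vertical
    degree k, and the rest, which has the eigenvalue k + 1 by ext_Nv. *)
Lemma vproj_ext_vproj j s : vproj j (ext wk) p s =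
  (j == k)%:R * hd wk p s + (j == k.+1)%:R * (ext wk p s - hd wk p s).
Proof.
rewrite -vproj_hd -vproj_vd -vprojD; apply: vproj_ext => t _.
by rewrite addrC subrK.
Qed.

End Component.

Lemma hdiffE w p s : gat_form w -> D p -> hdiff w p s = hd w p s.
Proof.
move=> hw Dp; rewrite /hdiff.
transitivity (\sum_(k < size s) 1 * hd (vproj k w) p s).
  apply: eq_bigr => k _; rewrite vproj_ext_vproj // eqxx.
  by rewrite (ltn_eqF (ltnSn k)) mul0r addr0.
rewrite -hd_sum //; last by move=> i; exact: gat_form_vproj.
apply: hd_on => // q t Dq e; rewrite -(@vproj_total _ _ q _ t (size s)).
- by apply: eq_bigr => k _; rewrite mul1r.
- exact: gat_form_mlin.
- by rewrite -e.
Qed.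

Lemma vdiffE w p s : gat_form w -> D p -> vdiff w p s = ext w p s - hd w p s.
Proof.
move=> hw Dp; rewrite /vdiff.
transitivity (\sum_(k < size s) 1 * ext (vproj k w) p s - \sum_(k < size s) 1 * hd (vproj k w) p s).
  rewrite -sumrB; apply: eq_bigr => k _; rewrite vproj_ext_vproj // eqxx.
  by rewrite (gtn_eqF (ltnSn k)) mul0r add0r !mul1r.
have E q t : D q -> (size t).+1 = size s -> \sum_(k < size s) 1 * vproj k w q t = w q t.
  move=> Dq e; rewrite -[RHS](@vproj_total _ _ q _ t (size s)).
  - by apply: eq_bigr => k _; rewrite mul1r.
  - exact: gat_form_mlin.
  - by rewrite -e.
rewrite -hd_sum -?ext_sum //; try by move=> i; exact: gat_form_vproj.
by congr (_ - _); [apply: ext_on_size|apply: hd_on].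
Qed.

End Differentials.

(** * Symmetry of second derivatives *)

Section Schwarz.
Context {R : realType}.

Lemma line_near (V : normedModType R) (U : set V) (x v : V) : open U -> U x ->
  \forall t \near (0 : R), U (x + t *: v).
Proof.
move=> oU Ux.
have c : (fun t : R => x + t *: v) @ (0 : R) --> x + (0 : R) *: v.
  apply: cvgD; first exact: cvg_cst.
  by apply: cvgZr_tmp; exact: cvg_id.
apply: c; rewrite scale0r addr0; exact: open_nbhs_nbhs.
Qed.

Lemma norm_sub_via (X P Q d d' : R) : `|X - Q| <= d -> `|X - P| <= d' -> `|P - Q| <= d + d'.
Proof.
move=> h h'; have -> : P - Q = (X - Q) - (X - P) by ring.
by rewrite (le_trans (ler_normB _ _)) // lerD.
Qed.

Context {m : nat}.
Implicit Types (f : 'rV[R]_m -> R) (U : set 'rV[R]_m) (x : 'rV[R]_m).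

Lemma smooth_differentiable U f x : smooth_on U f -> U x -> differentiable f x.
Proof. by move=> h; exact: (h [::]). Qed.

Lemma smooth_partial U f a : smooth_on U f -> smooth_on U (partial a f).
Proof. by move=> h s x Ux; have := h (rcons s a) x Ux; rewrite foldr_rcons. Qed.

Lemma partialP U f a x : smooth_on U f -> U x ->
  is_derive x (delta_mx 0 a) f (partial a f x).
Proof.
by move=> hf Ux; apply: derivableP; apply: diff_derivable; exact: smooth_differentiable Ux.
Qed.

Lemma diff_partial f x (u : 'rV[R]_m) : differentiable f x ->
  'd f x u = \sum_a u 0 a * partial a f x.
Proof.
move=> df; rewrite {1}(row_sum_delta u) linear_sum; apply: eq_bigr => a _.
by rewrite linearZ /partial deriveE.
Qed.

Let ea (a : 'I_m) : 'rV[R]_m := delta_mx 0 a.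

Let Delta f x a b (h : R) :=
  f (x + h *: ea b + h *: ea a) - f (x + h *: ea a) - (f (x + h *: ea b) - f x).

(** By the mean value theorem the second difference is h times a difference of
    values of the partial derivative g of f; the differentiability of g at x
    evaluates it up to order h^2. *)
Lemma second_difference U f a b x (e : R) : open U -> smooth_on U f -> U x -> 0 < e ->
  exists2 r : R, 0 < r & forall h, 0 < h < r ->
    `|Delta f x a b h - h ^+ 2 * partial b (partial a f) x| <= e * h ^+ 2.
Proof.
move=> oU sf Ux e0.
pose g := partial a f; have sg : smooth_on U g by exact: smooth_partial.
have dg := smooth_differentiable sg Ux.
pose k : R := `|ea a| + `|ea b| + 1.
have k0 : 0 < k by rewrite ltr_wpDl // addr_ge0.
have e1 : 0 < e / (2 * k) by rewrite divr_gt0 // mulr_gt0.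
have /eqaddoP hg0 := diff_locally dg.
have hg := hg0 _ e1.
have hU : \forall v \near (0 : 'rV[R]_m), U (v + x).
  have c : (fun v => v + x) @ (0 : 'rV[R]_m) --> 0 + x.
    by apply: (@cvgD _ _ _ (nbhs (0 : 'rV[R]_m)) _ id (cst x)); [exact: cvg_id|exact: cvg_cst].
  apply: c; rewrite add0r; exact: open_nbhs_nbhs.
have [r r0 hr] := (nbhs_ballP _ _).1 (filterI hg hU).
exists (r / k); first by rewrite divr_gt0.
move=> h /andP[h0 hrk].
have hk : h * k < r by rewrite -ltr_pdivlMr.
(* The boolean t selects one of the two segments x + s ea a and x + h ea b + s ea a. *)
have small (s : R) (t : bool) : 0 <= s <= h ->
    `|s *: ea a + (if t then h else 0) *: ea b| <= h * k.
  move=> /andP[s0 sh]; rewrite (le_trans (ler_normD _ _)) // !normrZ (ger0_norm s0).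
  rewrite ger0_norm; last by case: t => //; exact: ltW.
  rewrite /k !mulrDr mulr1 -[leLHS]addr0 lerD // ?(ltW h0) // lerD //.
    by rewrite ler_wpM2r.
  by rewrite ler_wpM2r //; case: t => //; exact: ltW.
have near0 s t : 0 <= s <= h -> let v := s *: ea a + (if t then h else 0) *: ea b in
    `|g (v + x) - g x - 'd g x v| <= e / (2 * k) * `|v| /\ U (v + x).
  move=> hs v; have : ball (0 : 'rV[R]_m) r v.
    by rewrite -ball_normE /= sub0r normrN (le_lt_trans (small s t hs)).
  by move/hr => [/= hv Uv]; split=> //; rewrite -addrA -opprD.
have Us s t : 0 <= s <= h -> U (x + (if t then h else 0) *: ea b + s *: ea a).
  move=> /(near0 _ t) [_]; congr U.
  by rewrite -addrA addrC; congr (_ + _); rewrite addrC.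
(* The second difference is phi h - phi 0; its derivative dphi is a difference of
   values of g, both within h * k < r of x. *)
pose phi s := f (x + h *: ea b + s *: ea a) - f (x + s *: ea a).
pose dphi s := g (x + h *: ea b + s *: ea a) - g (x + s *: ea a).
have hphi s : 0 <= s <= h -> is_derive s 1 phi (dphi s).
  move=> hs; apply: is_deriveB; apply: is_derive_line; apply: (@partialP U f a _ sf).
    exact: (Us s true).
  by have := Us s false hs; rewrite scale0r addr0.
have [c hc E] : exists2 c, c \in `]0, h[%R & phi h - phi 0 = dphi c * (h - 0).
  apply: MVT => //.
    move=> s; rewrite in_itv /= => /andP[s0 sh]; apply: hphi.
    by rewrite (ltW s0) (ltW sh).
  apply: derivable_within_continuous => s; rewrite in_itv /= => hs.
  by have [] := hphi s hs.
have hc' : 0 <= c <= h by move: hc; rewrite in_itv /= => /andP[/ltW -> /ltW ->].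
have -> : Delta f x a b h = dphi c * h.
  by rewrite -[h in RHS]subr0 -E /phi /Delta !scale0r !addr0.
have [h1 _] := near0 c true hc'; have [h2 _] := near0 c false hc'.
move: h1 h2; rewrite /= scale0r addr0.
set v1 := c *: ea a + h *: ea b; set v2 := c *: ea a => h1 h2.
have s1 : `|v1| <= h * k by exact: (small c true).
have s2 : `|v2| <= h * k by have := small c false hc'; rewrite scale0r addr0.
have dE : 'd g x v1 - 'd g x v2 = h * partial b g x.
  by rewrite -linearB /v1 addrAC subrr add0r linearZ /partial deriveE.
have -> : dphi c * h - h ^+ 2 * partial b (partial a f) x =
   h * ((g (v1 + x) - g x - 'd g x v1) - (g (v2 + x) - g x - 'd g x v2)).
  have -> : g (v1 + x) = g (x + h *: ea b + c *: ea a).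
    by congr g; rewrite /v1 addrC -addrA; congr (_ + _); rewrite addrC.
  have -> : g (v2 + x) = g (x + c *: ea a) by rewrite addrC.
  rewrite -[partial a f]/g expr2 -mulrA -dE /dphi; ring.
rewrite normrM (gtr0_norm h0).
have B : forall A1 A2 : R, `|A1| <= e / (2 * k) * `|v1| -> `|A2| <= e / (2 * k) * `|v2| ->
    h * `|A1 - A2| <= e * h ^+ 2.
  move=> A1 A2 a1 a2.
  have -> : e * h ^+ 2 = h * (e / (2 * k) * (h * k) + e / (2 * k) * (h * k)).
    by field; rewrite lt0r_neq0.
  rewrite ler_pM2l // (le_trans (ler_normB _ _)) // lerD //.
    by rewrite (le_trans a1) // ler_pM2l.
  by rewrite (le_trans a2) // ler_pM2l.
exact: B.
Qed.

(** The second difference is symmetric in the two directions. *)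
Lemma schwarz U f a b x : open U -> smooth_on U f -> U x ->
  partial a (partial b f) x = partial b (partial a f) x.
Proof.
move=> oU sf Ux; apply/eqP; rewrite -subr_eq0 -normr_le0; apply/ler_addgt0Pr => e e0.
have e2 : 0 < e / 2 by rewrite divr_gt0.
have [r r0 hr] := second_difference a b oU sf Ux e2.
have [r' r0' hr'] := second_difference b a oU sf Ux e2.
(* One step h serves for both orders of the partial derivatives. *)
pose h := Num.min r r' / 2.
have h0 : 0 < h by rewrite divr_gt0 // lt_min r0 r0'.
have hm : h < Num.min r r' by rewrite ltr_pdivrMr // ltr_pMr ?lt_min ?r0 ?r0' // ltr1n.
have /hr A : 0 < h < r by rewrite h0 (lt_le_trans hm) // ge_min lexx.
have /hr' B : 0 < h < r' by rewrite h0 (lt_le_trans hm) // ge_min lexx orbT.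
have S : Delta f x a b h = Delta f x b a h.
  by rewrite /Delta (addrAC x); set X := f _; set Y := f _; set Z := f _; set T := f _; ring.
rewrite add0r -(ler_pM2l (exprn_gt0 2 h0)) -{1}(gtr0_norm (exprn_gt0 2 h0)) -normrM.
rewrite S in A.
rewrite mulrBr (le_trans (norm_sub_via A B)) // (_ : h ^+ 2 * e = e / 2 * h ^+ 2 + e / 2 * h ^+ 2) //.
by field.
Qed.

End Schwarz.

(** * Prolongation of the action of vector fields *)

Section Prolongation.
Context {R : realType} {n : nat} (U : set 'rV[R]_n) (oU : open U).
Notation J := (jspace R n).
Implicit Types (p q V : J) (h : J -> R) (f : 'rV[R]_n -> R) (a b c d : 'I_n).

Definition over : set J := [set p | U (basept p)].

Lemma basept_line p V (t : R) : basept (p + t *: V) = basept p + t *: basept V.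
Proof. by apply/rowP => a; rewrite !mxE. Qed.

Lemma over_open : line_open over.
Proof.
move=> p V hp.
have := line_near (basept V) oU hp.
by apply: filterS => t; rewrite /over /= basept_line.
Qed.

Lemma isD_base f p V : smooth_on U f -> over p ->
  isD (fun q => f (basept q)) V p (\sum_a V (inl a) * partial a f (basept p)).
Proof.
move=> sf hp; have df := smooth_differentiable sf hp.
have := derivableP (diff_derivable (v := basept V) df).
rewrite deriveE // => /der0_line h.
apply: der0_eq; first by apply: der0_ext h => t; rewrite -basept_line.
by rewrite diff_partial //; apply: eq_bigr => a _; rewrite mxE.
Qed.

Lemma gat_base f p : smooth_on U f -> over p -> gat (fun q => f (basept q)) p.
Proof.
move=> sf hp; exists (fun V => \sum_a V (inl a) * partial a f (basept p)); split.
  move=> k V W; rewrite mulr_sumr -big_split; apply: eq_bigr => a _.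
  by rewrite !jE /=; ring.
by move=> V; exact: isD_base.
Qed.

(** ** Functions linear in the derivatives of the metric *)

(** Formal sums of terms c f(x) g_{ab,C}, the components of xi and of its total
    derivatives.  On them total derivatives are computed symbolically by Dtot. *)
Definition terms : Type := seq ((R * ('rV[R]_n -> R)) * (upair n * multi_index n)).
Implicit Types (l : terms).

Definition ev l p : R := \sum_(x <- l) x.1.1 * x.1.2 (basept p) * p (inr x.2).

Fixpoint smooth_terms l : Prop :=
  if l is x :: l' then smooth_on U x.1.2 /\ smooth_terms l' else True.

Fixpoint Dtot a l : terms :=
  if l is x :: l' then
    ((x.1.1, partial a x.1.2), x.2) :: (x.1, (x.2.1, mi_add1 x.2.2 a)) :: Dtot a l'
  else [::].

Lemma ev_cons x l p : ev (x :: l) p = x.1.1 * x.1.2 (basept p) * p (inr x.2) + ev l p.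
Proof. by rewrite /ev big_cons. Qed.

Lemma ev_nil p : ev [::] p = 0.
Proof. by rewrite /ev big_nil. Qed.

Lemma smooth_cat l l' : smooth_terms l -> smooth_terms l' -> smooth_terms (l ++ l').
Proof. by elim: l => [|x l IH] //= [hx /IH h] /h. Qed.

Lemma smooth_Dtot a l : smooth_terms l -> smooth_terms (Dtot a l).
Proof. by elim: l => [|x l IH] //= [hx /IH h]; split=> //; exact: smooth_partial. Qed.

Definition evD l p V : R := \sum_(x <- l) x.1.1 *
  ((\sum_a V (inl a) * partial a x.1.2 (basept p)) * p (inr x.2) +
   x.1.2 (basept p) * V (inr x.2)).

Lemma isD_ev l p V : smooth_terms l -> over p -> isD (ev l) V p (evD l p V).
Proof.
move=> hl hp; elim: l hl => [_|x l IH /= [hx /IH {}IH]].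
  apply: isD_ext (_ : isD (fun=> 0) V p _); first by move=> q; rewrite ev_nil.
  by apply: isD_eq (isD_cst _ _ _) _; rewrite /evD big_nil.
apply: isD_ext (_ : isD (fun q => x.1.1 * (x.1.2 (basept q) * q (inr x.2)) + ev l q) V p _).
  by move=> q; rewrite ev_cons mulrA.
apply: isD_eq (isDD (isDZ _ (isDM (isD_base _ hx hp) (isD_coord _ _ _))) IH) _.
by rewrite /evD big_cons.
Qed.

Lemma gat_ev l p : smooth_terms l -> over p -> gat (ev l) p.
Proof.
move=> hl hp; elim: l hl => [_|x l IH /= [hx /IH {}IH]].
  by apply: gat_ext (gat_cst 0 p) => q; rewrite ev_nil.
apply: gat_ext (_ : gat (fun q => (x.1.1 * (x.1.2 (basept q) * q (inr x.2))) + ev l q) p).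
  by move=> q; rewrite ev_cons mulrA.
apply: gatD => //; apply: gatM; first exact: gat_cst.
by apply: gatM; [exact: gat_base|exact: gat_coord].
Qed.

Lemma sum_hpartial a p (F : 'I_n -> R) : \sum_b hpartial a p (inl b) * F b = F a.
Proof.
rewrite (bigD1 a) //= eqxx mul1r big1 ?addr0 // => b ba.
by rewrite (negbTE ba) mul0r.
Qed.

Lemma evD_hpartial a l p : evD l p (hpartial a p) = ev (Dtot a l) p.
Proof.
rewrite /evD; elim: l => [|x l IH]; first by rewrite big_nil ev_nil.
case: x => [[c f] [ab C]].
by rewrite big_cons IH (sum_hpartial a p (fun b => partial b f (basept p))) /= !ev_cons /=; ring.
Qed.

Lemma tot_ev a l p : smooth_terms l -> over p -> tot a (ev l) p = ev (Dtot a l) p.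
Proof. by move=> hl hp; rewrite -evD_hpartial; exact: isD_dirder (isD_ev _ hl hp). Qed.

(** The mixed terms agree after an exchange; the terms with two derivatives of a
    coefficient agree by the symmetry of second derivatives. *)
Lemma DtotC a b l p : smooth_terms l -> over p ->
  ev (Dtot a (Dtot b l)) p = ev (Dtot b (Dtot a l)) p.
Proof.
move=> hl hp; elim: l hl => //= x l IH [hx /IH {}IH].
rewrite !ev_cons /= IH (schwarz a b oU hx hp) mi_add1C.
by congr (_ + _); rewrite addrCA.
Qed.

Definition jet_linear h := exists l, smooth_terms l /\ forall p, over p -> h p = ev l p.

Definition eq_over h h' := forall p, over p -> h p = h' p.

Lemma tot_eq_over a h h' : eq_over h h' -> eq_over (tot a h) (tot a h').
Proof. by move=> e p hp; apply: (dirder_on _ over_open). Qed.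

Lemma jet_linear_eq h h' : eq_over h h' -> jet_linear h -> jet_linear h'.
Proof. by move=> e [l [hl h1]]; exists l; split=> // p hp; rewrite -e // h1. Qed.

Lemma jet_linear_gat h p : jet_linear h -> over p -> gat h p.
Proof.
move=> [l [hl e]] hp; apply: (gat_on over_open hp (f := ev l)); last exact: gat_ev.
by move=> q hq; rewrite e.
Qed.

Lemma jet_linear_tot a h : jet_linear h -> jet_linear (tot a h).
Proof.
move=> [l [hl e]]; exists (Dtot a l); split; first exact: smooth_Dtot.
by move=> p hp; rewrite -tot_ev //; apply: tot_eq_over.
Qed.

Lemma jet_linear_totC a b h : jet_linear h -> eq_over (tot a (tot b h)) (tot b (tot a h)).
Proof.
move=> [l [hl e]] p hp.
have E c d : tot c (tot d h) p = ev (Dtot c (Dtot d l)) p.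
  rewrite -tot_ev //; last exact: smooth_Dtot.
  apply: tot_eq_over => // q hq; rewrite -tot_ev //; exact: tot_eq_over.
by rewrite !E DtotC.
Qed.

Lemma jet_linear_add h h' : jet_linear h -> jet_linear h' -> jet_linear (fun p => h p + h' p).
Proof.
move=> [l [hl e]] [l' [hl' e']]; exists (l ++ l'); split; first exact: smooth_cat.
by move=> p hp; rewrite e // e' // /ev big_cat.
Qed.

Lemma jet_linear0 : jet_linear (fun=> 0).
Proof. by exists [::]; split=> // p _; rewrite ev_nil. Qed.

Lemma jet_linear_sum (I : Type) (r : seq I) (h : I -> J -> R) : (forall i, jet_linear (h i)) ->
  jet_linear (fun p => \sum_(i <- r) h i p).
Proof.
move=> hh; elim: r => [|i r IH].
  by apply: jet_linear_eq jet_linear0 => p _; rewrite big_nil.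
by apply: jet_linear_eq (jet_linear_add (hh i) IH) => p _; rewrite big_cons.
Qed.

Lemma jet_linear_term k f K : smooth_on U f -> jet_linear (fun p => k * (f (basept p) * p (inr K))).
Proof.
move=> hf; exists [:: ((k, f), K)]; split=> // p _.
by rewrite ev_cons ev_nil addr0 mulrA.
Qed.

Lemma jet_linear_opp h : jet_linear h -> jet_linear (fun p => - h p).
Proof.
move=> [l [hl e]]; exists (map (fun x => ((- x.1.1, x.1.2), x.2)) l); split.
  by elim: l hl {e} => //= x l IH [hx /IH].
move=> p hp; rewrite e //; elim: l {hl e} => [|x l IH]; first by rewrite /= ev_nil oppr0.
by rewrite /= !ev_cons /= opprD IH; congr (_ + _); ring.
Qed.

Lemma jet_linear_iter a h k : jet_linear h -> jet_linear (iter k (tot a) h).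
Proof. by move=> hh; elim: k => //= k; exact: jet_linear_tot. Qed.

Lemma iter_eq_over a h h' k : eq_over h h' -> eq_over (iter k (tot a) h) (iter k (tot a) h').
Proof. by move=> e; elim: k => //= k IH; exact: tot_eq_over. Qed.

Lemma jet_linear_iterC a b h k : jet_linear h ->
  eq_over (iter k (tot b) (tot a h)) (tot a (iter k (tot b) h)).
Proof.
move=> hh; elim: k => //= k IH p hp.
by apply: etrans (tot_eq_over b IH hp) _; exact: jet_linear_totC (jet_linear_iter b k hh) p hp.
Qed.

Definition tot_list (r : seq 'I_n) (C : multi_index n) h :=
  foldr (fun a h => iter (C a) (tot a) h) h r.

Lemma jet_linear_tot_list r C h : jet_linear h -> jet_linear (tot_list r C h).
Proof. by move=> hh; elim: r => //= a r IH; exact: jet_linear_iter. Qed.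

Lemma jet_linear_tot_mi C h : jet_linear h -> jet_linear (tot_mi C h).
Proof. exact: jet_linear_tot_list. Qed.

Lemma tot_list_add a r C h : jet_linear h -> uniq r -> a \in r ->
  eq_over (tot_list r (mi_add1 C a) h) (tot a (tot_list r C h)).
Proof.
move=> hh; elim: r => //= b r IH /andP[br ur]; rewrite in_cons.
have [->{a IH}|ab] := eqVneq a b; last first.
  move=> /= ar p hp; rewrite ffunE eq_sym (negbTE ab) addn0.
  apply: etrans (iter_eq_over b (C b) (IH ur ar) hp) _.
  exact: jet_linear_iterC (jet_linear_tot_list r C hh) p hp.
move=> _ p hp; rewrite ffunE eqxx addn1 /=; congr (tot b (iter _ _ _) p).
elim: r br {ur} => //= a r IH; rewrite in_cons negb_or => /andP[ba /IH ->].
by rewrite ffunE eq_sym (negbTE ba) addn0.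
Qed.

(** Iterated total derivatives are defined in a fixed order of the indices; since they
    commute, one more derivative can be taken last. *)
Lemma tot_mi_add1 a C h : jet_linear h -> eq_over (tot_mi (mi_add1 C a) h) (tot a (tot_mi C h)).
Proof. by move=> hh; apply: tot_list_add => //; rewrite ?enum_uniq ?mem_enum. Qed.

Lemma tot_mi0 h : tot_mi (mi0 n) h = h.
Proof. by rewrite /tot_mi; elim: (enum _) => //= a r ->; rewrite ffunE. Qed.

Lemma mi_ind (P : multi_index n -> Prop) : P (mi0 n) ->
  (forall C a, P C -> P (mi_add1 C a)) -> forall C, P C.
Proof.
move=> h0 h1 C; have [m] := ubnP (mi_size C); elim: m C => // m IH C hC.
have [/existsP[a ha]|/existsPn h] := boolP [exists a, (0 < C a)%N]; last first.
  suff -> : C = mi0 n by [].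
  by apply/ffunP => a; rewrite ffunE; have := h a; case: (C a).
pose C' : multi_index n := [ffun b => (C b - (b == a))%N].
have -> : C = mi_add1 C' a.
  by apply/ffunP => b; rewrite !ffunE; case: eqVneq => [->|_]; rewrite ?subnK ?subn0 ?addn0.
apply: h1; apply: IH; rewrite -ltnS (leq_trans _ hC) // ltnS.
rewrite /mi_size (bigD1 a) //= [X in (_ < X)%N](bigD1 a) //= ffunE eqxx subn1.
rewrite -addSn prednK // leq_add2l; apply: leq_sum => b ba.
by rewrite ffunE leq_subr.
Qed.

(** A field which commutes with total derivatives is determined by what it does to
    the metric, by induction on the order of the jet coordinates. *)
Lemma evolutionary_uniq (F G : multi_index n -> J -> R) :
  eq_over (F (mi0 n)) (G (mi0 n)) ->
  (forall C a, eq_over (F (mi_add1 C a)) (tot a (F C))) ->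
  (forall C a, eq_over (G (mi_add1 C a)) (tot a (G C))) ->
  forall C, eq_over (F C) (G C).
Proof.
move=> h0 hF hG; elim/mi_ind => // C a IH p hp.
by rewrite hF // hG //; exact: tot_eq_over.
Qed.

(** ** The field xi *)

Lemma mk_upairC a b : mk_upair a b = mk_upair b a.
Proof.
apply: val_inj => /=; case: (ltngtP a b) => // /val_inj ->.
by [].
Qed.

Definition smooth_field (v : 'rV[R]_n -> 'rV[R]_n) :=
  forall a, smooth_on U (fun x => v x 0 a).

Section Field.
Variables (v : 'rV[R]_n -> 'rV[R]_n).
Hypothesis sv : smooth_field v.

Definition Dv a c : 'rV[R]_n -> R := partial a (fun x => v x 0 c).

Lemma smooth_Dv a c : smooth_on U (Dv a c).
Proof. exact: smooth_partial. Qed.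

Lemma xi_compE a b p : xi_comp v a b p =
  - \sum_c (v (basept p) 0 c * g1_ a b c p + Dv a c (basept p) * g_ c b p +
            Dv b c (basept p) * g_ a c p).
Proof. by []. Qed.

Lemma jet_linear_xi_comp a b : jet_linear (xi_comp v a b).
Proof.
apply: jet_linear_opp; apply: jet_linear_sum => c.
have T f K : smooth_on U f -> jet_linear (fun p => f (basept p) * p (inr K)).
  by move=> hf; apply: jet_linear_eq (jet_linear_term 1 K hf) => p _; rewrite mul1r.
apply: jet_linear_add; first apply: jet_linear_add.
- exact: T (sv c).
- exact: T (smooth_Dv a c).
- exact: T (smooth_Dv b c).
Qed.

Lemma jet_linear_xi ab C : jet_linear (fun p => xi v p (inr (ab, C))).
Proof. exact: jet_linear_tot_mi (jet_linear_xi_comp _ _). Qed.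

Lemma xi_gat p i : over p -> gat (fun q => xi v q i) p.
Proof.
case: i => [a|[ab C]] hp; first exact: gat_cst.
exact: jet_linear_gat (jet_linear_xi _ _) hp.
Qed.

Lemma xi_add1 ab C a :
  eq_over (fun p => xi v p (inr (ab, mi_add1 C a))) (tot a (fun p => xi v p (inr (ab, C)))).
Proof. exact: tot_mi_add1 (jet_linear_xi_comp _ _). Qed.

Lemma xi_comp_sym a b p : xi_comp v a b p = xi_comp v b a p.
Proof.
rewrite !xi_compE; congr (- _); apply: eq_bigr => c _.
by rewrite /g1_ /g_ /gjet !(mk_upairC b) (mk_upairC c a); ring.
Qed.

Lemma xi0 a b p : xi v p (inr (mk_upair a b, mi0 n)) = xi_comp v a b p.
Proof.
rewrite /= tot_mi0; case: ifP => //= _; exact: xi_comp_sym.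
Qed.

Lemma xi1 a b c p : over p ->
  xi v p (inr (mk_upair a b, mi_add1 (mi0 n) c)) = tot c (xi_comp v a b) p.
Proof.
move=> hp; rewrite (xi_add1 (mk_upair a b) (mi0 n) c hp).
by apply: tot_eq_over => // q hq; rewrite xi0.
Qed.

(** The bracket of xi with a total derivative vanishes; in terms of components this
    is xi_add1. *)
Lemma Dxi_hpartial p a : over p ->
  Dfield (xi v) p (hpartial a p) = jshift a (xi v p).
Proof.
move=> hp; apply/funext => -[b|[ab C]]; rewrite /Dfield; first by rewrite dirder_cst.
by rewrite [RHS](xi_add1 ab C a hp).
Qed.

(** *** The sum with the horizontal lift *)

Definition rfield p : J := xi v p + hlift v p.

Lemma hliftE p i : hlift v p i = \sum_a v (basept p) 0 a * hpartial a p i.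
Proof. by rewrite /hlift jsumE; apply: eq_bigr. Qed.

Lemma hlift_inl p a : hlift v p (inl a) = v (basept p) 0 a.
Proof.
rewrite hliftE (bigD1 a) //= eqxx mulr1 big1 ?addr0 // => b ba.
by rewrite eq_sym (negbTE ba) mulr0.
Qed.

Lemma rfield_inl p a : rfield p (inl a) = v (basept p) 0 a.
Proof. by rewrite /rfield jaddE hlift_inl add0r. Qed.

Lemma rfield_inr p ab C : rfield p (inr (ab, C)) =
  xi v p (inr (ab, C)) + \sum_a v (basept p) 0 a * p (inr (ab, mi_add1 C a)).
Proof. by rewrite /rfield jaddE hliftE. Qed.

Lemma isD_hlift p V i : over p -> isD (fun q => hlift v q i) V p
  (\sum_a ((\sum_b V (inl b) * Dv b a (basept p)) * hpartial a p i +
           v (basept p) 0 a * jshift a V i)).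
Proof.
move=> hp; apply: isD_ext (_ : isD (fun q => \sum_a v (basept q) 0 a * hpartial a q i) V p _).
  by move=> q; rewrite hliftE.
apply: isD_sumT => a; apply: isDM; last exact: isD_hpartial.
exact: (isD_base V (sv a) hp).
Qed.

Lemma rfield_gat p i : over p -> gat (fun q => rfield q i) p.
Proof.
move=> hp; apply: gatD; first exact: xi_gat.
apply: gat_ext (_ : gat (fun q => \sum_a v (basept q) 0 a * hpartial a q i) p).
  by move=> q; rewrite hliftE.
apply: gat_sum => a; apply: gatM; last exact: gat_hpartial.
exact: (gat_base (sv a)).
Qed.

(** The horizontal lift of v fails to commute with the total derivative in the
    direction c by the derivative of v in that direction. *)
Lemma rfield_add1 p ab C c : over p -> rfield p (inr (ab, mi_add1 C c)) =
  tot c (fun q => rfield q (inr (ab, C))) p -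
  \sum_a Dv c a (basept p) * p (inr (ab, mi_add1 C a)).
Proof.
move=> hp; have h1 := gatP (hpartial c p) (jet_linear_gat (jet_linear_xi ab C) hp).
have h2 := isD_hlift (hpartial c p) (inr (ab, C)) hp.
have -> : tot c (fun q => rfield q (inr (ab, C))) p =
   xi v p (inr (ab, mi_add1 C c)) + \sum_a (Dv c a (basept p) * p (inr (ab, mi_add1 C a)) +
           v (basept p) 0 a * p (inr (ab, mi_add1 (mi_add1 C c) a))).
  rewrite (xi_add1 ab C c hp); apply: isD_dirder; apply: isD_eq (isDD h1 h2) _.
  congr (_ + _); apply: eq_bigr => a _ /=.
  by rewrite (sum_hpartial c p (fun b => Dv b a (basept p))) mi_add1C.
rewrite rfield_inr big_split /=; ring.
Qed.

End Field.

End Prolongation.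

(** * The brackets of the lifted fields *)

Section DoubleSums.
Context {R : comRingType} {I : finType}.

Lemma sum2_swap (X Y Z : I -> I -> R) :
  (forall c d, X c d - Y c d = Z c d - Z d c) ->
  \sum_c \sum_d X c d = \sum_c \sum_d Y c d.
Proof.
move=> h; apply/eqP; rewrite -subr_eq0 -sumrB.
under eq_bigr => c _ do rewrite -sumrB.
under eq_bigr => c _ do under eq_bigr => d _ do rewrite h.
under eq_bigr => c _ do rewrite sumrB.
by rewrite sumrB [X in _ - X]exchange_big subrr.
Qed.

(** The infinitesimal actions of two vector fields on a bilinear form g, written in
    coordinates, have as commutator the action of the bracket.  Dv a c and Hv c a d
    stand for first and second derivatives of v, g1 and g2 for those of g. *)
Lemma lie_bracket_tensor (v w : I -> R) (Dv Dw : I -> I -> R) (Hv Hw : I -> I -> I -> R)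
    (g : I -> I -> R) (g1 : I -> I -> I -> R) (g2 : I -> I -> I -> I -> R) (a b : I) :
  (forall c a d, Hv c a d = Hv a c d) -> (forall c a d, Hw c a d = Hw a c d) ->
  (forall a b c d, g2 a b c d = g2 a b d c) ->
  let act (v : I -> R) (Dv : I -> I -> R) (a b : I) :=
    - \sum_c (v c * g1 a b c + Dv a c * g c b + Dv b c * g a c) in
  let Dact (v : I -> R) (Dv : I -> I -> R) (Hv : I -> I -> I -> R) (a b e : I) :=
    - \sum_d (Dv e d * g1 a b d + v d * g2 a b d e + (Hv e a d * g d b + Dv a d * g1 d b e) +
      (Hv e b d * g a d + Dv b d * g1 a d e)) in
  let comp (v w : I -> R) (Dv Dw : I -> I -> R) (Hv Hw : I -> I -> I -> R) :=
    - \sum_c (w c * Dact v Dv Hv a b c + Dw a c * act v Dv c b + Dw b c * act v Dv a c) in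
  comp v w Dv Dw Hv Hw - comp w v Dw Dv Hw Hv =
  - \sum_d ((\sum_c (v c * Dw c d - w c * Dv c d)) * g1 a b d +
     (\sum_c (Dv a c * Dw c d + v c * Hw a c d - (Dw a c * Dv c d + w c * Hv a c d))) * g d b +
     (\sum_c (Dv b c * Dw c d + v c * Hw b c d - (Dw b c * Dv c d + w c * Hv b c d))) * g a d).
Proof.
move=> hv hw hg /=.
pose X (v w : I -> R) (Dv Dw : I -> I -> R) (Hv : I -> I -> I -> R) c d :=
  w c * (Dv c d * g1 a b d + v d * g2 a b d c + (Hv c a d * g d b + Dv a d * g1 d b c) +
      (Hv c b d * g a d + Dv b d * g1 a d c)) +
  Dw a c * (v d * g1 c b d + Dv c d * g d b + Dv b d * g c d) +
  Dw b c * (v d * g1 a c d + Dv a d * g d c + Dv c d * g a d).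
have E (v' w' : I -> R) (Dv' Dw' : I -> I -> R) (Hv' : I -> I -> I -> R) :
  (- \sum_c (w' c * - (\sum_d (Dv' c d * g1 a b d + v' d * g2 a b d c +
      (Hv' c a d * g d b + Dv' a d * g1 d b c) + (Hv' c b d * g a d + Dv' b d * g1 a d c))) +
     Dw' a c * - (\sum_d (v' d * g1 c b d + Dv' c d * g d b + Dv' b d * g c d)) +
     Dw' b c * - (\sum_d (v' d * g1 a c d + Dv' a d * g d c + Dv' c d * g a d)))) =
  \sum_c \sum_d X v' w' Dv' Dw' Hv' c d.
  rewrite -sumrN; apply: eq_bigr => c _.
  by rewrite !mulrN !opprD !opprK !mulr_sumr -!big_split.
rewrite !E.
have -> : \sum_c \sum_d X v w Dv Dw Hv c d - \sum_c \sum_d X w v Dw Dv Hw c d =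
    \sum_c \sum_d (X v w Dv Dw Hv c d - X w v Dw Dv Hw c d).
  by rewrite -sumrB; apply: eq_bigr => c _; rewrite -sumrB.
pose Y c d := - ((v c * Dw c d - w c * Dv c d) * g1 a b d +
     (Dv a c * Dw c d + v c * Hw a c d - (Dw a c * Dv c d + w c * Hv a c d)) * g d b +
     (Dv b c * Dw c d + v c * Hw b c d - (Dw b c * Dv c d + w c * Hv b c d)) * g a d).
rewrite (_ : - _ = \sum_c \sum_d Y c d); last first.
  rewrite exchange_big /= -sumrN; apply: eq_bigr => d _.
  by rewrite !mulr_suml -!big_split /= -sumrN; apply: eq_bigr => c _.
apply: (@sum2_swap _ _ (fun c d => w c * v d * g2 a b d c + w c * Dv a d * g1 d b c +
   w c * Dv b d * g1 a d c + Dw a c * v d * g1 c b d + Dw b c * v d * g1 a c d +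
   Dw a c * Dv b d * g c d + Dw b c * Dv a d * g d c)).
move=> c d; rewrite /X /Y (hv a c) (hv b c) (hw a c) (hw b c) (hg a b d c).
ring.
Qed.

End DoubleSums.

Section LieHomomorphism.
Context {R : realType} {n : nat} (U : set 'rV[R]_n) (oU : open U).
Notation J := (jspace R n).
Implicit Types (p q V : J) (v w u : 'rV[R]_n -> 'rV[R]_n) (a b c d : 'I_n).
Local Notation over := (over U).
Local Notation smooth_field := (smooth_field U).

Lemma smooth_derive v w x : smooth_field w -> U x ->
  'D_(v x) w x = \row_a \sum_b v x 0 b * partial b (fun x => w x 0 a) x.
Proof.
move=> sw Ux.
have dw i a : derivable (fun x => w x i a) x (v x).
  by rewrite (ord1 i); apply: diff_derivable; exact: smooth_differentiable (sw a) Ux.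
rewrite derive_mx; last exact/derivable_mxP.
apply/rowP => a; rewrite !mxE deriveE; last exact: smooth_differentiable (sw a) Ux.
by rewrite diff_partial //; exact: smooth_differentiable (sw a) Ux.
Qed.

Lemma bracketE v w x a : smooth_field v -> smooth_field w -> U x ->
  bracket v w x 0 a = \sum_c (v x 0 c * Dv w c a x - w x 0 c * Dv v c a x).
Proof.
by move=> sv sw Ux; rewrite /bracket !smooth_derive // !mxE sumrB.
Qed.

Lemma partial_on (f g : 'rV[R]_n -> R) a x : U x -> (forall y, U y -> f y = g y) ->
  partial a f x = partial a g x.
Proof.
move=> Ux e; apply: near_eq_derive; apply: filterS e _.
exact: open_nbhs_nbhs.
Qed.

Lemma Dv_bracket v w u a d x : smooth_field v -> smooth_field w -> U x ->
  (forall y, U y -> u y = bracket v w y) ->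
  Dv u a d x = \sum_c (Dv v a c x * Dv w c d x + v x 0 c * partial a (Dv w c d) x -
    (Dv w a c x * Dv v c d x + w x 0 c * partial a (Dv v c d) x)).
Proof.
move=> sv sw Ux hu; rewrite /Dv.
rewrite (partial_on a Ux (g := fun y => \sum_c (v y 0 c * Dv w c d y - w y 0 c * Dv v c d y))).
  have h c : is_derive x (delta_mx 0 a : 'rV[R]_n)
     (fun y => v y 0 c * Dv w c d y - w y 0 c * Dv v c d y)
     (Dv v a c x * Dv w c d x + v x 0 c * partial a (Dv w c d) x -
    (Dv w a c x * Dv v c d x + w x 0 c * partial a (Dv v c d) x)).
    have h1 := is_deriveM (partialP a (sv c) Ux) (partialP a (smooth_Dv sw c d) Ux).
    have h2 := is_deriveM (partialP a (sw c) Ux) (partialP a (smooth_Dv sv c d) Ux).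
    have aux (A B C D E F G H : R) :
        A *: B + C *: D - (E *: F + G *: H) = D * C + A * B - (H * G + E * F).
      by rewrite /GRing.scale /=; ring.
    exact: is_derive_eq (is_deriveB h1 h2) (aux _ _ _ _ _ _ _ _).
  have H : is_derive x (delta_mx 0 a : 'rV[R]_n)
     (\sum_c (fun y => v y 0 c * Dv w c d y - w y 0 c * Dv v c d y))
     (\sum_c (Dv v a c x * Dv w c d x + v x 0 c * partial a (Dv w c d) x -
    (Dv w a c x * Dv v c d x + w x 0 c * partial a (Dv v c d) x))).
    exact: is_derive_sum.
  rewrite /partial -[RHS](@derive_val _ _ _ _ _ _ _ H); congr ('D_ _ _ _).
  by apply/funext => y; rewrite fct_sumE.
by move=> y Uy; rewrite hu // bracketE.
Qed.

Section Bracket.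
Variables (v w : 'rV[R]_n -> 'rV[R]_n).
Hypotheses (sv : smooth_field v) (sw : smooth_field w).

Lemma isD_xi_comp a b p V : over p -> isD (xi_comp w a b) V p
  (- \sum_c ((\sum_e V (inl e) * Dv w e c (basept p)) * g1_ a b c p +
             w (basept p) 0 c * g1_ a b c V +
             ((\sum_e V (inl e) * partial e (Dv w a c) (basept p)) * g_ c b p +
             Dv w a c (basept p) * g_ c b V) +
             ((\sum_e V (inl e) * partial e (Dv w b c) (basept p)) * g_ a c p +
             Dv w b c (basept p) * g_ a c V))).
Proof.
move=> hp; apply: isDN; apply: isD_sumT => c.
apply: isDD; first apply: isDD.
- by apply: isDM; [exact: (isD_base V (sw c) hp)|exact: isD_coord].
- by apply: isDM; [exact: (isD_base V (smooth_Dv sw a c) hp)|exact: isD_coord].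
- by apply: isDM; [exact: (isD_base V (smooth_Dv sw b c) hp)|exact: isD_coord].
Qed.

Definition g2_ a b c d p : R := p (inr (mk_upair a b, mi_add1 (mi_add1 (mi0 n) c) d)).

Lemma tot_xi_comp a b c p : over p -> tot c (xi_comp w a b) p =
  - \sum_d (Dv w c d (basept p) * g1_ a b d p + w (basept p) 0 d * g2_ a b d c p +
     (partial c (Dv w a d) (basept p) * g_ d b p + Dv w a d (basept p) * g1_ d b c p) +
     (partial c (Dv w b d) (basept p) * g_ a d p + Dv w b d (basept p) * g1_ a d c p)).
Proof.
move=> hp; rewrite /tot (isD_dirder (isD_xi_comp _ _ _ hp)); congr (- _).
apply: eq_bigr => d _.
congr (_ * _ + _ + (_ * _ + _) + (_ * _ + _)).
- exact: (sum_hpartial c p (fun e => Dv w e d (basept p))).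
- exact: (sum_hpartial c p (fun e => partial e (Dv w a d) (basept p))).
- exact: (sum_hpartial c p (fun e => partial e (Dv w b d) (basept p))).
Qed.

End Bracket.

Lemma xi_bracket0 v w u a b p : smooth_field v -> smooth_field w ->
  (forall y, U y -> u y = bracket v w y) -> over p ->
  dirder (xi_comp w a b) (xi v p) p - dirder (xi_comp v a b) (xi w p) p = xi_comp u a b p.
Proof.
move=> sv sw hu hp.
pose T v' a b c := - \sum_d (Dv v' c d (basept p) * g1_ a b d p + v' (basept p) 0 d * g2_ a b d c p +
     (partial c (Dv v' a d) (basept p) * g_ d b p + Dv v' a d (basept p) * g1_ d b c p) +
     (partial c (Dv v' b d) (basept p) * g_ a d p + Dv v' b d (basept p) * g1_ a d c p)).
pose S v' a b := - \sum_c (v' (basept p) 0 c * g1_ a b c p + Dv v' a c (basept p) * g_ c b p +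
            Dv v' b c (basept p) * g_ a c p).
have E v' w' : smooth_field v' -> smooth_field w' ->
  dirder (xi_comp w' a b) (xi v' p) p = - \sum_c (w' (basept p) 0 c * T v' a b c +
    Dv w' a c (basept p) * S v' c b + Dv w' b c (basept p) * S v' a c).
  move=> sv' sw'; rewrite (isD_dirder (isD_xi_comp sw' _ _ _ hp)); congr (- _).
  apply: eq_bigr => c _.
  have Z (F : 'I_n -> R) (x y : R) : (\sum_e xi v' p (inl e) * F e) * x + y = y.
    by rewrite big1 ?mul0r ?add0r // => e _; rewrite mul0r.
  have <- : g1_ a b c (xi v' p) = T v' a b c.
    exact: etrans (xi1 oU sv' a b c hp) (tot_xi_comp sv' a b c hp).
  have <- : g_ c b (xi v' p) = S v' c b := xi0 v' c b p.
  have <- : g_ a c (xi v' p) = S v' a c := xi0 v' a c p.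
  by congr (_ + _ + _); apply: Z.
rewrite (E v w) // (E w v) //.
have C2 f c c' : smooth_field f -> forall d,
    partial c (Dv f c' d) (basept p) = partial c' (Dv f c d) (basept p).
  by move=> sf d; exact: (schwarz c c' oU (sf d) hp).
have := @lie_bracket_tensor R 'I_n (fun c => v (basept p) 0 c) (fun c => w (basept p) 0 c)
  (fun c d => Dv v c d (basept p)) (fun c d => Dv w c d (basept p))
  (fun e c d => partial e (Dv v c d) (basept p)) (fun e c d => partial e (Dv w c d) (basept p))
  (fun c d => g_ c d p) (fun c d e => g1_ c d e p) (fun c d e f => g2_ c d e f p) a b
  (fun c c' d => C2 v c c' sv d) (fun c c' d => C2 w c c' sw d)
  (fun c d e f => congr1 (fun C => p (inr (mk_upair c d, C))) (mi_add1C _ _ _)).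
move=> /= ->; rewrite xi_compE; congr (- _); apply: eq_bigr => d _.
by rewrite hu // bracketE // !(Dv_bracket _ _ sv sw hp hu).
Qed.

Lemma xi_tot v h a p : smooth_field v -> jet_linear U h -> over p ->
  dirder (tot a h) (xi v p) p = tot a (fun q => dirder h (xi v q) q) p.
Proof.
move=> sv [l [hl e]] hp.
have evxi l' q : smooth_terms U l' -> over q -> evD l' q (xi v q) =
    \sum_(x <- l') x.1.1 * (x.1.2 (basept q) * xi v q (inr x.2)).
  move=> _ _; apply: eq_bigr => x _; congr (_ * _).
  by rewrite big1 ?mul0r ?add0r // => b _; rewrite mul0r.
have -> : dirder (tot a h) (xi v p) p = evD (Dtot a l) p (xi v p).
  rewrite (dirder_on _ (over_open oU) hp (g := ev (Dtot a l))).
    by apply: isD_dirder; apply: (isD_ev _ _ hp); exact: smooth_Dtot.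
  by move=> q hq; rewrite -(tot_ev _ hl hq); exact: (tot_eq_over oU a e).
have -> : tot a (fun q => dirder h (xi v q) q) p =
    tot a (fun q => \sum_(x <- l) x.1.1 * (x.1.2 (basept q) * xi v q (inr x.2))) p.
  apply: (tot_eq_over oU) => // q hq; rewrite -(evxi _ _ hl hq).
  rewrite (dirder_on _ (over_open oU) hq (g := ev l)) //.
  exact: isD_dirder (isD_ev _ hl hq).
rewrite evxi //; last exact: smooth_Dtot.
symmetry; apply: isD_dirder; elim: l hl {e} => [_|x l IH /= [hx /IH {}IH]].
  rewrite big_nil; apply: isD_ext (isD_cst 0 _ _) => q; by rewrite big_nil.
case: x hx => [[k f] [ab C]] /= hf; rewrite !big_cons /=.
apply: isD_ext (_ : isD (fun q => k * (f (basept q) * xi v q (inr (ab, C))) +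
   \sum_(x <- l) x.1.1 * (x.1.2 (basept q) * xi v q (inr x.2))) _ _ _).
  by move=> q; rewrite big_cons.
have h1 := isD_base (hpartial a p) hf hp.
have h2 := gatP (hpartial a p) (jet_linear_gat oU (jet_linear_xi oU sv ab C) hp).
apply: isD_eq (isDD (isDZ k (isDM h1 h2)) IH) _.
have -> : dirder (fun q => xi v q (inr (ab, C))) (hpartial a p) p =
   xi v p (inr (ab, mi_add1 C a)) := esym (xi_add1 oU sv ab C a hp).
rewrite (sum_hpartial a p (fun b => partial b f (basept p))) mulrDr addrA.
by [].
Qed.

(** Both sides commute with total derivatives, so they can be compared at order 0. *)
Lemma xi_bracket v w u ab C : smooth_field v -> smooth_field w -> smooth_field u ->
  (forall y, U y -> u y = bracket v w y) -> forall p, over p ->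
  dirder (fun q => xi w q (inr (ab, C))) (xi v p) p -
  dirder (fun q => xi v q (inr (ab, C))) (xi w p) p = xi u p (inr (ab, C)).
Proof.
(* F is the component of the bracket of xi_v and xi_w. *)
move=> sv sw su hu; pose F C p := dirder (fun q => xi w q (inr (ab, C))) (xi v p) p -
  dirder (fun q => xi v q (inr (ab, C))) (xi w p) p.
have gD v' w' C' p : smooth_field v' -> smooth_field w' -> over p ->
    gat (fun q => dirder (fun q => xi w' q (inr (ab, C'))) (xi v' q) q) p.
  move=> sv' sw' hp; have [l [hl e]] := jet_linear_xi oU sw' ab C'.
  apply: (gat_on (over_open oU) hp (f := fun q => evD l q (xi v' q))).
    move=> q hq; rewrite (dirder_on _ (over_open oU) hq (g := ev l)) //.
    exact: esym (isD_dirder (isD_ev _ hl hq)).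
  elim: l hl {e} => [_|x l IH /= [hx /IH {}IH]].
    by apply: gat_ext (gat_cst 0 p) => q; rewrite /evD big_nil.
  apply: gat_ext (_ : gat (fun q => x.1.1 * (x.1.2 (basept q) * xi v' q (inr x.2)) +
     evD l q (xi v' q)) p).
    move=> q; rewrite /evD big_cons; congr (_ * _ + _).
    by rewrite big1 ?mul0r ?add0r // => b _; rewrite mul0r.
  apply: gatD => //; apply: gatM; first exact: gat_cst.
  by apply: gatM; [exact: gat_base hx hp|exact: (xi_gat oU sv')].
apply: (evolutionary_uniq oU (F := F) (G := fun C p => xi u p (inr (ab, C)))) => [p hp|C' a p hp|C' a].
- rewrite /F /= !tot_mi0; exact: (xi_bracket0 _ _ sv sw hu hp).
- rewrite {1}/F.
  have E v' w' : smooth_field v' -> smooth_field w' ->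
    dirder (fun q => xi w' q (inr (ab, mi_add1 C' a))) (xi v' p) p =
    tot a (fun q => dirder (fun q => xi w' q (inr (ab, C'))) (xi v' q) q) p.
    move=> sv' sw'; rewrite -xi_tot //; last exact: jet_linear_xi.
    apply: (dirder_on _ (over_open oU)) => // q hq; exact: (xi_add1 oU sw').
  rewrite !E //; symmetry; apply: isD_dirder.
  by apply: isDB; apply: gatP; exact: gD.
- exact: (xi_add1 oU su).
Qed.

(** The brackets of xi with the horizontal lift of the other field vanish, because
    xi commutes with total derivatives and is vertical; the lifts add the bracket of
    the fields on the base. *)
Lemma rfield_bracket v w u p : smooth_field v -> smooth_field w -> smooth_field u ->
  (forall y, U y -> u y = bracket v w y) -> over p ->
  jbracket (rfield v) (rfield w) p = rfield u p.
Proof.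
move=> sv sw su hu hp; apply/funext => i; rewrite /jbracket.
(* Apart from the derivative of xi w' and the sum with the derivatives Dv of w', the
   right-hand side is symmetric in v' and w', because total derivatives commute;
   so only these two terms contribute to the bracket. *)
have E v' w' : smooth_field v' -> smooth_field w' ->
  dirder (fun q => rfield w' q i) (rfield v' p) p =
    dirder (fun q => xi w' q i) (xi v' p) p +
    \sum_a v' (basept p) 0 a * jshift a (xi w' p) i +
    (\sum_a ((\sum_b v' (basept p) 0 b * Dv w' b a (basept p)) * hpartial a p i) +
     \sum_a w' (basept p) 0 a * jshift a (xi v' p) i +
     \sum_a \sum_b w' (basept p) 0 a * v' (basept p) 0 b * jshift a (hpartial b p) i).
  move=> sv' sw'; have hg := xi_gat oU sw' i hp.
  apply: isD_dirder; apply: isD_eq (isDD (gatP _ hg) (isD_hlift sw' _ _ hp)) _.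
  congr (_ + _).
    rewrite /rfield gatDU //; congr (_ + _).
    rewrite /hlift gat_sumU //; apply: eq_bigr => a _; congr (_ * _).
    by rewrite -[LHS]/(Dfield (xi w') p (hpartial a p) i) (Dxi_hpartial oU sw').
  rewrite big_split -addrA /=; congr (_ + _).
    apply: eq_bigr => a _; congr (_ * _); apply: eq_bigr => b _.
    by rewrite rfield_inl.
  rewrite -big_split; apply: eq_bigr => a _ /=.
  rewrite /rfield jshiftD jaddE mulrDr; congr (_ + _).
  rewrite /hlift jshift_sum jsumE mulr_sumr; apply: eq_bigr => b _.
  by rewrite jscaleE mulrA.
rewrite !E // /rfield jaddE hliftE.
set A := dirder _ _ _; set A' := dirder (fun q => xi v q i) _ _.
have -> : xi u p i = A - A'.
  rewrite /A /A'; case: i {E A A'} => [a|[ab C]].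
    by rewrite !dirder_cst subrr.
  by rewrite (xi_bracket _ _ sv sw su hu hp).
have -> : \sum_a u (basept p) 0 a * hpartial a p i =
   \sum_a (\sum_b v (basept p) 0 b * Dv w b a (basept p)) * hpartial a p i -
   \sum_a (\sum_b w (basept p) 0 b * Dv v b a (basept p)) * hpartial a p i.
  rewrite -sumrB; apply: eq_bigr => a _; rewrite -mulrBl hu // bracketE //.
  by rewrite sumrB.
have -> : \sum_a \sum_b w (basept p) 0 a * v (basept p) 0 b * jshift a (hpartial b p) i =
    \sum_a \sum_b v (basept p) 0 a * w (basept p) 0 b * jshift a (hpartial b p) i.
  rewrite exchange_big; apply: eq_bigr => a _; apply: eq_bigr => b _ /=.
  by rewrite (jshift_hpartialC b a) [w _ _ _ * _]mulrC.
ring.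
Qed.

(** The components of xi at order 0 are linear in v and its first derivatives, and
    they determine the others. *)
Lemma rfield_linear (k : R) v w u p : smooth_field v -> smooth_field w -> smooth_field u ->
  (forall y, U y -> u y = k *: v y + w y) -> over p ->
  rfield u p = k *: rfield v p + rfield w p.
Proof.
move=> sv sw su hu hp.
have D a c y : U y -> Dv u a c y = k * Dv v a c y + Dv w a c y.
  move=> Uy; rewrite /Dv.
  rewrite (partial_on a Uy (g := fun y => k * v y 0 c + w y 0 c)); last first.
    by move=> z Uz; rewrite hu // !mxE.
  have h1 := is_deriveZ k (partialP a (sv c) Uy).
  have h2 := is_deriveD h1 (partialP a (sw c) Uy).
  by rewrite /partial -[RHS]/(k *: _ + _) -[RHS](@derive_val _ _ _ _ _ _ _ h2).
have hxi ab C : forall q, over q ->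
    xi u q (inr (ab, C)) = k * xi v q (inr (ab, C)) + xi w q (inr (ab, C)).
  apply: (evolutionary_uniq oU (F := fun C q => xi u q (inr (ab, C)))
     (G := fun C q => k * xi v q (inr (ab, C)) + xi w q (inr (ab, C)))).
  - move=> q hq; rewrite /= !tot_mi0 !xi_compE mulrN -opprD mulr_sumr -big_split.
    by congr (- _); apply: eq_bigr => c _; rewrite /= hu // !D // !mxE; ring.
  - exact: (xi_add1 oU su).
  - move=> C' a q hq; rewrite (xi_add1 oU sv) // (xi_add1 oU sw) //.
    symmetry; apply: isD_dirder; apply: isDD; first apply: isDZ.
      exact: gatP (jet_linear_gat oU (jet_linear_xi oU sv _ _) hq).
    exact: gatP (jet_linear_gat oU (jet_linear_xi oU sw _ _) hq).
apply/funext => i; rewrite /rfield !jE !hliftE.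
have -> : \sum_a u (basept p) 0 a * hpartial a p i =
   k * (\sum_a v (basept p) 0 a * hpartial a p i) + \sum_a w (basept p) 0 a * hpartial a p i.
  by rewrite mulr_sumr -big_split; apply: eq_bigr => a _; rewrite hu // !mxE /=; ring.
case: i => [a|[ab C]]; last by rewrite hxi //; ring.
by rewrite /=; ring.
Qed.

End LieHomomorphism.

Section StrictlyVertical.
Context {R : realType} {n : nat}.
Notation J := (jspace R n).
Variables (D : set J).
Hypothesis Dopen : line_open D.

(** The horizontal differential is built from dx^a, which a vertical field annihilates,
    and from Lie derivatives along total derivatives, which commute with the field. *)
Lemma vertical_hdiff w (X : J -> J) p s : gat_form D w -> D p ->
  (forall q i, D q -> gat (fun q => X q i) q) ->
  (forall a, X p (inl a) = 0) ->
  (forall a, Dfield X p (hpartial a p) = jshift a (X p)) ->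
  hdiff w p (X p :: s) + hdiff (iprod X w) p s = 0.
Proof.
move=> hw Dp hX X0 hc.
have hi : gat_form D (iprod X w) by exact: (gat_form_contr Dopen hw hX).
rewrite !(hdiffE Dopen) // /hd /=.
rewrite big1 ?sub0r; last by move=> a _; rewrite X0 mul0r.
rewrite addrC; apply/eqP; rewrite subr_eq0; apply/eqP.
apply: alt_ext => V t _; apply: eq_bigr => a _; congr (_ * _).
rewrite /Lh /=.
have h := contr_rule Dopen t hw Dp (fun i => gatP (hpartial a p) (hX p i Dp)).
rewrite (isD_dirder h) -[X in w p (X :: t)]/(Dfield X p (hpartial a p)) hc.
by rewrite addrAC addrC; congr (_ + _); rewrite addrC.
Qed.

End StrictlyVertical.

(** * The forms of the Hilbert-Einstein theory *)

Section Volume.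
Context {R : realType} {n : nat}.
Notation J := (jspace R n).
Implicit Types (p q V W : J) (s t : seq J) (a b c d : 'I_n) (l : seq 'I_n).

Definition bvec a : J := evec (inl a).

Lemma bvecE a b : bvec a (inl b) = (b == a)%:R :> R.
Proof. by []. Qed.

Definition dxc a : J -> R := fun V => V (inl a).

Definition one_at (s : seq J) : R := if s is [::] then 1 else 0.

(** The product dx^{a_1} /\ ... /\ dx^{a_k}. *)
Definition dxs l : seq J -> R := foldr (fun a al => e1 (dxc a) al) one_at l.

Definition dx_top : seq J -> R := dxs (index_enum 'I_n).

Lemma ext_form0 (f : J -> R) p s :
  ext (form0 f) p s = if s is [:: V] then dirder f V p else 0.
Proof.
rewrite extE; case: s => [|V [|W s]] //=; first by rewrite subr0; apply: dirder_ext.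
rewrite /contr; rewrite dirder_cst dirder_cst.
rewrite (_ : alt _ s = 0) ?subrr ?subr0 // -[RHS](alt0 s).
by apply: alt_ext => X t _; rewrite /contr dirder_cst.
Qed.

Lemma dxE a p s : dx a p s = if s is [:: V] then dxc a V else 0 :> R.
Proof.
rewrite /dx ext_form0; case: s => [|V [|]] //.
exact: isD_dirder (isD_coord _ _ _).
Qed.

Lemma big_dx l p s :
  (\big[wedge/form0 (fun=> 1)]_(a <- l) dx a) p s = dxs l s :> R.
Proof.
elim: l s => [|a l IH] s; first by rewrite big_nil; case: s.
rewrite big_cons wedge1; [|by rewrite dxE|by move=> *; rewrite dxE].
by apply: e1_ext => // V; rewrite dxE.
Qed.

Lemma e10 (a : J -> R) s : e1 a (fun=> 0) s = 0.
Proof. by rewrite -[RHS](alt0 s); apply: alt_ext => V t _; rewrite mulr0. Qed.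

Lemma e1_dxs a l s : a \in l -> e1 (dxc a) (dxs l) s = 0.
Proof.
elim: l s => //= b l IH s; rewrite in_cons; have [->|ab] := eqVneq a b.
  by rewrite e1_e1.
move=> /= al; rewrite e1_anticomm (e1_ext (a' := dxc b) (al' := fun=> 0)) //.
  by rewrite e10 oppr0.
by move=> t _; exact: IH.
Qed.

Lemma e1_contr_dx_top b V s : e1 (dxc b) (contr V dx_top) s = dxc b V * dx_top s.
Proof. by rewrite e1_contr /contr e1_dxs ?subr0 // mem_index_enum. Qed.

Lemma dxs_slot A (B : 'I_n -> 'I_n -> R) l s :
  (forall V a, dxc a (A V) = \sum_b dxc b V * B b a) ->
  slot A (dxs l) s = \sum_a \sum_b B b a * e1 (dxc b) (contr (bvec a) (dxs l)) s.
Proof.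
move=> hA; elim: l s => [|c l IH] s /=.
  rewrite big1 => [|a _]; last first.
    rewrite big1 // => b _; rewrite (e1_ext (a' := dxc b) (al' := fun=> 0)) //.
    by rewrite e10 mulr0.
  case: s => //= V s; rewrite add0r -[RHS](slot0 A s); exact: slot_ext.
rewrite slot_e1.
transitivity (\sum_b B b c * e1 (dxc b) (dxs l) s -
   \sum_a \sum_b B b a * e1 (dxc b) (e1 (dxc c) (contr (bvec a) (dxs l))) s).
  congr (_ + _).
    rewrite (e1_ext (a' := fun V => \sum_b B b c * dxc b V) (al' := dxs l)) //.
      by rewrite e1_suml; apply: eq_bigr => b _; rewrite e1_Zl.
    by move=> V; rewrite /= hA; apply: eq_bigr => b _; rewrite mulrC.
  rewrite -sumrN (e1_ext (a' := dxc c) (al' := fun t => \sum_a \sum_b B b a *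
      e1 (dxc b) (contr (bvec a) (dxs l)) t)) // e1_sum.
  apply: eq_bigr => a _; rewrite e1_sum -sumrN; apply: eq_bigr => b _.
  by rewrite e1Z e1_anticomm mulrN.
rewrite [RHS](eq_bigr (fun a => \sum_b B b a * ((c == a)%:R * e1 (dxc b) (dxs l) s) -
    \sum_b B b a * e1 (dxc b) (e1 (dxc c) (contr (bvec a) (dxs l))) s)); last first.
  move=> a _; rewrite -sumrB; apply: eq_bigr => b _; rewrite -mulrBr; congr (_ * _).
  by rewrite -e1Z -e1N -e1D; exact: e1_ext.
rewrite sumrB; congr (_ - _); rewrite exchange_big /=; apply: eq_bigr => b _.
rewrite (bigD1 c) //= eqxx mul1r big1 ?addr0 // => a ac.
by rewrite eq_sym (negbTE ac) mul0r mulr0.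
Qed.

(** A linear map which acts on the coordinates of the base by the matrix B acts on the
    volume form, as a derivation, by the trace of B. *)
Lemma dx_top_slot A (B : 'I_n -> 'I_n -> R) s :
  (forall V a, dxc a (A V) = \sum_b dxc b V * B b a) ->
  slot A dx_top s = (\sum_a B a a) * dx_top s.
Proof.
move=> hA; rewrite (dxs_slot _ _ hA) mulr_suml; apply: eq_bigr => a _.
rewrite (bigD1 a) //= e1_contr_dx_top /dxc bvecE eqxx mul1r big1 ?addr0 // => b ba.
by rewrite e1_contr_dx_top /dxc bvecE (negbTE ba) mul0r mulr0.
Qed.

Lemma dxs_contr l V s : contr V (dxs l) s = \sum_a dxc a V * contr (bvec a) (dxs l) s.
Proof.
elim: l s => [|c l IH] s /=; first by rewrite big1 // => a _; rewrite mulr0.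
rewrite /contr e1_cons [RHS](eq_bigr (fun a => dxc a V * (c == a)%:R * dxs l s -
   dxc a V * e1 (dxc c) (contr (bvec a) (dxs l)) s)); last first.
  by move=> a _; rewrite e1_cons mulrBr mulrA /dxc bvecE.
rewrite sumrB; congr (_ - _).
  rewrite (bigD1 c) //= eqxx mulr1 big1 ?addr0 // => a ac.
  by rewrite eq_sym (negbTE ac) mulr0 mul0r.
rewrite (e1_ext (a' := dxc c) (al' := fun t => \sum_a dxc a V * contr (bvec a) (dxs l) t)) //.
by rewrite e1_sum; apply: eq_bigr => a _; rewrite e1Z.
Qed.

Lemma dx_top_contr V s : contr V dx_top s = \sum_a dxc a V * contr (bvec a) dx_top s.
Proof. exact: dxs_contr. Qed.

Lemma dx_top_hpartial a p s : contr (hpartial a p) dx_top s = contr (bvec a) dx_top s.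
Proof. by rewrite dx_top_contr [RHS]dx_top_contr. Qed.

(** Contracted with a coordinate field, the volume form has the weight of a vector
    density: the trace, and minus the matrix on the index of the field. *)
Lemma slot_contr_dx_top A (B : 'I_n -> 'I_n -> R) d s :
  (forall V a, dxc a (A V) = \sum_b dxc b V * B b a) ->
  slot A (contr (bvec d) dx_top) s = (\sum_a B a a) * contr (bvec d) dx_top s -
    \sum_a B d a * contr (bvec a) dx_top s.
Proof.
move=> hA; have := contr_slot A dx_top (bvec d) s.
rewrite {1}/contr (dx_top_slot _ hA) => h.
rewrite -[(\sum_a B a a) * _]/((\sum_a B a a) * dx_top (bvec d :: s)) h.
rewrite -[dx_top (A _ :: s)]/(contr (A (bvec d)) dx_top s) dx_top_contr.
rewrite (eq_bigr (fun a => B d a * contr (bvec a) dx_top s)); first by rewrite addrAC subrr add0r.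
move=> a _; rewrite hA (bigD1 d) //= /dxc bvecE eqxx mul1r big1 ?addr0 // => b bd.
by rewrite bvecE (negbTE bd) mul0r.
Qed.

Definition sqrt_det p : R := Num.sqrt (- \det (gmx p)).

Lemma volE p s : vol p s = sqrt_det p * dx_top s.
Proof. by rewrite /vol /fscale big_dx. Qed.

Definition hilbert_density p : R := scalar_curvature p * sqrt_det p.

Lemma lagrangianE p s : hilbert_lagrangian p s = hilbert_density p * dx_top s.
Proof. by rewrite /hilbert_lagrangian /fscale volE mulrA. Qed.

(** ** The variation of the metric *)

Definition K0 a b : coord n := inr (mk_upair a b, mi0 n).
Definition K1 a b c : coord n := inr (mk_upair a b, mi_add1 (mi0 n) c).

Definition form1 (al : J -> J -> R) : jet_form R n :=
  fun p s => if s is [:: V] then al p V else 0.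

Lemma line_open_setT : line_open [set: J].
Proof. by move=> p V _; apply: filterE. Qed.

Lemma gat_form_form0 (f : J -> R) : (forall p, gat f p) -> gat_form setT (form0 f).
Proof.
move=> hf; split=> [p _ s1 s2 k V W|p _ s1 s2 V||p s _].
- by case: s1 => [|X s1] /=; rewrite mulr0 addr0.
- by case: s1.
- by exists [::] => p [|V s] [|V' s'] _.
- case: s => [|V s]; [exact: hf|exact: gat_cst].
Qed.

Lemma vdiff_form0 (f : J -> R) p s : (forall p, gat f p) ->
  vdiff (form0 f) p s = form1 (fun p V => dirder f (ver p V) p) p s.
Proof.
move=> hf; have hn := gat_form_form0 hf; rewrite (vdiffE line_open_setT) // ext_form0 /hd.
have E W V' t : \sum_a dxc a W * Lh a (form0 f) p (V' :: t) = 0.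
  rewrite big1 // => a _; rewrite /Lh /= dirder_cst !add0r.
  by rewrite (_ : contr V' _ = fun=> 0) // slot0 mulr0.
case: s => [|V [|V' s]]; first by rewrite /= subrr.
  rewrite /= subr0 /ver gatB // /hor gat_sumU //; congr (_ - _).
  by apply: eq_bigr => a _; rewrite /Lh /= addr0.
rewrite (_ : alt _ _ = 0) ?subr0 // -[RHS](alt0 (V :: V' :: s)).
by apply: alt_ext => W [|X t] // _; exact: E.
Qed.

Lemma deltagE a b p s : deltag a b p s = form1 (fun p V => ver p V (K0 a b)) p s.
Proof.
rewrite /deltag vdiff_form0; last by move=> q; exact: gat_coord.
case: s => [|V [|]] //=; exact: isD_dirder (isD_coord _ _ _).
Qed.

Lemma gat_form_deltag a b : gat_form setT (form1 (fun p V => ver p V (K0 a b))).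
Proof.
split=> [p _ s1 s2 k V W|p _ s1 s2 V||p s _].
- case: s1 => [|X [|Y s1]] /=; last by rewrite mulr0 addr0.
    case: s2 => [|X s2] /=; last by rewrite mulr0 addr0.
    by rewrite ver_lin !jE.
  by rewrite mulr0 addr0.
- by case: s1 => [|X [|Y s1]].
- exists (K0 a b :: [seq inl c | c : 'I_n]) => p s s' _.
  case: s s' => [|V [|W s]] [|V' [|W' s']] //=; try by case=> _.
    move=> [h _]; rewrite !ver_inr h ?mem_head //; congr (_ - _).
    apply: eq_bigr => c _; rewrite h // in_cons; apply/orP; right.
    by apply: map_f; rewrite mem_enum.
- case: s => [|V [|W s]]; [exact: gat_cst|exact: ver_gat|exact: gat_cst].
Qed.

Lemma lie_deltag a b c p s :
  lie (hpartial c) (deltag a b) p s = form1 (fun p V => ver p V (K1 a b c)) p s.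
Proof.
rewrite (lie_on (D := setT) (X' := hpartial c) (w' := form1 (fun p V => ver p V (K0 a b)))) //.
- rewrite (lie_hpartial line_open_setT) //; last exact: gat_form_deltag.
  rewrite /Lh; case: s => [|V [|W s]].
  + by rewrite dirder_cst addr0.
  + rewrite /= (isD_dirder (isD_ver _ _ _ _)) addr0.
    have := congr1 (fun X : J => X (K0 a b)) (Dver_hpartial c p V).
    rewrite !jE addrA => /eqP; rewrite subr_eq0 => /eqP ->.
    by [].
  + rewrite dirder_cst add0r -[RHS](slot0 (jshift c) (V :: W :: s)).
    by apply: slot_ext => -[|X [|Y t]].
- exact: line_open_setT.
- by move=> q t _; exact: deltagE.
Qed.

(** The covariant derivative of the variation of the metric, on a vertical vector W. *)
Definition nab c a b p W : R := W (K1 a b c) - \sum_e Gamma e c a p * W (K0 e b) -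
  \sum_e Gamma e c b p * W (K0 a e).

Lemma nabla_deltagE c a b p s :
  nabla_deltag c a b p s = form1 (fun p V => nab c a b p (ver p V)) p s.
Proof.
rewrite /nabla_deltag !addrfctE !opprfctE.
rewrite -[lie _ _ p s]/(lie (hpartial c) (deltag a b) p s) lie_deltag !fct_sumE.
rewrite (eq_bigr (fun e => Gamma e c a p * form1 (fun p V => ver p V (K0 e b)) p s)); last first.
  by move=> e _; rewrite /fscale deltagE.
rewrite [X in _ - X](eq_bigr (fun e => Gamma e c b p * form1 (fun p V => ver p V (K0 a e)) p s));
  last by move=> e _; rewrite /fscale deltagE.
case: s => [|V [|W s]] //=; rewrite !big1 ?subr0 // => e _; by rewrite mulr0.
Qed.

(** The vector valued 1-form whose contraction with vol is the boundary form. *)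
Definition bform d p W : R := \sum_a \sum_b \sum_c ginv a d p * ginv b c p *
  (nab c a b p W - nab a b c p W).

Definition alpha d p V : R := sqrt_det p * bform d p (ver p V).

Lemma boundaryE p s :
  hilbert_boundary p s = \sum_d e1 (alpha d p) (contr (bvec d) dx_top) s.
Proof.
rewrite /hilbert_boundary !fct_sumE.
transitivity (\sum_a \sum_b \sum_c \sum_d e1 (fun V => sqrt_det p * (ginv a d p * ginv b c p *
   (nab c a b p (ver p V) - nab a b c p (ver p V)))) (contr (bvec d) dx_top) s).
  apply: eq_bigr => a _; rewrite !fct_sumE; apply: eq_bigr => b _.
  rewrite !fct_sumE; apply: eq_bigr => c _; rewrite !fct_sumE; apply: eq_bigr => d _.
  have E t : fscale (fun p => ginv a d p * ginv b c p)
      (nabla_deltag c a b - nabla_deltag a b c) p t =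
     form1 (fun p V => ginv a d p * ginv b c p *
       (nab c a b p (ver p V) - nab a b c p (ver p V))) p t.
    rewrite /fscale addrfctE opprfctE !addrfctE !opprfctE !nabla_deltagE.
    by case: t => [|V [|]] //=; rewrite subrr mulr0.
  rewrite wedge1; [|by rewrite E|by move=> *; rewrite E].
  transitivity (e1 (fun V => (ginv a d p * ginv b c p *
   (nab c a b p (ver p V) - nab a b c p (ver p V)))) (fun t => sqrt_det p * contr (bvec d) dx_top t) s).
    apply: e1_ext => [V|t _]; first by rewrite E.
    by rewrite /iprod volE -(dx_top_hpartial d p).
  by rewrite e1Z -e1_Zl.
under eq_bigr => a _ do under eq_bigr => b _ do rewrite exchange_big.
under eq_bigr => a _ do rewrite exchange_big.
rewrite exchange_big; apply: eq_bigr => d _ /=.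
under eq_bigr => a _ do under eq_bigr => b _ do rewrite -e1_suml.
under eq_bigr => a _ do rewrite -e1_suml.
rewrite -e1_suml; apply: e1_ext => // V.
rewrite /= /alpha /bform mulr_sumr; apply: eq_bigr => a _.
by rewrite mulr_sumr; apply: eq_bigr => b _; rewrite mulr_sumr.
Qed.

Definition elform p W : R := \sum_a \sum_b
  (Ric_up a b p - 2^-1 * scalar_curvature p * ginv a b p) * W (K0 a b).

Lemma ELE p s : hilbert_EL p s = - e1 (fun V => sqrt_det p * elform p (ver p V)) dx_top s.
Proof.
rewrite /hilbert_EL !opprfctE !fct_sumE; congr (- _).
transitivity (\sum_a \sum_b e1 (fun V => sqrt_det p * ((Ric_up a b p - 2^-1 * scalar_curvature p *
    ginv a b p) * ver p V (K0 a b))) dx_top s).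
  apply: eq_bigr => a _; rewrite !fct_sumE; apply: eq_bigr => b _.
  have E t : fscale (fun p => Ric_up a b p - 2^-1 * scalar_curvature p * ginv a b p)
      (deltag a b) p t = form1 (fun p V => (Ric_up a b p - 2^-1 * scalar_curvature p *
    ginv a b p) * ver p V (K0 a b)) p t.
    rewrite /fscale deltagE.
    by case: t => [|V [|]] //=; rewrite mulr0.
  rewrite wedge1; [|by rewrite E|by move=> *; rewrite E].
  transitivity (e1 (fun V => (Ric_up a b p - 2^-1 * scalar_curvature p *
    ginv a b p) * ver p V (K0 a b)) (fun t => sqrt_det p * dx_top t) s).
    apply: e1_ext => [V|t _]; first by rewrite E.
    by rewrite volE.
  by rewrite e1Z -e1_Zl.
under eq_bigr => a _ do rewrite -e1_suml.
rewrite -e1_suml; apply: e1_ext => // V.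
by rewrite /= /elform [RHS]mulr_sumr; apply: eq_bigr => a _; rewrite [RHS]mulr_sumr.
Qed.

End Volume.

(** * Derivatives of matrices *)

Section MatrixDerivative.
Context {R : realType} {E : lmodType R}.
Implicit Types (U p : E).

Definition isDm m n (F : E -> 'M[R]_(m, n)) U p (F' : 'M[R]_(m, n)) :=
  forall i j, isD (fun q => F q i j) U p (F' i j).

Lemma isDm_eq m n (F : E -> 'M[R]_(m, n)) U p F' F'' :
  isDm F U p F' -> F' = F'' -> isDm F U p F''.
Proof. by move=> h <-. Qed.

Lemma isDm_uniq m n (F : E -> 'M[R]_(m, n)) U p F' F'' :
  isDm F U p F' -> isDm F U p F'' -> F' = F''.
Proof. by move=> h h'; apply/matrixP => i j; exact: isD_uniq (h i j) (h' i j). Qed.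

Lemma isDmD m n (F G : E -> 'M[R]_(m, n)) U p F' G' :
  isDm F U p F' -> isDm G U p G' -> isDm (fun q => F q + G q) U p (F' + G').
Proof.
move=> h h' i j; rewrite mxE.
by apply: isD_ext (isDD (h i j) (h' i j)) => q; rewrite mxE.
Qed.

Lemma isDmN m n (F : E -> 'M[R]_(m, n)) U p F' :
  isDm F U p F' -> isDm (fun q => - F q) U p (- F').
Proof.
by move=> h i j; rewrite mxE; apply: isD_ext (isDN (h i j)) => q; rewrite mxE.
Qed.

Lemma isDmB m n (F G : E -> 'M[R]_(m, n)) U p F' G' :
  isDm F U p F' -> isDm G U p G' -> isDm (fun q => F q - G q) U p (F' - G').
Proof. by move=> h h'; apply: isDmD => //; exact: isDmN. Qed.

Lemma isDmM m n k (F : E -> 'M[R]_(m, n)) (G : E -> 'M[R]_(n, k)) U p F' G' :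
  isDm F U p F' -> isDm G U p G' ->
  isDm (fun q => F q *m G q) U p (F' *m G p + F p *m G').
Proof.
move=> h h' i j; rewrite !mxE -big_split.
apply: isD_ext (_ : isD (fun q => \sum_k F q i k * G q k j) _ _ _); first by move=> q; rewrite mxE.
by apply: isD_sumT => l; exact: isDM.
Qed.

Lemma isDmZ m n (f : E -> R) (F : E -> 'M[R]_(m, n)) U p f' F' :
  isD f U p f' -> isDm F U p F' -> isDm (fun q => f q *: F q) U p (f' *: F p + f p *: F').
Proof.
move=> h h' i j; rewrite !mxE.
by apply: isD_ext (isDM h (h' i j)) => q; rewrite mxE.
Qed.

Lemma isDm_sum m n (I : finType) (F : I -> E -> 'M[R]_(m, n)) U p (F' : I -> 'M[R]_(m, n)) :
  (forall i, isDm (F i) U p (F' i)) -> isDm (fun q => \sum_i F i q) U p (\sum_i F' i).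
Proof.
move=> h i j; rewrite summxE.
apply: isD_ext (_ : isD (fun q => \sum_k F k q i j) _ _ _); first by move=> q; rewrite summxE.
by apply: isD_sumT => k; exact: h.
Qed.

Lemma isD_trace n (F : E -> 'M[R]_n) U p F' :
  isDm F U p F' -> isD (fun q => \tr (F q)) U p (\tr F').
Proof. by move=> h; apply: isD_sumT => i; exact: h. Qed.

Lemma isD_prod (I : eqType) (r : seq I) (f : I -> E -> R) (f' : I -> R) U p :
  uniq r -> (forall i, isD (f i) U p (f' i)) ->
  isD (fun q => \prod_(i <- r) f i q) U p
    (\sum_(i <- r) f' i * \prod_(j <- r | j != i) f j p).
Proof.
move=> + h; elim: r => [_|i r IH /= /andP[ir ur]].
  by rewrite big_nil; apply: isD_ext (isD_cst 1 _ _) => q; rewrite big_nil.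
apply: isD_ext (_ : isD (fun q => f i q * \prod_(j <- r) f j q) _ _ _).
  by move=> q; rewrite big_cons.
apply: isD_eq (isDM (h i) (IH ur)) _.
rewrite big_cons big_cons eqxx /= mulr_sumr; congr (_ * _ + _).
  rewrite big_seq [RHS]big_seq_cond; apply: eq_bigl => j.
  by have [->|//] := eqVneq j i; rewrite ?andbT ?(negbTE ir) ?andbF.
rewrite !big_seq; apply: eq_bigr => j jr.
rewrite big_cons; case: eqVneq => [e|_]; first by rewrite e jr in ir.
by rewrite mulrCA.
Qed.

(** The formula of Jacobi, by differentiating the rows one by one. *)
Lemma isD_det n (F : E -> 'M[R]_n) U p F' : isDm F U p F' ->
  isD (fun q => \det (F q)) U p (\tr (F' *m \adj (F p))).
Proof.
move=> h; pose M i : 'M[R]_n := \matrix_(k, l) (if k == i then F' k l else F p k l).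
have -> : \tr (F' *m \adj (F p)) = \sum_i \det (M i).
  apply: eq_bigr => i _; rewrite mxE (expand_det_row (M i) i).
  apply: eq_bigr => j _; rewrite !mxE eqxx; congr (_ * (_ * \det _)).
  by apply/matrixP => k l; rewrite !mxE eq_sym (negbTE (neq_lift _ _)).
under eq_bigr => i _ do rewrite /determinant.
rewrite exchange_big /=.
rewrite /determinant; apply: isD_sumT => s.
rewrite -mulr_sumr; apply: isDZ.
apply: isD_eq (isD_prod (index_enum_uniq 'I_n) (fun i => h i (perm.fun_of_perm s i))) _.
apply: eq_bigr => i _.
rewrite [RHS](bigD1 i) //= mxE eqxx; congr (_ * _).
by apply: eq_bigr => j ji; rewrite mxE (negbTE ji).
Qed.

Lemma isD_inv (f : E -> R) U p f' : f p != 0 -> isD f U p f' ->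
  isD (fun q => (f q)^-1) U p (- (f p)^-2 * f').
Proof.
move=> f0 h; have e : f (p + (0 : R) *: U) = f p by rewrite scale0r addr0.
have := @is_deriveV R (fun t => f (p + t *: U)) 0 f' 1.
by rewrite e => H; exact: (der0_eq (H f0 h) erefl).
Qed.

Lemma isD_sqrt (f : E -> R) U p f' : 0 < f p -> isD f U p f' ->
  isD (fun q => Num.sqrt (f q)) U p ((2 * Num.sqrt (f p))^-1 * f').
Proof.
move=> f0 h; have e : f (p + (0 : R) *: U) = f p by rewrite scale0r addr0.
have hs := is_derive1_sqrt f0; rewrite -e in hs.
have H := @is_derive1_comp R Num.sqrt (fun t => f (p + t *: U)) 0 _ _ hs h.
by apply: (der0_eq H); rewrite e.
Qed.

(** Cofactors show that the inverse is differentiable; its derivative then follows from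
    the product with the matrix. *)
Lemma isDm_inv n (F : E -> 'M[R]_n) U p F' (D : set E) :
  line_open D -> D p -> (forall q, D q -> F q \in unitmx) -> isDm F U p F' ->
  isDm (fun q => invmx (F q)) U p (- (invmx (F p) *m F' *m invmx (F p))).
Proof.
move=> Dopen Dp hu h.
(* The derivative of the cofactor formula exists, whatever its value. *)
have [H hH] : exists H, isDm (fun q => invmx (F q)) U p H.
  have hc i j : isD (fun q => cofactor (F q) i j) U p
      ((-1) ^+ (i + j) * \tr (row' i (col' j F') *m \adj (row' i (col' j (F p))))).
    apply: isDZ; apply: isD_det => k l; rewrite !mxE.
    by apply: isD_ext (h (lift i k) (lift j l)) => q; rewrite !mxE.
  have hd := isD_inv (_ : \det (F p) != 0) (isD_det h).
  exists (\matrix_(i, j) (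
     - (\det (F p))^-2 * (\tr (F' *m \adj (F p))) * cofactor (F p) j i +
     (\det (F p))^-1 * ((-1) ^+ (j + i) *
        \tr (row' j (col' i F') *m \adj (row' j (col' i (F p))))))) => i j.
  rewrite mxE; apply: (isD_on Dopen Dp (F := fun q => (\det (F q))^-1 * cofactor (F q) j i)).
    by move=> q /hu uq; rewrite /invmx uq !mxE.
  apply: isDM; last exact: hc.
  by apply: hd; have := hu p Dp; rewrite unitmxE unitfE.
have e : isDm (fun q => F q *m invmx (F q)) U p 0.
  move=> i j; apply: (isD_on Dopen Dp (F := fun q => (1%:M : 'M[R]_n) i j)).
    by move=> q /hu uq; rewrite mulmxV.
  by apply: isD_eq (isD_cst _ _ _) _; rewrite mxE.
have up := hu p Dp.
have := isDm_uniq e (isDmM h hH) => /esym/eqP; rewrite addrC addr_eq0 => /eqP e2.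
apply: isDm_eq hH _.
by rewrite -[H](mulKmx up) e2 mulmxN mulmxA.
Qed.

End MatrixDerivative.

Section MatrixIdentities.
Context {R : comRingType} {n : nat}.
Implicit Types (A B G : 'M[R]_n).

Lemma addmxE m k (A B : 'M[R]_(m, k)) i j : (A + B) i j = A i j + B i j.
Proof. by rewrite mxE. Qed.
Lemma oppmxE m k (A : 'M[R]_(m, k)) i j : (- A) i j = - A i j.
Proof. by rewrite mxE. Qed.

End MatrixIdentities.

(** Identities of non-commutative polynomials in matrices: the products are expanded
    and the entries of the resulting monomials are treated as atoms of ring. *)
Ltac mx_ring :=
  rewrite ?(mulmxDl, mulmxDr, mulmxBl, mulmxBr, mulmxN, mulNmx, mulmxA);
  apply/matrixP => ? ?; rewrite ?(addmxE, oppmxE); ring.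

(** * Variation of the Christoffel symbols *)

Section Christoffel.
Context {R : realType} {n : nat}.
Notation J := (jspace R n).
Variables (D : set J).
Hypotheses (Dopen : line_open D) (Ddet : forall p, D p -> \det (gmx p) < 0).
Implicit Types (p q U V W : J) (a b c d e : 'I_n).

Definition Gi p : 'M[R]_n := invmx (gmx p).

Definition G1 c p : 'M[R]_n := \matrix_(a, b) g1_ a b c p.

(** The Christoffel symbols of the first kind; the upper index is the column, and c is
    the index of the direction. *)
Definition Km c p : 'M[R]_n :=
  \matrix_(b, a) (2^-1 * (g1_ a b c p + g1_ a c b p - g1_ b c a p)).

(** The c-th connection matrix acts on row vectors: the entry (b, d) is Gamma^d_{bc}. *)
Definition Gam c p : 'M[R]_n := Km c p *m Gi p.

Lemma gmx_unit p : D p -> gmx p \in unitmx.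
Proof. by move/Ddet => h; rewrite unitmxE unitfE lt_eqF. Qed.

Lemma g1_sym a b c p : g1_ a b c p = g1_ b a c p.
Proof. by rewrite /g1_ /gjet mk_upairC. Qed.

Lemma gmx_tr p : (gmx p)^T = gmx p.
Proof. by apply/matrixP => a b; rewrite !mxE /gjet mk_upairC. Qed.

Lemma Gi_tr p : (Gi p)^T = Gi p.
Proof. by rewrite /Gi trmx_inv gmx_tr. Qed.

Lemma Gi_sym p a b : Gi p a b = Gi p b a.
Proof. by rewrite -{1}Gi_tr mxE. Qed.

Lemma GamE d b c p : Gamma d b c p = Gam c p b d.
Proof.
rewrite /Gamma /Gam mxE mulr_sumr; apply: eq_bigr => a _.
by rewrite mxE mulrCA mulrC -/(Gi p) [ginv _ _ _](Gi_sym p d a).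
Qed.

Lemma Km_sym b c a p : Km c p b a = Km b p c a.
Proof. by rewrite !mxE (g1_sym b c a); congr (_ * (_ - _)); rewrite addrC. Qed.

Lemma Gam_sym b c d p : Gam c p b d = Gam b p c d.
Proof. by rewrite !mxE; apply: eq_bigr => a _; rewrite Km_sym. Qed.

Lemma G1_Km c p : G1 c p = Km c p + (Km c p)^T.
Proof.
apply/matrixP => a b; rewrite !mxE (g1_sym b a c).
set x := g1_ a b c p; set y := g1_ b c a p; set z := g1_ a c b p.
by field.
Qed.

Lemma isDm_gmx V p : isDm gmx V p (gmx V).
Proof.
move=> a b; rewrite mxE.
by apply: isD_ext (isD_coord (K0 a b) V p) => q; rewrite mxE.
Qed.

Lemma isDm_gmx_field (Y : J -> J) U p Y' : (forall i, isD (fun q => Y q i) U p (Y' i)) ->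
  isDm (fun q => gmx (Y q)) U p (gmx Y').
Proof.
by move=> h a b; rewrite mxE; apply: isD_ext (h (K0 a b)) => q; rewrite mxE.
Qed.

Lemma isDm_Km_field c (Y : J -> J) U p Y' : (forall i, isD (fun q => Y q i) U p (Y' i)) ->
  isDm (fun q => Km c (Y q)) U p (Km c Y').
Proof.
move=> h b a; rewrite mxE.
apply: isD_ext (_ : isD (fun q => 2^-1 * (Y q (K1 a b c) + Y q (K1 a c b) -
  Y q (K1 b c a))) U p _); first by move=> q; rewrite mxE.
by apply: isDZ; apply: isDB => //; apply: isDD.
Qed.

Lemma isDm_Km c V p : isDm (Km c) V p (Km c V).
Proof. by apply: isDm_Km_field => i; exact: isD_coord. Qed.

Lemma isDm_Gi V p : D p -> isDm Gi V p (- (Gi p *m gmx V *m Gi p)).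
Proof.
by move=> Dp; apply: (isDm_inv Dopen Dp) (isDm_gmx V p) => q; exact: gmx_unit.
Qed.

(** The derivative of Gam along V. *)
Definition DGam c p V : 'M[R]_n := (Km c V - Gam c p *m gmx V) *m Gi p.

Lemma isDm_Gam c V p : D p -> isDm (Gam c) V p (DGam c p V).
Proof.
move=> Dp; apply: isDm_eq (isDmM (isDm_Km c V p) (isDm_Gi V Dp)) _.
by rewrite /DGam /Gam; mx_ring.
Qed.

(** Minus the second derivative of Gam along U and V; its symmetry in U and V lets the
    vertical derivative and the total derivatives of Gam be exchanged. *)
Definition symG c p U V : 'M[R]_n :=
  DGam c p U *m gmx V *m Gi p + DGam c p V *m gmx U *m Gi p.

Lemma symGC c p U V : symG c p U V = symG c p V U.
Proof. by rewrite /symG addrC. Qed.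

Lemma isDm_DGam c (Y : J -> J) U p Y' : D p ->
  (forall i, isD (fun q => Y q i) U p (Y' i)) ->
  isDm (fun q => DGam c q (Y q)) U p (DGam c p Y' - symG c p U (Y p)).
Proof.
move=> Dp h.
have h1 := isDmB (isDm_Km_field c h) (isDmM (isDm_Gam c U Dp) (isDm_gmx_field h)).
apply: isDm_eq (isDmM h1 (isDm_Gi U Dp)) _.
by rewrite /symG /DGam; mx_ring.
Qed.

Lemma gmx_lin (k : R) V W : gmx (k *: V + W) = k *: gmx V + gmx W.
Proof. by apply/matrixP => a b; rewrite !mxE. Qed.

Lemma Km_lin c (k : R) V W : Km c (k *: V + W) = k *: Km c V + Km c W.
Proof.
apply/matrixP => a b; rewrite !mxE /g1_ /gjet !jE.
set x := V _; set y := V _; set z := V _; set x' := W _; set y' := W _; set z' := W _.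
ring.
Qed.

Lemma DGam_lin c p (k : R) V W : DGam c p (k *: V + W) = k *: DGam c p V + DGam c p W.
Proof.
rewrite /DGam gmx_lin Km_lin mulmxDr -scalemxAr.
rewrite [X in _ = X + _]scalemxAl -mulmxDl; congr (_ *m _).
by rewrite scalerBr opprD addrACA.
Qed.

Lemma DGamD c p V W : DGam c p (V + W) = DGam c p V + DGam c p W.
Proof. by have := DGam_lin c p 1 V W; rewrite !scale1r. Qed.

Lemma DGam0 c p : DGam c p 0 = 0.
Proof. by apply: (addrI (DGam c p 0)); rewrite -DGamD !addr0. Qed.

Lemma DGamN c p V : DGam c p (- V) = - DGam c p V.
Proof. by apply/eqP; rewrite -addr_eq0 -DGamD addNr DGam0. Qed.

Lemma DGam_sumZ c p (I : finType) (k : I -> R) (V : I -> J) :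
  DGam c p (\sum_i k i *: V i) = \sum_i k i *: DGam c p (V i).
Proof.
elim/big_rec2: _ => [|i X Y _ h]; first exact: DGam0.
by rewrite DGam_lin h.
Qed.

Lemma DGam_sym b c d p V : DGam c p V b d = DGam b p V c d.
Proof.
rewrite !mxE; apply: eq_bigr => a _; rewrite !mxE; congr ((_ * (_ - _) - _) * _).
- by rewrite addrC.
- by rewrite g1_sym.
- by apply: eq_bigr => e _; rewrite Gam_sym.
Qed.

Lemma mulmx_rows_eq (X Y Z : 'M[R]_n) b c : (forall a, X b a = Y c a) ->
  forall d, (X *m Z) b d = (Y *m Z) c d.
Proof. by move=> h d; rewrite !mxE; apply: eq_bigr => a _; rewrite h. Qed.

Lemma symG_sym b c d p U V : symG c p U V b d = symG b p U V c d.
Proof.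
rewrite /symG !addmxE; congr (_ + _); do 2 apply: mulmx_rows_eq => ?; exact: DGam_sym.
Qed.

(** ** The density *)

Lemma sqrt_det_gt0 p : D p -> 0 < sqrt_det p.
Proof. by move=> /Ddet h; rewrite /sqrt_det sqrtr_gt0 oppr_gt0. Qed.

(** The logarithmic derivative of sqrt (- det g) is half the trace of g^{-1} dg. *)
Lemma isD_sqrt_det V p : D p -> isD (@sqrt_det R n) V p (2^-1 * \tr (Gi p *m gmx V) * sqrt_det p).
Proof.
move=> Dp; have hd := Ddet Dp.
have h := isD_sqrt (f := fun q => - \det (gmx q)) _ (isDN (isD_det (isDm_gmx V p))).
apply: isD_eq (h _) _; first by rewrite oppr_gt0.
have up := gmx_unit Dp; rewrite -/(sqrt_det p).
have -> : \tr (gmx V *m \adj (gmx p)) = - (sqrt_det p ^+ 2) * \tr (Gi p *m gmx V).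
  rewrite sqr_sqrtr ?oppr_ge0 ?(ltW hd) // opprK mxtrace_mulC /Gi /invmx up.
  by rewrite -scalemxAl mxtraceZ mulrA mulfV ?mul1r // lt_eqF.
have s0 : sqrt_det p != 0 by rewrite gt_eqF // sqrt_det_gt0.
by field.
Qed.

End Christoffel.

(** * The Palatini identity *)

Section Contractions.
Context {R : comRingType} {n : nat}.
Implicit Types (H A B : 'M[R]_n) (X Gm : 'I_n -> 'M[R]_n) (a b c d e f : 'I_n).

(** The vector g^{bc} X^d_{bc} - g^{dc} X^b_{bc} for H = g^{-1}, where X^d_{bc} is the
    entry (b, d) of the c-th matrix. *)
Definition Aform H X d : R := \sum_b \sum_c H b c * X c b d - \sum_c H d c * \tr (X c).

Lemma Aform_addX H X X' d : Aform H (fun c => X c + X' c) d = Aform H X d + Aform H X' d.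
Proof.
rewrite /Aform addrACA -opprD -!big_split; congr (_ - _).
  apply: eq_bigr => b _; rewrite -big_split; apply: eq_bigr => c _ /=.
  by rewrite mxE mulrDr.
by apply: eq_bigr => c _; rewrite mxtraceD mulrDr.
Qed.

Lemma Aform_ext H X X' d : X =1 X' -> Aform H X d = Aform H X' d.
Proof. by move=> /funext ->. Qed.

(** Fourfold sums, to rename the indices of contractions by transpositions. *)
Definition S4 (F : 'I_n -> 'I_n -> 'I_n -> 'I_n -> R) : R :=
  \sum_a \sum_b \sum_c \sum_d F a b c d.

Lemma S4_ext F F' : (forall a b c d, F a b c d = F' a b c d) -> S4 F = S4 F'.
Proof. by move=> h; do 4!apply: eq_bigr => ? _. Qed.

Lemma S4_12 F : S4 F = S4 (fun a b c d => F b a c d).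
Proof. exact: exchange_big. Qed.

Lemma S4_23 F : S4 F = S4 (fun a b c d => F a c b d).
Proof. by apply: eq_bigr => a _; exact: exchange_big. Qed.

Lemma S4_34 F : S4 F = S4 (fun a b c d => F a b d c).
Proof. by do 2 apply: eq_bigr => ? _; exact: exchange_big. Qed.

(** If X is a variation of the connection Gm, with derivatives T d (c) of X (c) in the
    direction d, the variation of the Ricci tensor contracted with H is the
    divergence of the vector Aform H X.  The derivative of H is - (H Gm + Gm^T H), as
    for the inverse of a metric parallel for Gm, and \tr (Gm d) is the logarithmic
    derivative of its volume density.  Written out, the terms without derivatives
    are the same contractions up to the names of the indices. *)
Lemma palatini H X Gm (T : 'I_n -> 'I_n -> 'M[R]_n) :
  (forall a b, H a b = H b a) ->
  (forall b c d, X c b d = X b c d) -> (forall b c d, Gm c b d = Gm b c d) ->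
  (forall d b c e, T d c b e = T d b c e) ->
  \sum_d (Aform (- (H *m Gm d + (Gm d)^T *m H)) X d + Aform H (T d) d +
    \tr (Gm d) * Aform H X d) =
  \sum_a \sum_b H a b * \sum_e (T e a - T a e + (X a *m Gm e + Gm a *m X e) -
     (X e *m Gm a + Gm e *m X a)) b e.
Proof.
move=> hH hX hG hT.
(* L1 to L4 come from the derivative of H, L5 from T, and L6, L7 from the density. *)
pose L1 := S4 (fun d b c f => H b f * Gm d f c * X c b d).
pose L2 := S4 (fun d b c f => Gm d f b * H f c * X c b d).
pose L3 := S4 (fun d c f e => H d f * Gm d f c * X c e e).
pose L4 := S4 (fun d c f e => Gm d f d * H f c * X c e e).
pose L5 := \sum_d \sum_b \sum_c H b c * T d c b d - \sum_d \sum_c \sum_e H d c * T d c e e.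
pose L6 := S4 (fun d f b c => Gm d f f * (H b c * X c b d)).
pose L7 := S4 (fun d f c e => Gm d f f * (H d c * X c e e)).
have eL : \sum_d (Aform (- (H *m Gm d + (Gm d)^T *m H)) X d + Aform H (T d) d +
    \tr (Gm d) * Aform H X d) = - L1 - L2 + L3 + L4 + L5 + L6 - L7.
  rewrite big_split big_split /=.
  rewrite (_ : - L1 - L2 + L3 + L4 + L5 + L6 - L7 =
    (- (L1 + L2) + (L3 + L4)) + L5 + (L6 - L7)); last by ring.
  congr (_ + _ + _).
  - rewrite /L1 /L2 /L3 /L4 /S4 -!big_split -sumrN -big_split; apply: eq_bigr => d _ /=.
    rewrite /Aform -!big_split; congr (_ + _).
      rewrite -sumrN; apply: eq_bigr => b _; rewrite -!big_split -sumrN.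
      apply: eq_bigr => c _ /=; rewrite oppmxE addmxE mulNr; congr (- _).
      rewrite !mxE mulrDl !mulr_suml -!big_split; apply: eq_bigr => f _ /=.
      by rewrite mxE.
    rewrite -sumrN; apply: eq_bigr => c _; rewrite oppmxE addmxE mulNr opprK.
    rewrite !mxE mulrDl !mulr_suml -!big_split; apply: eq_bigr => f _ /=.
    rewrite /mxtrace !mulr_sumr -!big_split; apply: eq_bigr => e _.
    by rewrite mxE.
  - rewrite /L5 -sumrB; apply: eq_bigr => d _; rewrite /Aform; congr (_ - _).
    by apply: eq_bigr => c _; rewrite /mxtrace mulr_sumr.
  - rewrite /L6 /L7 /S4 -sumrB; apply: eq_bigr => d _; rewrite /Aform mulrBr; congr (_ - _).
      rewrite /mxtrace mulr_suml; apply: eq_bigr => f _; rewrite mulr_sumr.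
      by apply: eq_bigr => b _; rewrite mulr_sumr.
    rewrite /mxtrace mulr_suml; apply: eq_bigr => f _; rewrite mulr_sumr.
    by apply: eq_bigr => c _; rewrite !mulr_sumr.
(* R5 comes from T, and R1 to R4 from the products of X and Gm.  R3 and R4 match L2
   and L1, R1 and R2 match L6 and L3, and L4 cancels L7. *)
pose R1 := S4 (fun a b e f => H a b * (X a b f * Gm e f e)).
pose R2 := S4 (fun a b e f => H a b * (Gm a b f * X e f e)).
pose R3 := S4 (fun a b e f => H a b * (X e b f * Gm a f e)).
pose R4 := S4 (fun a b e f => H a b * (Gm e b f * X a f e)).
pose R5 := \sum_a \sum_b \sum_e H a b * T e a b e - \sum_a \sum_b \sum_e H a b * T a e b e.
have eR : \sum_a \sum_b H a b * \sum_e (T e a - T a e + (X a *m Gm e + Gm a *m X e) -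
     (X e *m Gm a + Gm e *m X a)) b e = R5 + R1 + R2 - R3 - R4.
  rewrite (_ : R5 + R1 + R2 - R3 - R4 = R5 + (R1 + R2 - (R3 + R4))); last by ring.
  rewrite /R5 /R1 /R2 /R3 /R4 /S4 -!big_split -!sumrB -big_split; apply: eq_bigr => a _ /=.
  rewrite -!big_split -!sumrB -big_split; apply: eq_bigr => b _ /=.
  rewrite mulr_sumr -!big_split -!sumrB -big_split; apply: eq_bigr => e _ /=.
  rewrite !(addmxE, oppmxE) [(X a *m _) _ _]mxE [(Gm a *m _) _ _]mxE.
  rewrite [(X e *m _) _ _]mxE [(Gm e *m _) _ _]mxE -!mulr_sumr.
  by rewrite mulrBr mulrDr mulrBr !mulrDr -!addrA.
have e1 : R4 = L1.
  rewrite /R4 S4_34 S4_23 S4_12 S4_34 S4_23 S4_12 S4_23.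
  by apply: S4_ext => d b c f; rewrite hX mulrA.
have e2 : R3 = L2.
  rewrite /R3 S4_34 S4_23 S4_12 S4_34 S4_23 S4_34.
  apply: S4_ext => d b c f; by rewrite (hX b c d) (hG f d b) [X b c d * _]mulrC mulrCA mulrA.
have e3 : R2 = L3.
  rewrite /R2 S4_34 S4_23.
  by apply: S4_ext => d c f e; rewrite hX mulrA.
have e4 : L7 = L4.
  rewrite /L7 S4_12 S4_23.
  by apply: S4_ext => d c f e; rewrite (hG f d d) mulrA.
have e5 : R5 = L5.
  rewrite /R5 /L5; congr (_ - _).
    under eq_bigr => a _ do rewrite exchange_big.
    rewrite exchange_big; apply: eq_bigr => d _ /=; rewrite exchange_big.
    by apply: eq_bigr => b _; apply: eq_bigr => c _; rewrite hH.
  by do 3 apply: eq_bigr => ? _; rewrite hT.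
have e6 : R1 = L6.
  rewrite /R1 S4_34 S4_23 S4_12 S4_34 S4_23 S4_34.
  by apply: S4_ext => d f b c; rewrite hH (hG f d f) mulrA mulrC.
rewrite eL eR e1 e2 e3 e4 e5 e6; clear.
move: L1 L2 L3 L4 L5 L6 => x1 x2 x3 x4 x5 x6; ring.
Qed.

End Contractions.

(** * Curvature *)

Section Curvature.
Context {R : realType} {n : nat}.
Notation J := (jspace R n).
Variables (D : set J).
Hypotheses (Dopen : line_open D) (Ddet : forall p, D p -> \det (gmx p) < 0).
Implicit Types (p q U V W : J) (a b c d e : 'I_n).

Lemma gmxE W a b : gmx W a b = W (K0 a b).
Proof. by rewrite mxE. Qed.

Lemma K0C a b : K0 a b = K0 b a :> coord n.
Proof. by rewrite /K0 mk_upairC. Qed.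

Lemma DGam_gmx c p W : D p -> DGam c p W *m gmx p = Km c W - Gam c p *m gmx W.
Proof. by move=> Dp; rewrite /DGam mulmxKV //; exact: gmx_unit Ddet _ Dp. Qed.

(** The variation of the Christoffel symbols is the tensor formed from the covariant
    derivatives of the variation of the metric like the symbols themselves from the
    derivatives of the metric. *)
Lemma nab_DGam c b a p W : D p -> (DGam c p W *m gmx p) b a =
  2^-1 * (nab c a b p W + nab b a c p W - nab a b c p W).
Proof.
move=> Dp; rewrite DGam_gmx //.
pose S x y z := \sum_e Gam x p y e * gmx W e z.
have SC x y z : S x y z = S y x z by apply: eq_bigr => e _; rewrite Gam_sym.
have N x y z : nab x y z p W = g1_ y z x W - S x y z - S x z y.
  rewrite /nab; congr (_ - _ - _); apply: eq_bigr => e _; rewrite GamE Gam_sym gmxE //.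
  by rewrite K0C.
rewrite !N addmxE oppmxE [(Gam c p *m gmx W) b a]mxE -/(S c b a) mxE.
rewrite (SC b c a) (SC a b c) (SC a c b).
move: (S c b a) (S c a b) (S b a c) (g1_ _ _ _ _) (g1_ _ _ _ _) (g1_ _ _ _ _) => *.
by field.
Qed.

Lemma nabC a b c p W : nab c a b p W = nab c b a p W.
Proof.
rewrite /nab /K1 mk_upairC addrAC; congr (_ - _ - _); apply: eq_bigr => e _;
by rewrite K0C.
Qed.

(** T1 and T2 are the two terms of the boundary form.  By nab_DGam and the symmetry of
    g^{-1} the first contraction in Aform is T1 - T2 / 2.  In the second one two of the
    three covariant derivatives cancel, which leaves T2 / 2. *)
Lemma bformE d p W : D p -> bform d p W = Aform (Gi p) (fun c => DGam c p W) d.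
Proof.
move=> Dp; have up := gmx_unit Ddet Dp.
pose T1 := \sum_a \sum_b \sum_c Gi p a d * Gi p b c * nab c a b p W.
pose T2 := \sum_a \sum_b \sum_c Gi p a d * Gi p b c * nab a b c p W.
have -> : bform d p W = T1 - T2.
  rewrite /bform /T1 /T2 -sumrB; apply: eq_bigr => a _; rewrite -sumrB.
  apply: eq_bigr => b _; rewrite -sumrB; apply: eq_bigr => c _.
  by rewrite -/(Gi p) mulrBr.
have E c b e : DGam c p W b e = \sum_a (2^-1 * (nab c a b p W + nab b a c p W - nab a b c p W)) * Gi p a e.
  have -> : DGam c p W = DGam c p W *m gmx p *m Gi p by rewrite mulmxK.
  by rewrite mxE; apply: eq_bigr => a _; rewrite nab_DGam.
have half : 2^-1 + 2^-1 = 1 :> R by field.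
have e1 : \sum_b \sum_c Gi p b c * DGam c p W b d = T1 - 2^-1 * T2.
  transitivity (\sum_a \sum_b \sum_c Gi p a d * Gi p b c *
     (2^-1 * nab c a b p W + (2^-1 * nab b a c p W - 2^-1 * nab a b c p W))).
    rewrite [RHS]exchange_big; apply: eq_bigr => b _; rewrite [RHS]exchange_big.
    apply: eq_bigr => c _; rewrite E mulr_sumr; apply: eq_bigr => a _; ring.
  have -> : T1 - 2^-1 * T2 = 2^-1 * T1 + (2^-1 * T1 - 2^-1 * T2).
    by rewrite addrA -mulrDl half mul1r.
  rewrite [X in _ + (_ * X - _)](_ : T1 = \sum_a \sum_b \sum_c Gi p a d * Gi p b c * nab b a c p W).
    rewrite /T1 /T2 !mulr_sumr -sumrB -big_split; apply: eq_bigr => a _ /=.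
    rewrite !mulr_sumr -sumrB -big_split; apply: eq_bigr => b _ /=.
    rewrite !mulr_sumr -sumrB -big_split; apply: eq_bigr => c _ /=.
    move: (nab _ _ _ _ _) (nab _ _ _ _ _) (nab _ _ _ _ _) (Gi _ _ _) (Gi _ _ _) => *; ring.
  rewrite /T1; apply: eq_bigr => a _; rewrite exchange_big; apply: eq_bigr => b _.
  by apply: eq_bigr => c _; rewrite (Gi_sym p c b).
have e2 : \sum_c Gi p d c * \tr (DGam c p W) = 2^-1 * T2.
  rewrite mulr_sumr; apply: eq_bigr => a _; rewrite [Gi p d a]Gi_sym.
  have -> : \tr (DGam a p W) = 2^-1 * \sum_b \sum_c Gi p b c * nab a b c p W.
    transitivity (\sum_b \sum_c (2^-1 * (Gi p b c * nab a b c p W) +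
       (2^-1 * (Gi p b c * nab b c a p W) - 2^-1 * (Gi p b c * nab c b a p W)))).
      apply: eq_bigr => b _; rewrite E; apply: eq_bigr => c _.
      rewrite (nabC c b) (Gi_sym p c b); ring.
    have z : \sum_b \sum_c 2^-1 * (Gi p b c * nab b c a p W) =
        \sum_b \sum_c 2^-1 * (Gi p b c * nab c b a p W).
      by rewrite exchange_big; apply: eq_bigr => b _; apply: eq_bigr => c _; rewrite (Gi_sym p c b).
    under eq_bigr => b _ do rewrite big_split sumrB /=.
    rewrite big_split sumrB /= z subrr addr0 mulr_sumr.
    by apply: eq_bigr => b _; rewrite mulr_sumr.
  rewrite mulrCA !mulr_sumr; apply: eq_bigr => b _; rewrite !mulr_sumr.
  by apply: eq_bigr => c _; rewrite !mulrA.
rewrite /Aform e1 e2.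
have -> : T1 - 2^-1 * T2 - 2^-1 * T2 = T1 - (2^-1 + 2^-1) * T2 by ring.
by rewrite half mul1r.
Qed.

(** ** The Ricci tensor *)

(** The total derivatives of the connection matrices. *)
Definition TG b a p : 'M[R]_n := DGam a p (hpartial b p).

(** The curvature as a matrix: the entry (c, d) is Riem_{abc}^d. *)
Definition Fm a b p : 'M[R]_n :=
  TG b a p - TG a b p + (Gam a p *m Gam b p - Gam b p *m Gam a p).

Lemma RiemE a b c d p : D p -> Riem a b c d p = Fm a b p c d.
Proof.
move=> Dp; have T x y z w : tot x (Gamma y z w) p = TG x z p w y.
  apply: isD_dirder; apply: isD_ext (isDm_Gam Dopen Ddet z (hpartial x p) Dp w y) => q.
  by rewrite GamE Gam_sym.
rewrite /Riem /Fm !T !(addmxE, oppmxE); congr (_ + _).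
rewrite sumrB !mxE; congr (_ - _); apply: eq_bigr => e _;
by rewrite !GamE (Gam_sym c) (Gam_sym e).
Qed.

Lemma RicE a b p : D p -> Ric a b p = \sum_e Fm a e p b e.
Proof. by move=> Dp; apply: eq_bigr => e _; rewrite RiemE. Qed.

(** The derivative of TG along V; the part symmetric in V and the direction b is the
    second derivative of the connection matrices. *)
Definition DTG b a p V : 'M[R]_n := DGam a p (jshift b V) - symG a p V (hpartial b p).

Definition DFm a b p V : 'M[R]_n := DTG b a p V - DTG a b p V +
  ((DGam a p V *m Gam b p + Gam a p *m DGam b p V) -
   (DGam b p V *m Gam a p + Gam b p *m DGam a p V)).

Lemma isDm_TG b a V p : D p -> isDm (TG b a) V p (DTG b a p V).
Proof.
by move=> Dp; apply: (isDm_DGam Dopen Ddet) => // i; exact: isD_hpartial.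
Qed.

Lemma isDm_Fm a b V p : D p -> isDm (Fm a b) V p (DFm a b p V).
Proof.
move=> Dp; have h c := isDm_Gam Dopen Ddet c V Dp.
by apply: isDmD; apply: isDmB; [exact: isDm_TG|exact: isDm_TG|exact: isDmM|exact: isDmM].
Qed.

Lemma isD_Ric a b V p : D p -> isD (Ric a b) V p (\sum_e DFm a e p V b e).
Proof.
move=> Dp; apply: (isD_on Dopen Dp (F := fun q => \sum_e Fm a e q b e)).
  by move=> q Dq; rewrite RicE.
by apply: isD_sumT => e; exact: isDm_Fm.
Qed.

Lemma isD_scalar V p : D p -> isD scalar_curvature V p
  (\sum_a \sum_b ((- (Gi p *m gmx V *m Gi p)) a b * Ric a b p +
     Gi p a b * \sum_e DFm a e p V b e)).
Proof.
move=> Dp; apply: isD_sumT => a; apply: isD_sumT => b.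
by apply: isDM; [exact: (isDm_Gi Dopen Ddet)|exact: isD_Ric].
Qed.

(** The variation of g^{-1} and of the volume density gives the Einstein tensor, the
    variation of the Ricci tensor remains. *)
Lemma isD_hilbert_density V p : D p -> isD hilbert_density V p
  (sqrt_det p * (\sum_a \sum_b Gi p a b * \sum_e DFm a e p V b e -
   elform p V)).
Proof.
move=> Dp; apply: isD_eq (isDM (isD_scalar V Dp) (isD_sqrt_det Ddet V Dp)) _.
have -> : elform p V = \sum_a \sum_b (Gi p *m gmx V *m Gi p) a b * Ric a b p -
    2^-1 * scalar_curvature p * \tr (Gi p *m gmx V).
  rewrite /elform; under eq_bigr => a _ do under eq_bigr => b _ do rewrite mulrBl.
  under eq_bigr => a _ do rewrite sumrB.
  rewrite sumrB; congr (_ - _); last first.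
    rewrite /mxtrace [RHS]mulr_sumr; apply: eq_bigr => a _; rewrite mxE [RHS]mulr_sumr.
    by apply: eq_bigr => b _; rewrite gmxE mulrA K0C.
  pose F a b c d := Gi p a c * Gi p b d * Ric c d p * gmx V a b.
  transitivity (S4 F).
    apply: eq_bigr => a _; apply: eq_bigr => b _.
    rewrite /Ric_up mulr_suml. apply: eq_bigr => c _; rewrite mulr_suml.
    by apply: eq_bigr => d _; rewrite /F mxE.
  rewrite S4_23 S4_12 S4_34 S4_23; apply: eq_bigr => c _; apply: eq_bigr => d _.
  rewrite mxE mulr_suml exchange_big; apply: eq_bigr => b _ /=.
  rewrite mxE !mulr_suml; apply: eq_bigr => a _.
  by rewrite /F (Gi_sym p a c); move: (Gi p c a) (Gi p b d) (gmx V a b) => *; ring.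
under eq_bigr => a _ do rewrite big_split /=.
rewrite big_split /=.
under eq_bigr => a _ do under eq_bigr => b _ do rewrite oppmxE mulNr.
under eq_bigr => a _ do rewrite sumrN.
rewrite sumrN.
move: (\sum_a \sum_b _) (\sum_a \sum_b _) (\tr _) (scalar_curvature p) (sqrt_det p) => x y z r s; ring.
Qed.

(** ** The variation of the lagrangian *)

Lemma gmx_hpartial d p : gmx (hpartial d p) = G1 d p.
Proof. by apply/matrixP => a b; rewrite !mxE. Qed.

Lemma Gi_G1 d p : Gi p *m G1 d p *m Gi p = Gi p *m Gam d p + (Gam d p)^T *m Gi p.
Proof.
by rewrite G1_Km mulmxDr mulmxDl /Gam trmx_mul Gi_tr mulmxA.
Qed.

Lemma tr_Gi_G1 d p : D p -> 2^-1 * \tr (Gi p *m G1 d p) = \tr (Gam d p).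
Proof.
move=> Dp; rewrite G1_Km mulmxDr mxtraceD.
have -> : \tr (Gi p *m (Km d p)^T) = \tr (Gi p *m Km d p).
  by rewrite -mxtrace_tr trmx_mul trmxK Gi_tr mxtrace_mulC.
rewrite /Gam [RHS]mxtrace_mulC; move: (\tr _) => x.
by field.
Qed.

Lemma isD_alpha d V U p : D p -> isD (fun q => alpha d q V) U p
  (2^-1 * \tr (Gi p *m gmx U) * sqrt_det p * Aform (Gi p) (fun c => DGam c p (ver p V)) d +
   sqrt_det p * (Aform (- (Gi p *m gmx U *m Gi p)) (fun c => DGam c p (ver p V)) d +
     Aform (Gi p) (fun c => DGam c p (Dver U V) - symG c p U (ver p V)) d)).
Proof.
move=> Dp; apply: (isD_on Dopen Dp (F := fun q => sqrt_det q * Aform (Gi q) (fun c => DGam c q (ver q V)) d)).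
  by move=> q Dq; rewrite /alpha bformE.
have hX c : isDm (fun q => DGam c q (ver q V)) U p (DGam c p (Dver U V) - symG c p U (ver p V)).
  by apply: (isDm_DGam Dopen Ddet) => // i; exact: isD_ver.
have hG := isDm_Gi Dopen Ddet U Dp.
apply: isDM; first exact: (isD_sqrt_det Ddet).
rewrite /Aform addrACA -opprD -!big_split.
apply: isDB.
  apply: isD_sumT => b; rewrite -big_split; apply: isD_sumT => c.
  by apply: isDM; [exact: hG|exact: hX].
by apply: isD_sumT => c; apply: isDM; [exact: hG|exact: isD_trace].
Qed.

Lemma alphaE d p V : D p ->
  alpha d p V = sqrt_det p * Aform (Gi p) (fun c => DGam c p (ver p V)) d.
Proof. by move=> Dp; rewrite /alpha bformE. Qed.

(** The Palatini identity for the variation of the connection, with the derivatives of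
    g^{-1} and of the volume density expressed by the connection.  The coefficients
    alpha contain the projection ver, whose total derivative compensates jshift by
    Dver_hpartial. *)
Lemma variation_hilbert_density p V : D p ->
  \sum_d (dirder (fun q => alpha d q V) (hpartial d p) p + alpha d p (jshift d V)) =
  sqrt_det p * elform p (ver p V) + dirder hilbert_density (ver p V) p.
Proof.
move=> Dp; rewrite (isD_dirder (isD_hilbert_density (ver p V) Dp)) mulrBr addrCA subrr addr0.
set W := ver p V; pose X c := DGam c p W.
transitivity (sqrt_det p * \sum_d (Aform (- (Gi p *m Gam d p + (Gam d p)^T *m Gi p)) X d +
    Aform (Gi p) (fun c => DTG d c p W) d + \tr (Gam d p) * Aform (Gi p) X d)).
  rewrite mulr_sumr; apply: eq_bigr => d _.
  rewrite (isD_dirder (isD_alpha _ _ _ Dp)) alphaE // gmx_hpartial tr_Gi_G1 // Gi_G1.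
  rewrite -/W -/X.
  have -> : Aform (Gi p) (fun c => DTG d c p W) d =
     Aform (Gi p) (fun c => DGam c p (Dver (hpartial d p) V) - symG c p (hpartial d p) W) d +
     Aform (Gi p) (fun c => DGam c p (ver p (jshift d V))) d.
    rewrite -Aform_addX; apply: Aform_ext => c; rewrite addrAC -DGamD /DTG symGC.
    congr (DGam c p _ - _); apply/eqP; rewrite -subr_eq0 -opprB oppr_eq0 -addrA.
    by rewrite Dver_hpartial.
  set x := Aform _ X d; set y := Aform _ _ d; set z := Aform _ _ d; set w := Aform _ _ d.
  ring.
congr (_ * _).
rewrite (@palatini _ _ (Gi p) X (fun c => Gam c p) (fun d c => DTG d c p W)).
- apply: eq_bigr => a _; apply: eq_bigr => b _; congr (_ * _).
  by apply: eq_bigr => e _; rewrite /DFm [in RHS]addrA.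
- exact: Gi_sym.
- by move=> b c d; exact: DGam_sym.
- by move=> b c d; exact: Gam_sym.
- move=> d b c e; rewrite /DTG addmxE oppmxE [RHS]addmxE oppmxE.
  by rewrite DGam_sym symG_sym.
Qed.

End Curvature.

(** * Invariance under vector fields of the base *)

Section TensorLaws.
Context {R : numFieldType} {n : nat}.
Implicit Types (a b c d e : 'I_n).

(** The metric and its first derivatives transform by B and its derivatives H; in the
    alternating sum of the Christoffel symbols the symmetry of H leaves one term
    with H. *)
Lemma christoffel_law (H : 'I_n -> 'M[R]_n) (B g : 'M[R]_n) (g1 : 'I_n -> 'I_n -> 'I_n -> R)
    a b c :
  (forall x y e, H x y e = H y x e) -> (forall x y, g x y = g y x) ->
  let T x y z := - \sum_e (H x y e * g e z + B y e * g1 e z x + g1 y e x * B z e +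
    g y e * H x z e + B x e * g1 y z e) in
  let K c b a := 2^-1 * (g1 a b c + g1 a c b - g1 b c a) in
  2^-1 * (T c a b + T b a c - T a b c) =
  - \sum_e (H c b e * g e a + K c b e * B a e + B b e * K c e a + B c e * K e b a).
Proof.
move=> hH hg T K; rewrite /T /K -!opprD mulrN; congr (- _).
rewrite -big_split -sumrB mulr_sumr; apply: eq_bigr => e _ /=.
rewrite (hH a c e) (hH b a e) (hH b c e) (hg a e) (hg b e).
by field.
Qed.

(** The non-tensorial parts of the laws for connection matrices and their derivatives
    cancel in the curvature.  Ha and Hb are second derivatives and Q third
    derivatives of the field; s1, s2, s3 and hs stand for the sums over the index of
    the direction. *)
Lemma curvature_law (B Ga Gb Ha Hb Q s1a s1b s2ab s2ba s3ab s3ba hs Tab Tba : 'M[R]_n) :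
  let Da := - Ha - (B *m Ga - Ga *m B) - s1a in
  let Db := - Hb - (B *m Gb - Gb *m B) - s1b in
  - Q - (Hb *m Ga + B *m Tba - (Tba *m B + Ga *m Hb)) - (hs + s2ab) - s3ba -
  (- Q - (Ha *m Gb + B *m Tab - (Tab *m B + Gb *m Ha)) - (hs + s2ba) - s3ab) +
  (Da *m Gb + Ga *m Db - (Db *m Ga + Gb *m Da)) =
  - (B *m (Tba - Tab + (Ga *m Gb - Gb *m Ga)) - (Tba - Tab + (Ga *m Gb - Gb *m Ga)) *m B) -
  (s2ab - s3ab + (s1a *m Gb - Gb *m s1a)) - (s3ba - s2ba + (Ga *m s1b - s1b *m Ga)).
Proof. by move=> Da Db; rewrite /Da /Db; mx_ring. Qed.

Lemma Aform_mulmx (H : 'M[R]_n) (X : 'I_n -> 'M[R]_n) d : H^T = H ->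
  Aform H X d = \sum_c (H *m X c) c d - \sum_c H d c * \tr (X c).
Proof.
move=> hH; congr (_ - _); rewrite exchange_big; apply: eq_bigr => c _ /=.
by rewrite mxE; apply: eq_bigr => b _; rewrite -{2}hH mxE.
Qed.

(** The vector Aform transforms as a vector if its arguments transform as tensors: the
    matrix B acts on the contracted indices with opposite signs, and its action on
    the free index remains. *)
Lemma Aform_law (H B : 'M[R]_n) (X : 'I_n -> 'M[R]_n) d : H^T = H ->
  Aform (H *m B + B^T *m H) X d +
  Aform H (fun c => - (B *m X c - X c *m B) - \sum_f B c f *: X f) d =
  \sum_a B a d * Aform H X a.
Proof.
move=> hH; rewrite !Aform_mulmx //; last by rewrite linearD /= !trmx_mul trmxK hH addrC.
under [RHS]eq_bigr => a _ do rewrite Aform_mulmx // mulrBr.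
rewrite sumrB addrACA -opprD -!big_split /=; congr (_ - _).
  transitivity (\sum_c ((B^T *m (H *m X c)) c d + (H *m X c *m B) c d -
      \sum_f B c f * (H *m X f) c d)).
    apply: eq_bigr => c _.
    have -> : \sum_f B c f * (H *m X f) c d = (H *m \sum_f B c f *: X f) c d.
      rewrite mulmx_sumr summxE; apply: eq_bigr => f _.
      by rewrite -scalemxAr [RHS]mxE.
    rewrite -oppmxE -!addmxE; apply: (congr1 (fun A : 'M[R]_n => A c d)).
    move: (\sum_f _) => S; mx_ring.
  rewrite sumrB big_split /= addrAC.
  have -> : \sum_c (B^T *m (H *m X c)) c d = \sum_c \sum_f B c f * (H *m X f) c d.
    rewrite exchange_big; apply: eq_bigr => c _; rewrite mxE; apply: eq_bigr => e _.
    by rewrite [B^T c e]mxE.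
  rewrite subrr add0r; under eq_bigr => c _ do rewrite mxE.
  rewrite exchange_big; apply: eq_bigr => a _; rewrite mulr_sumr.
  by apply: eq_bigr => c _; rewrite mulrC.
transitivity (\sum_c ((H *m B) d c * \tr (X c) + (B^T *m H) d c * \tr (X c) -
    H d c * \sum_f B c f * \tr (X f))).
  apply: eq_bigr => c _; rewrite addmxE mulrDl.
  have -> : \tr (- (B *m X c - X c *m B) - \sum_f B c f *: X f) = - \sum_f B c f * \tr (X f).
    rewrite raddfB /= raddfN raddfB /= [\tr (X c *m B)]mxtrace_mulC subrr oppr0 sub0r.
    by congr (- _); rewrite raddf_sum; apply: eq_bigr => f _; rewrite /= mxtraceZ.
  by rewrite mulrN.
rewrite sumrB big_split /= addrAC.
have -> : \sum_c (H *m B) d c * \tr (X c) = \sum_c H d c * \sum_f B c f * \tr (X f).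
  under eq_bigr => c _ do rewrite mxE mulr_suml.
  rewrite exchange_big; apply: eq_bigr => c _; rewrite mulr_sumr.
  by apply: eq_bigr => f _; rewrite mulrA.
rewrite subrr add0r; under eq_bigr => c _ do rewrite mxE mulr_suml.
rewrite exchange_big; apply: eq_bigr => a _; rewrite mulr_sumr.
by apply: eq_bigr => c _; rewrite [B^T d a]mxE mulrA.
Qed.

End TensorLaws.

Section Invariance.
Context {R : realType} {n : nat}.
Notation J := (jspace R n).
Variables (U : set 'rV[R]_n) (oU : open U) (D : set J).
Hypotheses (Dopen : line_open D) (Ddet : forall p, D p -> \det (gmx p) < 0).
Hypothesis Dover : forall p, D p -> over U p.
Variable v : 'rV[R]_n -> 'rV[R]_n.
Hypothesis sv : smooth_field U v.
Implicit Types (p q V W : J) (a b c d e : 'I_n).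
Local Notation r := (rfield v).

Definition Bm p : 'M[R]_n := \matrix_(a, c) Dv v a c (basept p).
Definition Hm c p : 'M[R]_n := \matrix_(a, d) partial c (Dv v a d) (basept p).
Definition Qm e c p : 'M[R]_n := \matrix_(a, d) partial e (partial c (Dv v a d)) (basept p).

Lemma BmE p a c : Bm p a c = Dv v a c (basept p).
Proof. exact: mxE. Qed.
Lemma HmE p c a d : Hm c p a d = partial c (Dv v a d) (basept p).
Proof. exact: mxE. Qed.
Lemma QmE p e c a d : Qm e c p a d = partial e (partial c (Dv v a d)) (basept p).
Proof. exact: mxE. Qed.

Lemma isDm_Bm V p : D p -> isDm Bm V p (\sum_e V (inl e) *: Hm e p).
Proof.
move=> Dp a c; rewrite summxE.
apply: isD_ext (_ : isD (fun q => Dv v a c (basept q)) V p _); first by move=> q; rewrite BmE.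
apply: isD_eq (isD_base V (smooth_Dv sv a c) (Dover Dp)) _.
by apply: eq_bigr => e _; rewrite [RHS]mxE HmE.
Qed.

Lemma isDm_Hm c V p : D p -> isDm (Hm c) V p (\sum_e V (inl e) *: Qm e c p).
Proof.
move=> Dp a d; rewrite summxE.
apply: isD_ext (_ : isD (fun q => partial c (Dv v a d) (basept q)) V p _).
  by move=> q; rewrite HmE.
apply: isD_eq (isD_base V (smooth_partial c (smooth_Dv sv a d)) (Dover Dp)) _.
by apply: eq_bigr => e _; rewrite [RHS]mxE QmE.
Qed.

Lemma HmC c a d p : D p -> Hm c p a d = Hm a p c d.
Proof.
move=> Dp; have h := schwarz c a oU (sv d) (Dover Dp).
exact: etrans (HmE p c a d) (etrans h (esym (HmE p a c d))).
Qed.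

Lemma QmC c e p : D p -> Qm e c p = Qm c e p.
Proof.
move=> Dp; apply/matrixP => a d; have h := schwarz e c oU (smooth_Dv sv a d) (Dover Dp).
exact: etrans (QmE p e c a d) (etrans h (esym (QmE p c e a d))).
Qed.

(** The transport term of xi_{ab} is cancelled by the horizontal lift. *)
Lemma gmx_rfield p : gmx (r p) = - (Bm p *m gmx p + gmx p *m (Bm p)^T).
Proof.
apply/matrixP => a b; rewrite gmxE rfield_inr xi0 xi_compE addrC -sumrB.
rewrite oppmxE addmxE [(Bm p *m _) _ _]mxE [(gmx p *m _) _ _]mxE -big_split -sumrN.
apply: eq_bigr => c _; rewrite /= BmE gmxE [gmx p a c]gmxE [(Bm p)^T c b]mxE BmE.
rewrite -[g1_ a b c p]/(p (inr (mk_upair a b, mi_add1 (mi0 n) c))).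
rewrite -[g_ c b p]/(p (K0 c b)) -[g_ a c p]/(p (K0 a c)).
move: (v _ _ _) (Dv v a c _) (Dv v b c _) (p _) (p _) (p _) => *; ring.
Qed.

Lemma sum_hpartial_mx c p (F : 'I_n -> 'M[R]_n) :
  \sum_e hpartial c p (inl e) *: F e = F c.
Proof.
rewrite (bigD1 c) //= eqxx scale1r big1 ?addr0 // => e ec.
by rewrite (negbTE ec) scale0r.
Qed.

Lemma G1_rfield c p : D p -> G1 c (r p) =
  - (Hm c p *m gmx p + Bm p *m G1 c p + (G1 c p *m (Bm p)^T + gmx p *m (Hm c p)^T)) -
  \sum_e Bm p c e *: G1 e p.
Proof.
move=> Dp.
have hB := isDm_Bm (hpartial c p) Dp.
rewrite (sum_hpartial_mx c p (fun e => Hm e p)) in hB.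
have hBT : isDm (fun q => (Bm q)^T) (hpartial c p) p (Hm c p)^T.
  by move=> a b; rewrite mxE; apply: isD_ext (hB b a) => q; rewrite [RHS]mxE.
have hG := isDm_gmx (hpartial c p) p; rewrite gmx_hpartial in hG.
have h := isDmN (isDmD (isDmM hB hG) (isDmM hG hBT)).
apply/matrixP => a b; rewrite mxE.
have -> : g1_ a b c (r p) = tot c (fun q => r q (K0 a b)) p - \sum_e Bm p c e * g1_ a b e p.
  rewrite -[g1_ _ _ _ _]/(r p (inr (mk_upair a b, mi_add1 (mi0 n) c))).
  rewrite (rfield_add1 oU sv) //; last exact: Dover.
  apply: (congr2 (fun x y => x - y)); first by [].
  by apply: eq_bigr => e _; rewrite BmE.
rewrite [RHS]addmxE [X in _ = _ + X]oppmxE [X in _ = _ - X]summxE.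
apply: (congr2 (fun x y => x - y)).
  apply: isD_dirder; apply: isD_ext (h a b) => q.
  by rewrite -[RHS]gmxE gmx_rfield.
by apply: eq_bigr => e _; rewrite [RHS]mxE [G1 e p a b]mxE.
Qed.

Lemma Km_rfield c p : D p -> Km c (r p) =
  - (Hm c p *m gmx p + Km c p *m (Bm p)^T + Bm p *m Km c p + \sum_e Bm p c e *: Km e p).
Proof.
move=> Dp.
have E x y z : g1_ y z x (r p) = - \sum_e (Hm x p y e * gmx p e z + Bm p y e * g1_ e z x p +
    g1_ y e x p * Bm p z e + gmx p y e * Hm x p z e + Bm p x e * g1_ y z e p).
  have := congr1 (fun A : 'M[R]_n => A y z) (G1_rfield x Dp); rewrite mxE => ->.
  rewrite addmxE !oppmxE !addmxE summxE -opprD; congr (- _).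
  rewrite [(_ *m _) y z]mxE [(Bm p *m _) y z]mxE [(G1 x p *m _) y z]mxE.
  rewrite [(gmx p *m _) y z]mxE -!big_split; apply: eq_bigr => e _ /=.
  rewrite [G1 x p e z]mxE [G1 x p y e]mxE [(Bm p)^T _ _]mxE [(Hm x p)^T _ _]mxE.
  rewrite [(Bm p x e *: G1 e p) y z]mxE [G1 e p y z]mxE.
  move: (Hm x p y e) (Hm x p z e) (Bm p y e) (Bm p z e) (Bm p x e) (gmx p e z) (gmx p y e)
    (g1_ e z x p) (g1_ y e x p) (g1_ y z e p) => *; ring.
have gC x y : gmx p x y = gmx p y x by rewrite !gmxE K0C.
have L a b := christoffel_law (Bm p) (fun x y z => g1_ x y z p) a b c
  (fun x y e => HmC x y e Dp) gC.
apply/matrixP => b a; rewrite [LHS]mxE !E; apply: etrans (L a b) _.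
rewrite [RHS]oppmxE; congr (- _); rewrite !addmxE summxE.
rewrite [(Hm c p *m _) b a]mxE [(Km c p *m _) b a]mxE [(Bm p *m _) b a]mxE.
rewrite -!big_split; apply: eq_bigr => e _ /=.
by rewrite [(Bm p)^T _ _]mxE [(Bm p c e *: Km e p) b a]mxE [Km c p b e]mxE [Km c p e a]mxE [Km e p b a]mxE.
Qed.

(** The law of a connection: the term - Hm c is the inhomogeneous part. *)
Lemma Gam_rfield c p : D p -> DGam c p (r p) =
  - Hm c p - (Bm p *m Gam c p - Gam c p *m Bm p) - \sum_e Bm p c e *: Gam e p.
Proof.
move=> Dp; have up := gmx_unit Ddet Dp.
rewrite /DGam Km_rfield // gmx_rfield.
have -> : \sum_e Bm p c e *: Gam e p = (\sum_e Bm p c e *: Km e p) *m Gi p.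
  by rewrite mulmx_suml; apply: eq_bigr => e _; rewrite /Gam scalemxAl.
set S := \sum_e _.
rewrite mulmxN opprK mulmxDr mulmxDl mulmxDl mulNmx.
have e1 : Gam c p *m (Bm p *m gmx p) *m Gi p = Gam c p *m Bm p by rewrite mulmxA mulmxK.
have e2 : Gam c p *m (gmx p *m (Bm p)^T) *m Gi p = Km c p *m (Bm p)^T *m Gi p.
  by rewrite /Gam mulmxA mulmxKV.
rewrite e1 e2 !mulmxDl mulmxK // /Gam -!mulmxA.
by apply/matrixP => i j; rewrite !(addmxE, oppmxE); ring.
Qed.

Lemma Dfield_lin p (k : R) V W : D p ->
  Dfield r p (k *: V + W) = k *: Dfield r p V + Dfield r p W.
Proof.
move=> Dp; apply/funext => i; rewrite /Dfield !jE gat_lin //.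
exact: (rfield_gat oU sv i (Dover Dp)).
Qed.

Lemma Dfield_inl p V a : D p -> Dfield r p V (inl a) = \sum_b V (inl b) * Bm p b a.
Proof.
move=> Dp; rewrite /Dfield; apply: isD_dirder.
apply: isD_ext (_ : isD (fun q => v (basept q) 0 a) V p _).
  by move=> q; rewrite rfield_inl.
apply: isD_eq (isD_base V (sv a) (Dover Dp)) _.
by apply: eq_bigr => b _; rewrite BmE.
Qed.

Lemma isD_rfield p V i : D p -> isD (fun q => r q i) V p (Dfield r p V i).
Proof. by move=> Dp; apply: gatP; exact: (rfield_gat oU sv i (Dover Dp)). Qed.

(** The bracket of the field with a total derivative is a combination of total
    derivatives, with the derivatives of v as coefficients. *)
Lemma jshift_rfield b p : D p ->
  jshift b (r p) = Dfield r p (hpartial b p) - \sum_f Bm p b f *: hpartial f p.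
Proof.
move=> Dp; apply/funext => -[c|[ab C]]; rewrite jaddE joppE jsumE.
  rewrite Dfield_inl // /= -[LHS](subrr (Bm p b c)); congr (_ - _).
    rewrite (bigD1 b) //= eqxx mul1r big1 ?addr0 // => d db.
    by rewrite (negbTE db) mul0r.
  rewrite (bigD1 c) //= jscaleE /= eqxx mulr1 big1 ?addr0 // => d dc.
  by rewrite jscaleE /= eq_sym (negbTE dc) mulr0.
rewrite /= -[LHS]/(r p (inr (ab, mi_add1 C b))) (rfield_add1 oU sv) //; last exact: Dover.
by congr (_ - _); apply: eq_bigr => f _; rewrite jscaleE BmE.
Qed.

(** The field preserves the splitting into vertical and horizontal vectors. *)
Lemma Dver_rfield p V : D p ->
  Dver (r p) V + ver p (Dfield r p V) = Dfield r p (ver p V).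
Proof.
move=> Dp.
have -> : Dfield r p (ver p V) = Dfield r p V - Dfield r p (hor p V).
  by rewrite /ver addrC -scaleN1r Dfield_lin // scaleN1r addrC.
rewrite /Dver /ver addrCA; congr (_ + _); rewrite -opprD; congr (- _).
have -> : Dfield r p (hor p V) = \sum_b V (inl b) *: Dfield r p (hpartial b p).
  rewrite /hor; elim/big_rec2: _ => [|b X Y _ h]; last by rewrite Dfield_lin // h.
  by apply/funext => i; rewrite /Dfield gat0 //; exact: (rfield_gat oU sv i (Dover Dp)).
rewrite (eq_bigr (fun b => V (inl b) *: Dfield r p (hpartial b p) -
    \sum_f (V (inl b) * Bm p b f) *: hpartial f p)); last first.
  move=> b _; rewrite jshift_rfield // scalerBr scaler_sumr; congr (_ - _).
  by apply: eq_bigr => f _; rewrite scalerA.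
rewrite sumrB -[RHS]addr0 -addrA; congr (_ + _).
rewrite /hor exchange_big /= -sumrN -big_split big1 // => f _ /=.
by rewrite Dfield_inl // -scaler_suml addNr.
Qed.

(** The derivative along V of the law Gam_rfield. *)
Lemma DGam_Dfield c V p (VH VQ : 'M[R]_n) : D p ->
  \sum_e V (inl e) *: Hm e p = VH -> \sum_e V (inl e) *: Qm e c p = VQ ->
  DGam c p (Dfield r p V) - symG c p V (r p) =
  - VQ - (VH *m Gam c p + Bm p *m DGam c p V - (DGam c p V *m Bm p + Gam c p *m VH)) -
  \sum_f (VH c f *: Gam f p + Bm p c f *: DGam f p V).
Proof.
move=> Dp eH eQ; have hQ := isDm_Hm c V Dp.
have hB := isDm_Bm V Dp; rewrite eH in hB; rewrite eQ in hQ.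
have h1 := isDm_DGam Dopen Ddet c Dp (fun i => isD_rfield V i Dp).
have hG := isDm_Gam Dopen Ddet _ V Dp.
apply: isDm_uniq h1 _ => i j.
apply: (isD_on Dopen Dp (F := fun q => (- Hm c q - (Bm q *m Gam c q - Gam c q *m Bm q) -
   \sum_e Bm q c e *: Gam e q) i j)).
  by move=> q Dq; rewrite Gam_rfield.
move: i j; apply: isDmB.
  apply: isDmB; first exact: isDmN.
  by apply: isDmB; apply: isDmM.
by apply: isDm_sum => f; apply: isDmZ.
Qed.

Lemma DTG_rfield b a p : D p -> DTG b a p (r p) =
  - Qm b a p - (Hm b p *m Gam a p + Bm p *m TG b a p -
    (TG b a p *m Bm p + Gam a p *m Hm b p)) -
  (\sum_f Hm b p a f *: Gam f p + \sum_f Bm p a f *: TG b f p) -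
  \sum_f Bm p b f *: TG f a p.
Proof.
move=> Dp.
have := DGam_Dfield Dp (sum_hpartial_mx b p (fun e => Hm e p))
  (sum_hpartial_mx b p (fun e => Qm e a p)).
rewrite big_split /= => <-.
rewrite /DTG jshift_rfield // DGamD DGamN DGam_sumZ symGC.
by rewrite -addrA [- _ - _]addrC addrA.
Qed.

(** The curvature transforms as a tensor with two lower indices a, b and one index of
    each kind as a matrix: the third derivatives Qm and the second derivatives Hm are
    symmetric, so curvature_law applies. *)
Lemma DFm_rfield a b p : D p -> DFm a b p (r p) =
  - (Bm p *m Fm a b p - Fm a b p *m Bm p) -
  \sum_e Bm p a e *: Fm e b p - \sum_e Bm p b e *: Fm a e p.
Proof.
move=> Dp; pose s1 c := \sum_e Bm p c e *: Gam e p.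
pose s2 c d := \sum_f Bm p c f *: TG d f p.
pose s3 c d := \sum_f Bm p c f *: TG f d p.
pose hs c d := \sum_f Hm c p d f *: Gam f p.
have hsC c d : hs c d = hs d c by apply: eq_bigr => f _; exact: (congr1 (fun x => x *: Gam f p) (HmC c d f Dp)).
have E1 : \sum_e Bm p a e *: Fm e b p = s2 a b - s3 a b +
    (s1 a *m Gam b p - Gam b p *m s1 a).
  rewrite /s1 /s2 /s3 mulmx_suml mulmx_sumr -!sumrB -big_split; apply: eq_bigr => e _ /=.
  by rewrite /Fm scalerDr !scalerBr -scalemxAl -scalemxAr.
have E2 : \sum_e Bm p b e *: Fm a e p = s3 b a - s2 b a +
    (Gam a p *m s1 b - s1 b *m Gam a p).
  rewrite /s1 /s2 /s3 mulmx_suml mulmx_sumr -!sumrB -big_split; apply: eq_bigr => e _ /=.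
  by rewrite /Fm scalerDr !scalerBr -scalemxAl -scalemxAr.
have DT := DTG_rfield b a Dp; have DT' := DTG_rfield a b Dp.
have qs : Qm a b p = Qm b a p := QmC b a Dp.
rewrite E1 E2 /DFm (Gam_rfield a Dp) (Gam_rfield b Dp).
apply: etrans _ (@curvature_law _ _ (Bm p) (Gam a p) (Gam b p) (Hm a p) (Hm b p) (Qm b a p)
  (s1 a) (s1 b) (s2 a b) (s2 b a) (s3 a b) (s3 b a) (hs a b) (TG a b p) (TG b a p)).
apply: (congr2 +%R _ erefl); apply: (congr2 (fun x y : 'M[R]_n => x - y)).
  by rewrite (hsC a b); exact: DT.
exact: etrans DT' (congr1 (fun Z : 'M[R]_n => - Z - _ - _ - _) qs).
Qed.

Definition Rm p : 'M[R]_n := \matrix_(a, b) Ric a b p.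

Lemma isDm_Ric_rfield a b p : D p -> \sum_e DFm a e p (r p) b e =
  - (Bm p *m Rm p + Rm p *m (Bm p)^T) a b.
Proof.
move=> Dp; under eq_bigr => e _ do rewrite DFm_rfield // !(addmxE, oppmxE).
pose T1 := \sum_e \sum_f Bm p b f * Fm a e p f e.
pose T2 := \sum_e \sum_f Fm a e p b f * Bm p f e.
pose T3 := \sum_e \sum_f Bm p a f * Fm f e p b e.
pose T4 := \sum_e \sum_f Bm p e f * Fm a f p b e.
have -> : \sum_e (- ((Bm p *m Fm a e p) b e - (Fm a e p *m Bm p) b e) -
   (\sum_f Bm p a f *: Fm f e p) b e - (\sum_f Bm p e f *: Fm a f p) b e) =
   - (T1 - T2) - T3 - T4.
  rewrite /T1 /T2 /T3 /T4 -!(sumrB, sumrN); apply: eq_bigr => e _.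
  congr (- (_ - _) - _ - _); rewrite ?summxE ?[(_ *m _) b e]mxE //;
  by apply: eq_bigr => f _; rewrite mxE.
have -> : T4 = T2.
  rewrite /T4 /T2 exchange_big; do 2 (apply: eq_bigr => ? _); by rewrite mulrC.
rewrite addmxE [(Bm p *m _) a b]mxE [(Rm p *m _) a b]mxE.
have RmE x y : Rm p x y = \sum_e Fm x e p y e.
  exact: etrans (mxE _ _ _ _) (RicE Dopen Ddet _ _ Dp).
have -> : \sum_c Bm p a c * Rm p c b = T3.
  by rewrite /T3 exchange_big; apply: eq_bigr => c _; rewrite RmE mulr_sumr.
have -> : \sum_c Rm p a c * (Bm p)^T c b = T1.
  rewrite /T1 exchange_big; apply: eq_bigr => c _.
  by rewrite RmE [(Bm p)^T c b]mxE mulrC mulr_sumr.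
ring.
Qed.

Lemma Gi_rfield p : D p ->
  - (Gi p *m gmx (r p) *m Gi p) = Gi p *m Bm p + (Bm p)^T *m Gi p.
Proof.
move=> Dp; have up := gmx_unit Ddet Dp.
rewrite gmx_rfield mulmxN mulNmx opprK mulmxDr mulmxDl.
by rewrite [Gi p *m (_ *m gmx p)]mulmxA mulmxK // mulmxA mulVmx // mul1mx.
Qed.

Lemma tr_Gi_rfield p : D p -> 2^-1 * \tr (Gi p *m gmx (r p)) = - \tr (Bm p).
Proof.
move=> Dp; have up := gmx_unit Ddet Dp.
rewrite gmx_rfield mulmxN mulmxDr.
have -> : \tr (- (Gi p *m (Bm p *m gmx p) + Gi p *m (gmx p *m (Bm p)^T))) = - (\tr (Bm p) + \tr (Bm p)).
  rewrite raddfN raddfD /=; congr (- (_ + _)).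
    by rewrite mulmxA mxtrace_mulC mulmxA mulmxV // mul1mx.
  by rewrite mulmxA mulVmx // mul1mx mxtrace_tr.
by field.
Qed.

(** Each contraction of g^{-1} with the Ricci tensor pairs an action of B with an
    opposite one. *)
Lemma scalar_invariant p : D p -> dirder scalar_curvature (r p) p = 0.
Proof.
move=> Dp; rewrite (isD_dirder (isD_scalar Dopen Ddet (r p) Dp)) Gi_rfield //.
under eq_bigr => a _ do under eq_bigr => b _ do rewrite isDm_Ric_rfield //.
transitivity (\tr ((Gi p *m Bm p + (Bm p)^T *m Gi p) *m (Rm p)^T) -
   \tr (Gi p *m (Bm p *m Rm p + Rm p *m (Bm p)^T)^T)).
  rewrite /mxtrace -sumrB; apply: eq_bigr => a _; rewrite !mxE -sumrB; apply: eq_bigr => b _.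
  rewrite [(Rm p)^T b a]mxE [Rm p a b]mxE [(_ + _)^T b a]mxE.
  by rewrite mulrN.
rewrite linearD /= !trmx_mul trmxK mulmxDl mulmxDr !mxtraceD.
have -> : \tr ((Bm p)^T *m Gi p *m (Rm p)^T) = \tr (Gi p *m ((Rm p)^T *m (Bm p)^T)).
  by rewrite -mulmxA mxtrace_mulC mulmxA.
by rewrite -!mulmxA opprD addrACA [X in _ + X]addrC; move: (\tr _) (\tr _) => *; ring.
Qed.

Lemma hilbert_density_invariant p : D p ->
  dirder hilbert_density (r p) p = - \tr (Bm p) * hilbert_density p.
Proof.
move=> Dp; have h1 := isD_scalar Dopen Ddet (r p) Dp.
have h := isDM h1 (isD_sqrt_det Ddet (r p) Dp).
rewrite (isD_dirder h) -(isD_dirder h1) scalar_invariant // tr_Gi_rfield // mul0r add0r.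
by rewrite /hilbert_density mulrCA.
Qed.

(** A vertical vector V does not move the base point, so the inhomogeneous terms of
    DGam_Dfield vanish and the variation of the connection transforms as a tensor;
    Aform_law and the weight of sqrt (- det g) give the rest. *)
Lemma alpha_invariant d p V : D p ->
  dirder (fun q => alpha d q V) (r p) p + alpha d p (Dfield r p V) =
  - \tr (Bm p) * alpha d p V + \sum_a Bm p a d * alpha a p V.
Proof.
move=> Dp; rewrite (isD_dirder (isD_alpha Dopen Ddet _ _ _ Dp)).
rewrite (alphaE Ddet d (Dfield r p V) Dp) (alphaE Ddet d V Dp).
rewrite tr_Gi_rfield // Gi_rfield //.
set W := ver p V; pose X c := DGam c p W.
have -> : \sum_a Bm p a d * alpha a p V = sqrt_det p * \sum_a Bm p a d * Aform (Gi p) X a.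
  by rewrite mulr_sumr; apply: eq_bigr => a _; rewrite (alphaE Ddet a V Dp) mulrCA.
rewrite -(Aform_law _ _ _ (Gi_tr p)) -addrA -mulrDr mulrA; congr (_ + _ * _).
rewrite -addrA -Aform_addX; congr (_ + _); apply: Aform_ext => c.
have Z (F : 'I_n -> 'M[R]_n) : \sum_e W (inl e) *: F e = 0.
  by rewrite big1 // => e _; rewrite /W ver_inl scale0r.
rewrite addrAC -DGamD Dver_rfield // symGC.
rewrite (DGam_Dfield Dp (Z (fun e => Hm e p)) (Z (fun e => Qm e c p))).
rewrite mul0mx mulmx0 add0r addr0 oppr0 add0r; apply: (congr2 (fun x y : 'M[R]_n => x - y)) => //.
by apply: eq_bigr => f _; rewrite mxE scale0r add0r.
Qed.

End Invariance.

(** * The set of lorentzian jets is open *)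

Section Lorentzian.
Context {R : realType}.

Lemma lorentzian_det n (G : 'M[R]_n) : lorentzian G -> \det G < 0.
Proof.
move=> [n0 [P uP h]].
have dd : \det (diag_mx (\row_(a < n) if a == 0%N :> nat then -1 else 1 : R)) = -1.
  rewrite det_diag (bigD1 (Ordinal n0)) //= mxE eqxx big1 ?mulr1 // => a a0.
  by rewrite mxE; case: eqP => // e; case/eqP: a0; apply: val_inj.
have d0 : \det P != 0 by move: uP; rewrite unitmxE unitfE.
have := congr1 determinant h; rewrite dd !det_mulmx det_tr => e.
have e2 : \det P ^+ 2 * \det G = -1 by rewrite -e expr2; ring.
have p2 : 0 < \det P ^+ 2 by rewrite exprn_even_gt0.
by rewrite -(pmulr_rlt0 _ p2) e2 oppr_lt0.
Qed.

(** Elimination of the first row and column of a symmetric matrix near a diagonal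
    matrix of signs: the first entry keeps its sign and can be rescaled, and the
    remaining block is again near a diagonal matrix of signs. *)
Lemma near_diag_congruent n (s : 'rV[R]_n) : (forall i, s 0 i ^+ 2 = 1) ->
  exists2 e : R, 0 < e & forall A : 'M[R]_n, A^T = A ->
    (forall i j, `|A i j - diag_mx s i j| < e) ->
    exists2 Q : 'M[R]_n, Q \in unitmx & Q *m A *m Q^T = diag_mx s.
Proof.
elim: n s => [|n IH] s hs.
  exists 1 => // A _ _; exists 1%:M; first exact: unitmx1.
  by apply/matrixP => -[].
pose s1 : 'rV[R]_1 := lsubmx (s : 'rV_(1 + n)); pose s' : 'rV[R]_n := rsubmx (s : 'rV_(1 + n)).
have [e' e'0 he'] : exists2 e : R, 0 < e & forall A : 'M[R]_n, A^T = A ->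
    (forall i j, `|A i j - diag_mx s' i j| < e) ->
    exists2 Q : 'M[R]_n, Q \in unitmx & Q *m A *m Q^T = diag_mx s'.
  by apply: IH => i; rewrite mxE hs.
pose s0 := s1 0 0; have s02 : s0 ^+ 2 = 1 by rewrite /s0 mxE hs.
have ds : diag_mx s = block_mx (s0%:M : 'M_1) 0 0 (diag_mx s') :> 'M_(1 + n).
  have es : s = row_mx s1 s' :> 'rV_(1 + n) := esym (hsubmxK _).
  apply: etrans (congr1 (@diag_mx R (1 + n)) es) (etrans (diag_mx_row s1 s') _).
  congr block_mx; rewrite [LHS]mx11_scalar; congr (_%:M).
  by rewrite [LHS]mxE eqxx mulr1n.
(* With |A - diag s| < e <= 1/2 the first entry a satisfies |a| >= 1/2, and the
   correction b b^T / a of the remaining block is at most 2 * (1/2) * e = e. *)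
pose e : R := Num.min (2^-1) (e' / 2).
have h2 : 0 < 2^-1 :> R by rewrite invr_gt0.
have e0 : 0 < e by rewrite lt_min h2 divr_gt0.
have e12 : e <= 2^-1 by rewrite ge_min lexx.
have ee' : e + e <= e'.
  have : e <= e' / 2 by rewrite ge_min lexx orbT.
  by lra.
exists e => // A sA hA.
pose A4 : 'M[R]_(1 + n) := A.
pose a : R := ulsubmx A4 0 0.
pose b : 'rV[R]_n := ursubmx A4.
pose C : 'M[R]_n := drsubmx A4.
have A_E : A = block_mx (a%:M : 'M_1) b b^T C :> 'M_(1 + n).
  rewrite -[LHS](submxK A4); congr block_mx; first exact: mx11_scalar.
  by rewrite /b trmx_ursub /A4 sA.
have hA4 (i j : 'I_(1 + n)) : `|block_mx (a%:M : 'M_1) b b^T C i j -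
    block_mx (s0%:M : 'M_1) 0 0 (diag_mx s') i j| < e.
  by rewrite -ds -A_E; exact: hA.
have ha : `|a - s0| < e.
  by have := hA4 (lshift n 0) (lshift n 0); rewrite !block_mxEul !mxE !mulr1n.
have hb j : `|b 0 j| < e.
  by have := hA4 (lshift n 0) (rshift 1 j); rewrite !block_mxEur [X in _ - X]mxE subr0.
have hC i j : `|C i j - diag_mx s' i j| < e.
  by have := hA4 (rshift 1 i) (rshift 1 j); rewrite !block_mxEdr.
have s0n : `|s0| = 1.
  by apply/eqP; rewrite -(eqrXn2 (n := 2)) // expr1n real_normK ?num_real // s02.
have a_lb : 2^-1 <= `|a|.
  have := ler_normB a (a - s0); rewrite subKr s0n.
  by move=> h; have := ltW ha; lra.
have a0 : a != 0 by rewrite -normr_gt0 (lt_le_trans h2).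
pose S : 'M[R]_n := C - a^-1 *: (b^T *m b).
have sC : C^T = C by rewrite /C trmx_drsub /A4 sA.
have sS : S^T = S by rewrite /S linearB /= linearZ /= trmx_mul trmxK sC.
have hS i j : `|S i j - diag_mx s' i j| < e'.
  have -> : S i j - diag_mx s' i j = C i j - diag_mx s' i j - a^-1 * (b 0 i * b 0 j).
    by rewrite /S addmxE oppmxE [(a^-1 *: (b^T *m b)) i j]mxE [(b^T *m b) i j]mxE big_ord1 [b^T i 0]mxE addrAC.
  apply: le_lt_trans (ler_normB _ _) _; apply: lt_le_trans ee'; apply: ltr_leD; first exact: hC.
  rewrite !normrM normfV.
  have i2 : `|a|^-1 <= 2 by rewrite -[2]invrK lef_pV2 ?posrE // normr_gt0.
  have h1 : `|b 0 i| * `|b 0 j| <= 2^-1 * e.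
    by apply: ler_pM => //; [exact: le_trans (ltW (hb i)) e12|exact: ltW].
  have : `|a|^-1 * (`|b 0 i| * `|b 0 j|) <= 2 * (2^-1 * e).
    by apply: ler_pM => //; rewrite ?invr_ge0 ?mulr_ge0.
  by rewrite mulrA mulfV ?mul1r // pnatr_eq0.
have [Q' uQ' hQ'] := he' S sS hS.
pose L : 'M[R]_(1 + n) := block_mx 1%:M 0 (- a^-1 *: b^T) 1%:M.
(* L clears the first row and column, and T rescales the first entry to its sign. *)
pose d : R := (Num.sqrt `|a|)^-1.
have d0 : d != 0 by rewrite invr_eq0 sqrtr_eq0 -ltNge normr_gt0.
pose T : 'M[R]_(1 + n) := block_mx (d%:M : 'M_1) 0 0 Q'.
have uL : L \in unitmx by rewrite unitmxE det_lblock !det1 mulr1 unitr1.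
have uT : T \in unitmx.
  by rewrite unitmxE det_lblock det_scalar expr1 unitrM unitfE d0 -unitmxE.
exists (T *m L); first by rewrite unitmx_mul uT uL.
have LAL : L *m block_mx (a%:M : 'M_1) b b^T C *m L^T = block_mx (a%:M : 'M_1) 0 0 S.
  rewrite /L tr_block_mx !trmx1 trmx0 linearZ /= trmxK !mulmx_block.
  rewrite !mul1mx !mul0mx !mulmx1 !mulmx0 !addr0.
  have e1 : (a%:M : 'M_1) *m (- a^-1 *: b) + b = 0.
    by rewrite mul_scalar_mx scalerA mulrN mulfV // scaleN1r addNr.
  have e2 : (- a^-1 *: b^T) *m (a%:M : 'M_1) + b^T = 0.
    by rewrite mul_mx_scalar scalerA mulrN mulfV // scaleN1r addNr.
  by rewrite e1 e2 mul0mx add0r -scalemxAl scaleNr addrC.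
suff key : T *m L *m block_mx (a%:M : 'M_1) b b^T C *m (T *m L)^T =
    block_mx (s0%:M : 'M_1) 0 0 (diag_mx s').
  by rewrite -ds -A_E in key.
rewrite trmx_mul -!mulmxA (mulmxA L) (mulmxA _ L^T) LAL !mulmxA /T tr_block_mx !trmx0 tr_scalar_mx !mulmx_block.
rewrite !(mul0mx, mulmx0, addr0, add0r) hQ'; congr block_mx.
rewrite -!scalar_mxM; congr (_%:M).
have n0 : Num.sqrt `|a| != 0 by rewrite -invr_eq0.
have sq2 : Num.sqrt `|a| ^+ 2 = `|a| by rewrite sqr_sqrtr.
rewrite mulrAC -expr2 /d exprVn sq2.
have as0 : 0 < a * s0.
  have : `|a * s0 - s0 ^+ 2| < 2^-1.
    rewrite expr2 -mulrBl normrM s0n mulr1.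
    exact: lt_le_trans ha e12.
  by rewrite s02 ltr_norml => /andP[h _]; lra.
have -> : `|a| = a * s0 by rewrite -[LHS]mulr1 -[X in _ * X = _]s0n -normrM gtr0_norm.
apply: (mulfI (x := a * s0)); first by rewrite gt_eqF.
by rewrite mulrA mulfV ?gt_eqF // mul1r -mulrA -expr2 s02 mulr1.
Qed.

(** After the congruence which normalizes G, the perturbation is small. *)
Lemma lorentzian_near n (G H : 'M[R]_n) : lorentzian G -> G^T = G -> H^T = H ->
  \forall t \near (0 : R), lorentzian (G + t *: H).
Proof.
move=> [n0 [P uP h]] sG sH; set s : 'rV[R]_n := \row_(a < n) _ in h.
have [i|e e0 he] := @near_diag_congruent n s.
  by rewrite mxE; case: ifP => _; rewrite ?sqrrN expr1n.
pose H' := P *m H *m P^T.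
pose m : R := \sum_i \sum_j `|H' i j| + 1.
have m0 : 0 < m by rewrite ltr_wpDl // sumr_ge0 // => i _; rewrite sumr_ge0.
have hm i j : `|H' i j| < m.
  rewrite /m (bigD1 i) //= (bigD1 j) //= -addrA -addrA ltrDl.
  by rewrite ltr_wpDl ?sumr_ge0 // ltr_wpDl ?sumr_ge0 // => k _; rewrite sumr_ge0.
have : \forall t \near (0 : R), `|t| < e / m.
  have d0 : 0 < e / m by rewrite divr_gt0.
  by apply/nbhs_ballP; exists (e / m) => //= t; rewrite -ball_normE /= sub0r normrN.
apply: filterS => t ht.
have hPt : P *m (G + t *: H) *m P^T = diag_mx s + t *: H'.
  by rewrite mulmxDr mulmxDl h -scalemxAr -scalemxAl.
have [||Q uQ hQ] := he (P *m (G + t *: H) *m P^T).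
- by rewrite !trmx_mul trmxK linearD /= linearZ /= sG sH mulmxA.
- move=> i j; rewrite hPt addmxE addrC addKr mxE normrM.
  rewrite -(divfK (lt0r_neq0 m0) e); case: (ltgtP `|t| 0) => [|t0|->]; first by rewrite normr_lt0.
    by apply: ltr_pM; rewrite ?normr_ge0.
  by rewrite mul0r mulr_gt0 // divr_gt0.
split=> //; exists (Q *m P); first by rewrite unitmx_mul uQ uP.
by rewrite trmx_mul -hQ !mulmxA.
Qed.

End Lorentzian.

(** * The boundary identity and the invariance over a chart *)

Section Exterior.
Context {R : realType} {n : nat}.
Notation J := (jspace R n).
Implicit Types (p q U V W : J) (s t : seq J).

Lemma isD_e1 (al : J -> J -> R) (al' : J -> R) (c : seq J -> R) U p s :
  (forall V, isD (fun q => al q V) U p (al' V)) ->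
  isD (fun q => e1 (al q) c s) U p (e1 al' c s).
Proof.
move=> h; elim: s c => [|V s IH] c; first exact: isD_cst.
apply: (isD_ext (F := fun q => al q V * c s - e1 (al q) (contr V c) s)) => [q|].
  by rewrite e1_cons.
rewrite e1_cons; apply: isDB; last exact: IH.
by apply: isD_eq (isDM (h V) (isD_cst (c s) _ _)) _; rewrite mulr0 addr0.
Qed.

Lemma e10l (c : seq J -> R) s : e1 (fun=> 0) c s = 0.
Proof. by rewrite -[RHS](alt0 s); apply: alt_ext => V t _; rewrite mul0r. Qed.

Lemma gat_form_add (D : set J) (w w' : jet_form R n) : gat_form D w -> gat_form D w' ->
  gat_form D (fun q t => w q t + w' q t).
Proof.
move=> hw hw'; split=> [p Dp s1 s2 k V W|p Dp s1 s2 V||p s Dp].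
- by rewrite (gat_form_mlin hw Dp) (gat_form_mlin hw' Dp); ring.
- by rewrite (gat_form_altn hw Dp) (gat_form_altn hw' Dp) addr0.
- have [K hK] := gat_form_fin hw; have [K' hK'] := gat_form_fin hw'.
  exists (K ++ K') => p s s' Dp h; congr (_ + _); [apply: hK|apply: hK'] => //;
  apply: same_on_sub h => i iK; by rewrite mem_cat iK ?orbT.
- exact: gatD (gat_form_gat hw s Dp) (gat_form_gat hw' s Dp).
Qed.

(** The derivatives of total derivatives are vertical, so they act on the boundary form
    through its coefficients only. *)
Lemma slot_jshift_dx_top a s : slot (jshift a) (@dx_top R n) s = 0.
Proof.
rewrite (dx_top_slot (B := fun _ _ => 0)) ?big1 ?mul0r // => V b.
by rewrite big1 // => c _; rewrite mulr0.
Qed.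

Lemma slot_jshift_contr a d s : slot (jshift a) (contr (bvec d) (@dx_top R n)) s = 0.
Proof.
rewrite (slot_contr_dx_top (B := fun _ _ => 0)).
  by rewrite !big1 ?mul0r ?subr0 // => b _; rewrite mul0r.
by move=> V b; rewrite /dxc /= big1 // => c _; rewrite mulr0.
Qed.

End Exterior.

Section Chart.
Context {R : realType} {n : nat}.
Notation J := (jspace R n).
Variables (U : set 'rV[R]_n) (oU : open U).
Implicit Types (p q V W : J) (s t : seq J) (w L G : jet_form R n).

Definition Dlor : set J := [set p | U (basept p) /\ lorentzian (gmx p)].
Local Notation D := Dlor.

Lemma Dlor_open : line_open D.
Proof.
move=> p V [Up lp].
have h1 := @over_open _ _ U oU p V Up.
have h2 := lorentzian_near lp (gmx_tr p) (gmx_tr V).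
apply: filterS (filterI h1 h2) => t [Ut lt]; split => //.
have -> : gmx (p + t *: V) = gmx p + t *: gmx V; last by [].
by rewrite addrC gmx_lin addrC.
Qed.

Lemma Dlor_det p : D p -> \det (gmx p) < 0.
Proof. by case=> _ /lorentzian_det. Qed.

Lemma Dlor_over p : D p -> over U p.
Proof. by case. Qed.

Let Dopen := Dlor_open.
Let Ddet := Dlor_det.

Section Boundary.
Variables (L G : jet_form R n).
Hypotheses (nL : gat_form D L) (nG : gat_form D G).
Hypothesis hL : forall q t, D q -> L q t = hilbert_lagrangian q t.
Hypothesis hG : forall q t, D q -> G q t = hilbert_boundary q t.

Lemma L_E q t : D q -> L q t = hilbert_density q * dx_top t.
Proof. by move=> Dq; rewrite hL // lagrangianE. Qed.

Lemma G_E q t : D q -> G q t = \sum_d e1 (alpha d q) (contr (bvec d) dx_top) t.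
Proof. by move=> Dq; rewrite hG // boundaryE. Qed.

Lemma isD_L p V t : D p -> isD (fun q => L q t) V p (dirder hilbert_density V p * dx_top t).
Proof.
move=> Dp; apply: (isD_on Dopen Dp (F := fun q => hilbert_density q * dx_top t)).
  by move=> q Dq; rewrite L_E.
have h := isD_derP (isD_hilbert_density Dopen Ddet V Dp).
by apply: isD_eq (isDM h (isD_cst (dx_top t) _ _)) _; rewrite mulr0 addr0.
Qed.

Lemma isD_G p V t : D p -> isD (fun q => G q t) V p
  (\sum_d e1 (fun W => dirder (fun q => alpha d q W) V p) (contr (bvec d) dx_top) t).
Proof.
move=> Dp; apply: (isD_on Dopen Dp (F := fun q => \sum_d e1 (alpha d q) (contr (bvec d) dx_top) t)).
  by move=> q Dq; rewrite G_E.
apply: isD_sumT => d; apply: isD_e1 => W.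
exact: isD_derP (isD_alpha Dopen Ddet d W V Dp).
Qed.

Lemma vdiff_L p s : D p ->
  vdiff L p s = e1 (fun V => dirder hilbert_density (ver p V) p) dx_top s.
Proof.
move=> Dp; rewrite (vdiffE Dopen s nL Dp) extE /hd /e1 -altB; apply: alt_ext => V t _.
have -> : \sum_a V (inl a) * Lh a L p t =
   \sum_a V (inl a) * dirder (fun q => L q t) (hpartial a p) p.
  apply: eq_bigr => a _; congr (_ * _); rewrite /Lh.
  rewrite (@slot_ext _ _ _ _ (fun t => hilbert_density p * dx_top t)); last by move=> t' _; rewrite L_E.
  by rewrite slotZ slot_jshift_dx_top mulr0 addr0.
rewrite -(dirder_ver V t nL Dp); exact: isD_dirder (isD_L _ _ Dp).
Qed.

Lemma Lh_G a p t : D p -> Lh a G p t =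
  \sum_d e1 (fun V => dirder (fun q => alpha d q V) (hpartial a p) p + alpha d p (jshift a V))
    (contr (bvec d) dx_top) t.
Proof.
move=> Dp; rewrite /Lh (isD_dirder (isD_G _ _ Dp)).
rewrite (@slot_ext _ _ _ _ (fun t => \sum_d e1 (alpha d p) (contr (bvec d) dx_top) t)); last first.
  by move=> t' _; rewrite G_E.
rewrite slot_sum -big_split; apply: eq_bigr => d _ /=.
rewrite slot_e1 e1_Dl; congr (_ + _).
rewrite [X in _ + X](_ : _ = 0) ?addr0 // -[RHS](e10 (alpha d p) t).
by apply: e1_ext => // t' _; exact: slot_jshift_contr.
Qed.

(** The product of dx^a with the contracted volume form is the volume form for a = d
    and vanishes otherwise, which leaves a divergence. *)
Lemma hdiff_G p s : D p -> hdiff G p s =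
  - e1 (fun V => \sum_d (dirder (fun q => alpha d q V) (hpartial d p) p +
     alpha d p (jshift d V))) dx_top s.
Proof.
move=> Dp; rewrite (hdiffE Dopen s nG Dp) /hd.
pose be a d V := dirder (fun q => alpha d q V) (hpartial a p) p + alpha d p (jshift a V).
transitivity (\sum_a \sum_d e1 (dxc a) (e1 (be a d) (contr (bvec d) dx_top)) s).
  under [RHS]eq_bigr => a _ do rewrite -e1_sum.
  rewrite -alt_sum; apply: alt_ext => V t _; apply: eq_bigr => a _.
  by rewrite Lh_G.
rewrite e1_suml -sumrN exchange_big; apply: eq_bigr => d _ /=.
have E a : e1 (dxc a) (e1 (be a d) (contr (bvec d) dx_top)) s = - ((a == d)%:R * e1 (be a d) dx_top s).
  rewrite e1_anticomm; congr (- _); rewrite -e1Z; apply: e1_ext => // t _.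
  by rewrite e1_contr_dx_top.
rewrite (bigD1 d) //= E eqxx mul1r big1 ?addr0 // => a ad.
by rewrite E (negbTE ad) mul0r oppr0.
Qed.

Lemma boundary_identity p s : D p -> hilbert_EL p s - vdiff L p s = hdiff G p s.
Proof.
move=> Dp; rewrite ELE vdiff_L // hdiff_G // -opprD -e1_Dl; congr (- _).
by apply: e1_ext => // V; rewrite (variation_hilbert_density Dopen Ddet V Dp).
Qed.

(** The trace of B with which the field acts on the volume form cancels the weight of
    the densities, and its action on the contracting coordinate field cancels the
    action on the vector index of alpha. *)
Lemma lepage_lie v p s : smooth_field U v -> D p ->
  lie (rfield v) (fun q t => L q t + G q t) p s = 0.
Proof.
move=> sv Dp; rewrite (lieE Dopen s (gat_form_add nL nG) Dp); last first.
  by move=> i; exact: (rfield_gat oU sv i (Dlor_over Dp)).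
rewrite (isD_dirder (isDD (isD_L _ s Dp) (isD_G _ s Dp))) slotD.
rewrite addrACA.
have hA V a : dxc a (Dfield (rfield v) p V) = \sum_b dxc b V * Bm v p b a.
  exact: (Dfield_inl Dlor_over sv V a Dp).
have -> : slot (Dfield (rfield v) p) (L p) s = hilbert_density p * \tr (Bm v p) * dx_top s.
  rewrite (@slot_ext _ _ _ _ (fun t => hilbert_density p * dx_top t)); last by move=> t' _; rewrite L_E.
  by rewrite slotZ (dx_top_slot s hA) mulrA.
rewrite (hilbert_density_invariant oU Dopen Ddet Dlor_over sv Dp) -mulrDl.
have -> : - \tr (Bm v p) * hilbert_density p + hilbert_density p * \tr (Bm v p) = 0 by ring.
rewrite mul0r add0r.
rewrite (@slot_ext _ _ _ _ (fun t => \sum_d e1 (alpha d p) (contr (bvec d) dx_top) t)); last first.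
  by move=> t' _; rewrite G_E.
rewrite slot_sum.
under [X in _ + X]eq_bigr => d _ do rewrite slot_e1.
rewrite big_split /= addrA -big_split /=.
have -> : \sum_d e1 (alpha d p) (slot (Dfield (rfield v) p) (contr (bvec d) dx_top)) s =
    \sum_d (\tr (Bm v p) * e1 (alpha d p) (contr (bvec d) dx_top) s -
      \sum_a Bm v p d a * e1 (alpha d p) (contr (bvec a) dx_top) s).
  apply: eq_bigr => d _; rewrite -e1Z.
  rewrite (e1_ext (a' := alpha d p) (al' := fun t => \tr (Bm v p) * contr (bvec d) dx_top t +
      - \sum_a Bm v p d a * contr (bvec a) dx_top t)) //; last first.
    by move=> t _; exact: slot_contr_dx_top.
  rewrite e1D e1N e1_sum; congr (_ - _); apply: eq_bigr => a _; exact: e1Z.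
rewrite sumrB [X in _ - X]exchange_big addrA -big_split -sumrB big1 // => d _ /=.
rewrite -e1_Dl -e1_Zl -e1_Dl.
under eq_bigr => a _ do rewrite -e1_Zl.
rewrite -e1_suml -mulN1r -e1_Zl -e1_Dl -[RHS](e10l (contr (bvec d) dx_top) s).
apply: e1_ext => // V /=.
by rewrite (alpha_invariant oU Dopen Ddet Dlor_over sv d V Dp); ring.
Qed.

End Boundary.

End Chart.

(** * The manifest diffeomorphism symmetry *)

Lemma cod_open (R : realType) (n : nat) (M : manifold R n) (i : chart M) : open (cod i).
Proof. by rewrite /cod; case: M i => T c d f g h1 h2 h3 h4 h5 h6 h7 h8 h9 i; exact: h5. Qed.

Lemma vfield_smooth (R : realType) (n : nat) (M : manifold R n) (v : vfield M) (i : chart M) :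
  smooth_field (cod i) (v i).
Proof. by case: v => v sv tr a; exact: sv. Qed.

Lemma jform_gat_form_on (R : realType) (n : nat) (M : manifold R n) (k l : nat) (w : jform M k l)
  (i : chart M) : gat_form (Dlor (cod i)) (w i).
Proof.
by apply: jform_gat_form; [exact/Dlor_open/cod_open|case: w => w h h2 h3; exact: h].
Qed.

Theorem theorem4p1 (R : realType) (n : nat) (M : manifold R n)
    (L : jform M 0 n) (gamma : jform M 1 n.-1) (EL : jform M 1 n)
    (rho : vfield M -> jvfield M)
    (hL : eq_jform L (fun=> hilbert_lagrangian))
    (hgamma : eq_jform gamma (fun=> hilbert_boundary))
    (hEL : eq_jform EL (fun=> hilbert_EL))
    (hrho : forall v : vfield M,
       eq_jvfield (rho v) (fun i p => xi (v i) p + hlift (v i) p)) :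
  lepage_invariant L gamma rho /\ manifest_diffeo_symmetry EL L gamma rho.
Proof.
have oU (i : chart M) : open (cod i) := @cod_open _ _ M i.
have sm (v : vfield M) i : smooth_field (cod i) (v i) := @vfield_smooth _ _ M v i.
have oD i : line_open (Dlor (cod i)) := Dlor_open (oU i).
have inv : lepage_invariant L gamma rho.
  move=> v i p s Dp.
  have E := lepage_lie (oU i) (jform_gat_form_on L i) (jform_gat_form_on gamma i)
    (@hL i) (@hgamma i) s (sm v i) Dp.
  by rewrite -[RHS]E; apply: (lie_on _ (oD i) Dp) => // q; exact: hrho.
split=> //; split=> // [i p s Dp||v i w hw p s Dp].
- have -> : (EL i - vdiff (L i)) p s = EL i p s - vdiff (L i) p s by [].
  rewrite hEL //; exact: (boundary_identity (oU i) (jform_gat_form_on L i)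
    (jform_gat_form_on gamma i) (@hL i) (@hgamma i)).
- split=> [k u v w hu|u v w hu] i p Dp.
    rewrite !hrho //; exact: (rfield_linear (oU i) (sm v i)
      (sm w i) (sm u i) (hu i) (Dlor_over Dp)).
  have -> : jbracket (rho v i) (rho w i) p = jbracket (rfield (v i)) (rfield (w i)) p.
    apply/funext => c; rewrite /jbracket !hrho //.
    by congr (_ - _); apply: (dirder_on _ (oD i) Dp) => q Dq; rewrite hrho.
  rewrite hrho //; exact/esym/(rfield_bracket (oU i) (sm v i)
    (sm w i) (sm u i) (hu i) (Dlor_over Dp)).
- have E q : Dlor (cod i) q -> rho v i q - hlift (v i) q = xi (v i) q.
    by move=> Dq; rewrite hrho // addrK.
  apply: (vertical_hdiff (oD i) s (jform_gat_form (oD i) hw) Dp) => [q c Dq|a|a].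
  + apply: (gat_on (oD i) Dq (f := fun q => xi (v i) q c)).
      by move=> q' Dq'; rewrite E.
    exact: (xi_gat (oU i) (sm v i) c (Dlor_over Dq)).
  + by rewrite E.
  + rewrite E // -(Dxi_hpartial (oU i) (sm v i) a (Dlor_over Dp)).
    apply/funext => c; apply: (dirder_on _ (oD i) Dp) => q Dq; by rewrite E.
Qed.
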